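(* The Lie superalgebra $\mathfrak g=SKO(n,n+1;\lambda,\underline t)$ is simple.
   Context: Setting. $\mathbb F$ is a field of characteristic $p>3$, $n\ge 3$ is an integer, $\underline t=(t_1,\dots,t_n)$ is a tuple of positive integers, $\lambda\in\mathbb F$. Put $\pi_i=p^{t_i}-1$, $\mathbb A=\{\alpha\in\mathbb N_0^n:\alpha_i\le\pi_i\ \forall i\}$, and let $\varepsilon_i$ be the $i$-th unit vector. $\mathcal O(n;\underline t)$ is the divided power algebra with basis $x^{(\alpha)}$, $\alpha\in\mathbb A$, and product $x^{(\alpha)}x^{(\beta)}=\binom{\alpha+\beta}{\alpha}x^{(\alpha+\beta)}$ (with $x^{(\gamma)}=0$ if $\gamma\notin\mathbb A$); $x_i:=x^{(\varepsilon_i)}$. $\mathcal O=\mathcal O(n;\underline t)\otimes\Lambda$, where $\Lambda$ is the exterior superalgebra in odd variables $x_{n+1},\dots,x_{2n+1}$; $\mathrm p(a)\in\mathbb Z_2$ is the parity, and formulas involving $\mathrm p(a)$ are stated for homogeneous $a$ and extended linearly. $\partial_r$ ($1\le r\le 2n+1$) is the superderivation of $\mathcal O$ (even for $r\le n$, odd for $r>n$) with $\partial_r(x^{(\alpha)})=x^{(\alpha-\varepsilon_r)}$ for $r\le n$ and $\partial_r(x_s)=\delta_{rs}$. Put $i'=i+n$ for $1\le i\le n$, $i'=i-n$ for $n+1\le i\le 2n$; $\mu(i)=0$ for $i\le n$ and $\mu(i)=1$ for $n+1\le i\le 2n+1$; $\mathfrak D=\sum_{i=1}^{2n}x_i\partial_i$;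 $\Delta=\sum_{i=1}^n\partial_i\partial_{i'}$. For $a\in\mathcal O$ let $T_H(a)=\sum_{i=1}^{2n}(-1)^{\mu(i')\mathrm p(a)}\partial_{i'}(a)\partial_i$, $D_{KO}(a)=T_H(a)+(-1)^{\mathrm p(a)}\partial_{2n+1}(a)\mathfrak D+(\mathfrak D(a)-2a)\partial_{2n+1}$, and $\mathrm{div}_\lambda(a)=(-1)^{\mathrm p(a)}2\big(\Delta(a)+(\mathfrak D-n\lambda\,\mathrm{id})\partial_{2n+1}(a)\big)$. Then $KO(n,n+1;\underline t)=\{D_{KO}(a):a\in\mathcal O\}$ is a Lie superalgebra of superderivations of $\mathcal O$, and $\mathfrak g''=SKO''(n,n+1;\lambda,\underline t)=\{D_{KO}(a):a\in\mathcal O,\ \mathrm{div}_\lambda(a)=0\}$ is a subalgebra. Put $\mathfrak g'=[\mathfrak g'',\mathfrak g'']$ and $\mathfrak g=SKO(n,n+1;\lambda,\underline t)=[\mathfrak g',\mathfrak g']$. *)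

(* Defs.v *)
From HB Require Import structures.
From mathcomp Require Import all_boot all_order all_algebra.

Set Implicit Arguments.
Unset Strict Implicit.
Unset Printing Implicit Defensive.

Import GRing.Theory.
Local Open Scope ring_scope.

(* A superspace is a vector space V with the projections P b onto its parity-b
   parts V_b (b = true is odd). *)
Section LieSuperalgebras.

Variables (F : fieldType) (V : vectType F) (P : bool -> 'End(V)).

(* The component of parity b of an endomorphism, that is, the part mapping
   each V_c to V_(b + c). *)
Definition end_part (b : bool) (f : 'End(V)) : 'End(V) :=
  \sum_(c : bool) (P (b (+) c) \o f \o P c)%VF.

(* [f, g] = f g - (-1)^(|f| |g|) g f for homogeneous f and g, extended
   bilinearly. *)
Definition sbracket (f g : 'End(V)) : 'End(V) :=
  \sum_(b : bool) \sum_(c : bool)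
    ((end_part b f \o end_part c g)%VF
     - (-1) ^+ (b && c) *: (end_part c g \o end_part b f)%VF).

(* The span of all the [f, g] with f in U and g in W; as for prodv, bases are
   enough by bilinearity (see sbracketvP). *)
Definition sbracketv (U W : {vspace 'End(V)}) : {vspace 'End(V)} :=
  <<allpairs sbracket (vbasis U) (vbasis W)>>%VS.

Definition graded_vspace (U : {vspace 'End(V)}) : Prop :=
  forall (b : bool) (f : 'End(V)), f \in U -> end_part b f \in U.

Definition lie_subsuperalgebra (g : {vspace 'End(V)}) : Prop :=
  graded_vspace g /\ (sbracketv g g <= g)%VS.

Definition lie_ideal (g I : {vspace 'End(V)}) : Prop :=
  [/\ (I <= g)%VS, graded_vspace I & (sbracketv g I <= I)%VS].

Definition simple_lie_superalgebra (g : {vspace 'End(V)}) : Prop :=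
  [/\ lie_subsuperalgebra g,
      sbracketv g g <> 0%VS &
      forall I : {vspace 'End(V)}, lie_ideal g I -> I = 0%VS \/ I = g].

Lemma end_part_is_linear b : linear (end_part b).
Proof.
move=> a f g; rewrite /end_part scaler_sumr -big_split /=; apply: eq_bigr => c _.
by rewrite comp_lfunDr comp_lfunDl -comp_lfunZr -comp_lfunZl.
Qed.

Lemma sbracketDZl a f f' g :
  sbracket (a *: f + f') g = a *: sbracket f g + sbracket f' g.
Proof.
rewrite /sbracket scaler_sumr -big_split /=; apply: eq_bigr => b _.
rewrite scaler_sumr -big_split /=; apply: eq_bigr => c _.
rewrite end_part_is_linear comp_lfunDl comp_lfunDr -comp_lfunZl -comp_lfunZr.
by rewrite scalerBr scalerDr opprD addrACA !scalerA [a * _]mulrC.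
Qed.

Lemma sbracketDZr a f g g' :
  sbracket f (a *: g + g') = a *: sbracket f g + sbracket f g'.
Proof.
rewrite /sbracket scaler_sumr -big_split /=; apply: eq_bigr => b _.
rewrite scaler_sumr -big_split /=; apply: eq_bigr => c _.
rewrite end_part_is_linear comp_lfunDl comp_lfunDr -comp_lfunZl -comp_lfunZr.
by rewrite scalerBr scalerDr opprD addrACA !scalerA [a * _]mulrC.
Qed.

Lemma sbracketvP (U W X : {vspace 'End(V)}) :
  reflect (forall f g, f \in U -> g \in W -> sbracket f g \in X)
          (sbracketv U W <= X)%VS.
Proof.
have s0l g : sbracket 0 g = 0.
  by have := sbracketDZl (-1) 0 0 g; rewrite scaler0 addr0 scaleN1r addNr.
have s0r f : sbracket f 0 = 0.
  by have := sbracketDZr (-1) f 0 0; rewrite scaler0 addr0 scaleN1r addNr.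
apply: (iffP span_subvP) => [sX f g Uf Wg | sX _ /allpairsP[[f g] [/= Uf Wg ->]]];
  last by apply: sX; exact: vbasis_mem.
rewrite (coord_vbasis Uf); elim/big_ind: _ => [|f1 f2 X1 X2|i _].
- by rewrite s0l mem0v.
- by rewrite -[f1]scale1r sbracketDZl scale1r memvD.
rewrite -[_ *: _]addr0 sbracketDZl s0l addr0 memvZ //.
rewrite (coord_vbasis Wg); elim/big_ind: _ => [|g1 g2 X1 X2|j _].
- by rewrite s0r mem0v.
- by rewrite -[g1]scale1r sbracketDZr scale1r memvD.
rewrite -[_ *: _]addr0 sbracketDZr s0r addr0 memvZ //.
apply: sX; apply/allpairsP; exists ((vbasis U)`_i, (vbasis W)`_j).
by rewrite !mem_nth ?size_tuple.
Qed.

End LieSuperalgebras.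

Section ContactSuperalgebras.

Variables (F : fieldType) (p n : nat) (t : 'I_n -> nat).

(* (alpha, u) stands for x^(alpha) x_u, where alpha i < p ^ t i and x_u is the
   product, in increasing order, of the odd variables indexed by u: the element
   j : 'I_n.+1 is the index of x_(n+1+j), so that ord_max is that of
   x_(2n+1). *)
Definition monomial := ({dffun forall i : 'I_n, 'I_(p ^ t i)} * {set 'I_n.+1})%type.

HB.instance Definition _ := Finite.on monomial.

(* The superalgebra O(n; t) (x) Lambda, by coordinates on the monomials. *)
Definition superO := {ffun monomial -> F^o}.

HB.instance Definition _ := Vector.on superO.

(* x^(alpha) x_u, which is 0 if alpha is not in A. *)
Definition xmon (alpha : 'I_n -> nat) (u : {set 'I_n.+1}) : superO :=
  [ffun m : monomial =>
     ([forall i, m.1 i == alpha i :> nat] && (m.2 == u))%:R].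

Definition on_monomials (W : lmodType F) (f : monomial -> W) (a : superO) : W :=
  \sum_(m : monomial) a m *: f m.

Lemma on_monomials_is_linear (W : lmodType F) (f : monomial -> W) :
  linear (on_monomials f).
Proof.
move=> c a b; rewrite /on_monomials scaler_sumr -big_split; apply: eq_bigr => m _.
by rewrite !ffunE scalerDl scalerA.
Qed.

HB.instance Definition _ (W : lmodType F) (f : monomial -> W) :=
  GRing.isLinear.Build F superO W *:%R (on_monomials f) (on_monomials_is_linear f).

Definition parity (b : bool) : 'End(superO) :=
  linfun (on_monomials
    (fun m => if odd #|m.2| == b then xmon (fun i => m.1 i) m.2 else 0)).

(* x_u x_v = (-1) ^ (inversions u v) x_(u :|: v) if u and v are disjoint. *)
Definition inversions (u v : {set 'I_n.+1}) : nat :=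
  #|[set ij : 'I_n.+1 * 'I_n.+1 | [&& ij.1 \in u, ij.2 \in v & (ij.2 < ij.1)%N]]|.

Definition mulmon (m m' : monomial) : superO :=
  if [disjoint m.2 & m'.2] then
    ((-1) ^+ inversions m.2 m'.2 *
     (\prod_(i < n) 'C(m.1 i + m'.1 i, m.1 i))%:R) *:
    xmon (fun i => (m.1 i + m'.1 i)%N) (m.2 :|: m'.2)
  else 0.

(* Left multiplication: lmul a b is a b. *)
Definition lmul (a : superO) : 'End(superO) :=
  on_monomials (fun m => linfun (on_monomials (mulmon m))) a.

(* d_r for r <= n *)
Definition pdeven (r : 'I_n) : 'End(superO) :=
  linfun (on_monomials (fun m =>
    if m.1 r == 0%N :> nat then 0
    else xmon (fun i => (m.1 i - (i == r))%N) m.2)).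

(* d_(n+1+j): the sign comes from moving x_(n+1+j) to the front of x_u. *)
Definition pdodd (j : 'I_n.+1) : 'End(superO) :=
  linfun (on_monomials (fun m =>
    if j \in m.2 then
      (-1) ^+ #|[set k in m.2 | (k < j)%N]| *: xmon (fun i => m.1 i) (m.2 :\ j)
    else 0)).

(* The indices 1, ..., 2n: inl i and inr i stand for the i-th and the
   (n+i)-th one. *)
Definition varidx := ('I_n + 'I_n)%type.

HB.instance Definition _ := Finite.on varidx.

Definition iprime (r : varidx) : varidx :=
  match r with inl i => inr i | inr i => inl i end.

Definition mu (r : varidx) : bool := if r is inr _ then true else false.

Definition inod (i : 'I_n) : 'I_n.+1 := widen_ord (leqnSn n) i.

Definition pd (r : varidx) : 'End(superO) :=
  match r with inl i => pdeven i | inr i => pdodd (inod i) end.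

Definition pdlast : 'End(superO) := pdodd ord_max.

Definition xvar (r : varidx) : superO :=
  match r with
  | inl i => xmon (fun k => (k == i) : nat) set0
  | inr i => xmon (fun=> 0%N) [set inod i]
  end.

Definition euler : 'End(superO) := \sum_(r : varidx) (lmul (xvar r) \o pd r)%VF.

Definition Delta : 'End(superO) :=
  \sum_(i < n) (pd (inl i) \o pd (iprime (inl i)))%VF.

(* For b the parity of a; in general, the sums over b below decompose a into
   its homogeneous parts. *)
Definition TH_hom (b : bool) (a : superO) : 'End(superO) :=
  \sum_(r : varidx) (-1) ^+ (mu (iprime r) && b) *: (lmul (pd (iprime r) a) \o pd r)%VF.

Definition DKO_hom (b : bool) (a : superO) : 'End(superO) :=
  TH_hom b a + (-1) ^+ b *: (lmul (pdlast a) \o euler)%VF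
  + (lmul (euler a - 2 *: a) \o pdlast)%VF.

Definition DKO (a : superO) : 'End(superO) := \sum_(b : bool) DKO_hom b (parity b a).

Definition divKO (lambda : F) : 'End(superO) :=
  \sum_(b : bool) ((-1) ^+ b * 2) *:
    ((Delta + ((euler - (n%:R * lambda) *: \1) \o pdlast)) \o parity b)%VF.

Lemma DKO_is_linear : linear DKO.
Proof.
have lmulL : linear lmul by move=> c a b; exact: linearP.
have compL (f : superO -> superO) (g : 'End(superO)) :
    linear f -> linear (fun a => (lmul (f a) \o g)%VF).
  by move=> fL c a b; rewrite fL lmulL comp_lfunDl -comp_lfunZl.
move=> c a b; rewrite /DKO scaler_sumr -big_split; apply: eq_bigr => e _ /=.
have fL (f : 'End(superO)) : linear f by exact: linearP.
rewrite fL /DKO_hom /TH_hom; move: (parity e a) (parity e b) => a' b'.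
have eL : linear (fun u : superO => euler u - 2 *: u).
  move=> d u v; rewrite fL scalerDr opprD addrACA scalerBr !scalerA.
  by rewrite [2 * d]mulrC.
rewrite (compL _ pdlast eL c a' b') !scalerDr [RHS]addrACA; congr (_ + _).
rewrite [RHS]addrACA; congr (_ + _); last first.
  rewrite (compL _ euler (fL pdlast) c a' b') scalerDr !scalerA.
  by rewrite [c * _]mulrC.
rewrite scaler_sumr -big_split; apply: eq_bigr => r _ /=.
rewrite (compL _ (pd r) (fL (pd (iprime r))) c a' b') scalerDr !scalerA.
by rewrite [c * _]mulrC.
Qed.

HB.instance Definition _ :=
  GRing.isLinear.Build F superO 'End(superO) *:%R DKO DKO_is_linear.

(* SKO''(n, n+1; lambda, t), SKO' and SKO *)
Definition SKO2 (lambda : F) : {vspace 'End(superO)} :=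
  (linfun DKO @: lker (divKO lambda))%VS.

Definition SKO1 (lambda : F) : {vspace 'End(superO)} :=
  sbracketv parity (SKO2 lambda) (SKO2 lambda).

Definition SKO (lambda : F) : {vspace 'End(superO)} :=
  sbracketv parity (SKO1 lambda) (SKO1 lambda).

End ContactSuperalgebras.

(* Main.v *)
Require Import Defs.
From HB Require Import structures.
From mathcomp Require Import all_boot all_order all_algebra.
From mathcomp Require Import ring zify.

Set Implicit Arguments.
Unset Strict Implicit.
Unset Printing Implicit Defensive.

Import GRing.Theory.
Local Open Scope ring_scope.

(* Write D a for D_KO(a) and nab i = D(x_i), nabp i = D(x_{i'}); with D(1) these
   span the negative part of the grading in which x_1, ..., x_2n have degree 1
   and x_{2n+1} has degree 2.  Elements killed by all nab i and nabp i are
   constant (transitivity).  The identity [D a, D b] = D <a, b> is directly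
   computed when a is some x_r; in general the defect is annihilated by the
   negative part by induction on the total degree, hence is a constant, hence
   vanishes for degree reasons.  The same argument shows that the kernel of the
   divergence is closed under the bracket.

   Let L be the algebra of divergence-free elements.  The torus of the
   h_i = x_i x_{i'} acts on monomials with weights in the prime field.  Choose a
   combination tau of the differences h_i - h_j for which every x_r has nonzero
   weight, and let A = [tau, L] be the sum of the nonzero weight spaces.
   Then B = A + [A, A] is an ideal of L, and any nonzero ideal of g = L''
   contains D(1) by transitivity, hence all D(x_r), hence tau, hence A and B.
   It remains to see that g is contained in B.  Since multiplication by h_i
   is a homotopy for Delta away from h_i-weight 1, every element of L of another
   weight lies in [N, L] + F G, where N is spanned by the D(x_r) and G is the
   element of top degree, of weight 2.  Brackets of elements of weights 1 and 2
   have weights 2, 3 or vanish, so [L, L] is contained in B + F G,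
   and [L', L'] is contained in B. *)

(** * Lie superalgebras of endomorphisms *)

Import VectorInternalTheory.

(** Why [h] and [tau] are separate: a single h_i has constant nonzero divergence, so it acts on L
    only as an outer derivation. The combination tau has coefficients of sum zero, which makes it
    divergence-free.

    Why the weight matters: the homotopy recovers a - [h_i, a], which is zero exactly when a has
    h_i-weight 1. Weights are only defined modulo p, so no bound on exponents excludes weight 1, and
    that component is treated by bracketing once more.

    Why G appears: its leading monomial is the only one without x_{2n+1} that is not a partial
    derivative of another one. Whether G is itself a bracket is never decided, so no case
    distinction on lambda occurs; G disappears in the second derived algebra because [G, G] = 0 and
    B is an ideal.

    Three indices are needed to bring h_i - h_j back: with k different from i and j, it is obtained
    by applying D(x_k) to x_{k'}(h_i - h_j), which is divergence-free of nonzero weight. *)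

Lemma vect_coordP (F : fieldType) (V : vectType F) (a b : V) :
  (forall phi : V -> F, (forall x y, phi (x + y) = phi x + phi y) ->
    (forall x, phi (- x) = - phi x) -> (forall c x, phi (c *: x) = c * phi x) ->
    phi 0 = 0 -> phi a = phi b) -> a = b.
Proof.
move=> h; apply: (can_inj v2rK); apply/rowP => i; apply: (h (fun x => v2r x 0 i)) => *;
  by rewrite ?(linearD, linearN, linearZ, linear0) !mxE.
Qed.

(** The vectors disappear behind an arbitrary linear function [phi], which leaves an identity in [F]
    whose atoms are the values [phi v]. *)
Ltac vect_push :=
  let phi := fresh "phi" in let phiD := fresh in let phiN := fresh in
  let phiZ := fresh in let phi0 := fresh in
  apply: vect_coordP => phi phiD phiN phiZ phi0; rewrite ?(phiD, phiN, phiZ, phi0).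
(* Linear identities in a vector space, checked on coordinates. *)
Ltac vect_ring := vect_push; ring.
Ltac vect_field := vect_push; field.

Section EndLinear.
Variables (F : fieldType) (V : vectType F).
Lemma endP (f : 'End(V)) c (a b : V) : f (c *: a + b) = c *: f a + f b.
Proof. exact: linearP. Qed.
Lemma end0 (f : 'End(V)) : f 0 = 0. Proof. exact: linear0. Qed.
Lemma endD (f : 'End(V)) (a b : V) : f (a + b) = f a + f b.
Proof. exact: linearD. Qed.
Lemma endN (f : 'End(V)) (a : V) : f (- a) = - f a.
Proof. exact: linearN. Qed.
Lemma endB (f : 'End(V)) (a b : V) : f (a - b) = f a - f b.
Proof. exact: linearB. Qed.
Lemma endZ (f : 'End(V)) c (a : V) : f (c *: a) = c *: f a.
Proof. exact: linearZ. Qed.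

End EndLinear.

Section LieTheory.
Variables (F : fieldType) (V : vectType F) (P : bool -> 'End(V)).
Hypothesis two_neq0 : 2 != 0 :> F.
Hypothesis PP : forall b c, (P b \o P c)%VF = if b == c then P b else 0.
Hypothesis P_sum : P false + P true = \1%VF.

Local Notation br := (sbracket P).
Local Notation brv := (sbracketv P).

(* [psign] and [hat] are sealed so that rewriting does not unfold them. *)
Lemma psign_subproof : {f : 'End(V) | forall v, f v = P false v - P true v}.
Proof. by exists (P false - P true) => v; rewrite add_lfunE opp_lfunE. Qed.
Definition psign : 'End(V) := sval psign_subproof.
Lemma psignBE v : psign v = P false v - P true v.
Proof. exact: (svalP psign_subproof). Qed.

Lemma hat_subproof : {h : 'End(V) -> 'End(V) | forall f v, h f v = psign (f (psign v))}.
Proof. by exists (fun f => psign \o f \o psign)%VF => f v; rewrite !comp_lfunE. Qed.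
Definition hat : 'End(V) -> 'End(V) := sval hat_subproof.
Lemma hatE f v : hat f v = psign (f (psign v)).
Proof. exact: (svalP hat_subproof). Qed.

Lemma PPE b c v : P b (P c v) = if b == c then P b v else 0.
Proof. by have /lfunP/(_ v) := PP b c; rewrite comp_lfunE => ->; case: ifP;
  rewrite ?lfunE. Qed.

Lemma PfE v : P false v = v - P true v.
Proof. by have /lfunP/(_ v) := P_sum; rewrite add_lfunE id_lfunE => {2}<-; rewrite addrK. Qed.

Lemma psignE v : psign v = v - 2 *: P true v.
Proof. by rewrite psignBE PfE; vect_ring. Qed.

Lemma psignKE v : psign (psign v) = v.
Proof. by rewrite !psignE !linearB !linearZ /= !PPE /=; vect_ring. Qed.

Lemma hatK f : hat (hat f) = f.
Proof. by apply/lfunP => v; rewrite !hatE !psignKE. Qed.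

(** Conjugation by the parity automorphism fixes the even part of [f] and negates the odd part, so
    the parts are the half sum and the half difference of [f] and [hat f]. *)
Lemma end_partE b f : end_part P b f = 2^-1 *: (f + (-1) ^+ b *: hat f).
Proof.
apply/lfunP => v; rewrite /end_part sum_lfunE big_bool.
rewrite !comp_lfunE !(scale_lfunE,
  add_lfunE) hatE !psignE /= !linearB !linearZ /= !PfE !linearB /=.
by case: b => /=; rewrite ?expr1 ?expr0 ?PfE ?linearB /=;
  move: (P true (f (P true v))) (f (P true v)) (P true (f v)) (f v) => a b c d; vect_field.
Qed.

Lemma end_part_sum f : f = end_part P false f + end_part P true f.
Proof.
rewrite !end_partE expr0 expr1 scale1r scaleN1r -scalerDr addrACA subrr addr0.
by rewrite -mulr2n -scaler_nat scalerA mulVf // scale1r.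
Qed.

Lemma hat_end_part f : hat f = end_part P false f - end_part P true f.
Proof.
rewrite !end_partE expr0 expr1 scale1r scaleN1r -scalerBr opprD opprK addrACA subrr add0r.
rewrite -mulr2n -scaler_nat scalerA mulVf ?scale1r //.
Qed.

(** Carrying the odd part of [f] past [g] costs the sign (-1)^|g|, which [hat g] supplies. Only [f]
    is still split into parts. *)
Lemma sbracketE f g :
  br f g = (f \o g)%VF - (g \o end_part P false f)%VF - (hat g \o end_part P true f)%VF.
Proof.
rewrite /sbracket !big_bool /= hat_end_part.
move: (end_part_sum f) (end_part_sum g).
move: (end_part P false f) (end_part P true f) (end_part P false g) (end_part P true g).
move=> f0 f1 g0 g1 -> ->; rewrite expr0 expr1 !scale1r scaleN1r opprK.
rewrite !(comp_lfunDl, comp_lfunDr) comp_lfunNl.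
move: (f0 \o g0)%VF (f0 \o g1)%VF (f1 \o g0)%VF (f1 \o g1)%VF (g0 \o f0)%VF (g0 \o f1)%VF
  (g1 \o f0)%VF (g1 \o f1)%VF => a b c d a' b' c' d'.
vect_ring.
Qed.

End LieTheory.

(** * Bracket calculus without homogeneity assumptions *)

Section LieAlgebra.
Variables (F : fieldType) (V : vectType F) (P : bool -> 'End(V)).
Hypothesis two_neq0 : 2 != 0 :> F.
Hypothesis PP : forall b c, (P b \o P c)%VF = if b == c then P b else 0.
Hypothesis P_sum : P false + P true = \1%VF.

Local Notation br := (sbracket P).
Local Notation brv := (sbracketv P).
Local Notation hat := (hat P).
Local Notation ep := (end_part P).
Implicit Types (f g h X Y : 'End(V)) (U W : {vspace 'End(V)}).

Lemma sbracket_is_linear f : linear (br f).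
Proof. by move=> a x y; rewrite sbracketDZr. Qed.
HB.instance Definition _ f :=
  GRing.isLinear.Build F 'End(V) 'End(V) *:%R (sbracket P f) (sbracket_is_linear f).

Lemma brDr f g h : br f (g + h) = br f g + br f h.
Proof. by rewrite -[g]scale1r sbracketDZr !scale1r. Qed.
Lemma br0r f : br f 0 = 0.
Proof. by have := sbracketDZr P (-1) f 0 0; rewrite scaler0 addr0 scaleN1r addNr. Qed.
Lemma brZr a f g : br f (a *: g) = a *: br f g.
Proof. by rewrite -[a *: g]addr0 sbracketDZr br0r addr0. Qed.
Lemma brBr f g h : br f (g - h) = br f g - br f h.
Proof. by rewrite brDr -scaleN1r brZr scaleN1r. Qed.
Lemma br0l f : br 0 f = 0.
Proof. by have := sbracketDZl P (-1) 0 0 f; rewrite scaler0 addr0 scaleN1r addNr. Qed.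
Lemma brZl a f g : br (a *: f) g = a *: br f g.
Proof. by rewrite -[a *: f]addr0 sbracketDZl br0l addr0. Qed.
Lemma brDl f g h : br (f + g) h = br f h + br g h.
Proof. by rewrite -[f]scale1r sbracketDZl !scale1r. Qed.
Lemma brNl f g : br (- f) g = - br f g.
Proof. by rewrite -scaleN1r brZl scaleN1r. Qed.

Lemma hat_is_linear : linear hat.
Proof.
move=> a f g; apply/lfunP => v; rewrite !(hatE, add_lfunE, scale_lfunE).
by rewrite linearD linearZ.
Qed.
HB.instance Definition _ :=
  GRing.isLinear.Build F 'End(V) 'End(V) *:%R hat hat_is_linear.

Let hatK f : hat (hat f) = f. Proof. exact: hatK. Qed.
Let pK v : psign P (psign P v) = v. Proof. exact: psignKE. Qed.

Lemma hat_comp f g : hat (f \o g)%VF = (hat f \o hat g)%VF.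
Proof. by apply/lfunP => v; rewrite !(hatE, comp_lfunE) pK. Qed.

Lemma brE f g : br f g = (f \o g)%VF - (g \o ep false f)%VF - (hat g \o ep true f)%VF.
Proof. exact: sbracketE. Qed.

Lemma ep0E f : ep false f = 2^-1 *: (f + hat f).
Proof. by rewrite end_partE // expr0 scale1r. Qed.
Lemma ep1E f : ep true f = 2^-1 *: (f - hat f).
Proof. by rewrite end_partE // expr1 scaleN1r. Qed.

Lemma hat_ep0 f : hat (ep false f) = ep false f.
Proof. by rewrite ep0E linearZ linearD /= hatK addrC. Qed.
Lemma hat_ep1 f : hat (ep true f) = - ep true f.
Proof. by rewrite ep1E linearZ linearB /= hatK -scalerN opprB. Qed.
Lemma ep_sum f : f = ep false f + ep true f.
Proof. exact: end_part_sum. Qed.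

Lemma half_double f : 2^-1 *: (f + f) = f.
Proof. by rewrite -mulr2n -scaler_nat scalerA mulVf // scale1r. Qed.

Lemma br_even f g : hat f = f -> br f g = (f \o g)%VF - (g \o f)%VF.
Proof.
move=> e; rewrite brE ep0E ep1E e subrr scaler0 half_double.
by rewrite comp_lfun0r subr0.
Qed.
Lemma br_odd f g : hat f = - f -> br f g = (f \o g)%VF - (hat g \o f)%VF.
Proof.
move=> e; rewrite brE ep0E ep1E e subrr scaler0 opprK half_double.
by rewrite comp_lfun0r subr0.
Qed.

Lemma hat_br f g : hat (br f g) = br (hat f) (hat g).
Proof.
have h0 : ep false (hat f) = hat (ep false f) by rewrite hat_ep0 !ep0E hatK addrC.
have h1 : ep true (hat f) = hat (ep true f) by rewrite hat_ep1 !ep1E hatK -scalerN opprB.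
by rewrite !brE !linearB /= !hat_comp hatK h0 h1.
Qed.

Lemma br_antisym_even f g : hat f = f -> br f g = - br g f.
Proof.
move=> e; rewrite br_even // brE e {1}(ep_sum g) comp_lfunDr.
by move: (f \o _)%VF (f \o _)%VF (_ \o f)%VF => a b c; vect_ring.
Qed.
Lemma br_antisym_odd f g : hat f = - f -> br f g = - br (hat g) f.
Proof.
move=> e; rewrite br_odd // brE e comp_lfunNl opprK.
rewrite ep0E ep1E hatK [hat g + g]addrC -ep0E -[hat g - g]opprB scalerN -ep1E comp_lfunNr.
rewrite {1}(ep_sum g) comp_lfunDr; move: (f \o _)%VF (f \o _)%VF (_ \o f)%VF => a b c.
by vect_ring.
Qed.

Lemma jacobi_even f g h : hat f = f -> br f (br g h) = br (br f g) h + br g (br f h).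
Proof.
move=> e; have e2 X : br f X = (f \o X)%VF - (X \o f)%VF by exact: br_even.
have hf X : hat (br f X) = br f (hat X) by rewrite hat_br e.
have e0 X : ep false (br f X) = br f (ep false X).
  by rewrite !ep0E hf brZr brDr.
have e1 X : ep true (br f X) = br f (ep true X).
  by rewrite !ep1E hf brZr brBr.
rewrite (brE g h) (brE (br f g) h) (brE g (br f h)) e0 e1 hf !e2.
move: (ep false g) (ep true g) (hat h) => g0 g1 h'.
apply/lfunP => v; rewrite !(add_lfunE, opp_lfunE, comp_lfunE) !(endD, endN).
by vect_ring.
Qed.

(** The sign (-1)^|g| of the odd case is carried by [hat g], so neither [g] nor [h] has to be
    homogeneous. *)
Lemma jacobi_odd f g h : hat f = - f -> br f (br g h) = br (br f g) h + br (hat g) (br f h).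
Proof.
move=> e; have e2 X : br f X = (f \o X)%VF - (hat X \o f)%VF by exact: br_odd.
have hf X : hat (br f X) = - br f (hat X).
  by rewrite hat_br e brNl.
have e0 X : ep false (br f X) = br f (ep true X).
  by rewrite ep0E ep1E hf brZr brBr.
have e1 X : ep true (br f X) = br f (ep false X).
  by rewrite ep0E ep1E hf opprK brZr brDr.
have e0' X : ep false (hat X) = ep false X by rewrite !ep0E hatK addrC.
have e1' X : ep true (hat X) = - ep true X by rewrite !ep1E hatK -scalerN opprB.
have hg : hat g = ep false g - ep true g by exact: hat_end_part.
rewrite (brE g h) (brE (br f g) h) (brE (hat g) (br f h)) e0 e1 e0' e1' hf !e2.
rewrite !linearB /= !hat_comp hat_ep0 hat_ep1 !hatK.
move: (ep_sum g) hg; move: (ep false g) (ep true g) (hat h) => g0 g1 h' -> ->.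
apply/lfunP => v; rewrite !(add_lfunE, opp_lfunE, comp_lfunE) !(endD, endN).
by vect_ring.
Qed.

Definition hatv U : Prop := forall f, f \in U -> hat f \in U.

Lemma hatvP U : graded_vspace P U <-> hatv U.
Proof.
split=> h f => [Uf|g Ug]; last first.
  by case: f; rewrite ?ep0E ?ep1E memvZ //; [apply: memvB|apply: memvD] => //; apply: h.
by rewrite (hat_end_part two_neq0 P_sum) memvB // h.
Qed.

Lemma memv_brv U W f g : f \in U -> g \in W -> br f g \in brv U W.
Proof. by move=> Uf Wg; move/sbracketvP: (subvv (brv U W)) => h; apply: h. Qed.

Lemma brvS U U' W W' : (U <= U')%VS -> (W <= W')%VS -> (brv U W <= brv U' W')%VS.
Proof.
by move=> /subvP sU /subvP sW; apply/sbracketvP => f g /sU Uf /sW Wg; apply: memv_brv.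
Qed.

Lemma brv_ind (phi : {linear 'End(V) -> 'End(V)}) U W (X : {vspace 'End(V)}) :
  (forall f g, f \in U -> g \in W -> phi (br f g) \in X) ->
  forall y, y \in brv U W -> phi y \in X.
Proof.
move=> h y; suff /subvP s : (brv U W <= linfun phi @^-1: X)%VS.
  by move/s; rewrite -memv_preim lfunE.
by apply/sbracketvP => f g Uf Wg; rewrite -memv_preim lfunE; apply: h.
Qed.

Lemma hatv_brv U W : hatv U -> hatv W -> hatv (brv U W).
Proof.
move=> hU hW; apply: (brv_ind (phi := hat)) => f g Uf Wg /=.
by rewrite hat_br; apply: memv_brv; [apply: hU|apply: hW].
Qed.
Lemma hatvD U W : hatv U -> hatv W -> hatv (U + W).
Proof. by move=> hU hW f /memv_addP[u Uu [w Ww ->]]; rewrite linearD memv_add ?hU ?hW. Qed.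
Lemma hatv_line f : hat f = f \/ hat f = - f -> hatv <[f]>.
Proof.
move=> e g /vlineP[k ->]; rewrite linearZ /=.
by case: e => ->; rewrite ?scalerN ?memvN memvZ ?memv_line.
Qed.

Lemma ep_mem U f : hatv U -> f \in U -> ep false f \in U /\ ep true f \in U.
Proof. by move=> /hatvP h Uf; split; apply: h. Qed.

Lemma brv_sym U W : hatv U -> hatv W -> (brv U W <= brv W U)%VS.
Proof.
move=> hU hW; apply/sbracketvP => f g Uf Wg; have [U0 U1] := ep_mem hU Uf.
rewrite (ep_sum f) brDl (br_antisym_even _ (hat_ep0 f)) (br_antisym_odd _ (hat_ep1 f)).
by rewrite memvD ?memvN // memv_brv // hW.
Qed.

(** Graded subspaces contain the even and odd parts of their elements, so both Jacobi identities for
    elements apply, and all signs disappear at the level of subspaces. *)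
Lemma brv_jacobi U W (X : {vspace 'End(V)}) : hatv U -> hatv W ->
  (brv U (brv W X) <= brv (brv U W) X + brv W (brv U X))%VS.
Proof.
move=> hU hW; apply/sbracketvP => f y Uf; have [U0 U1] := ep_mem hU Uf.
move: y; apply: (brv_ind (phi := br f)) => g h Wg Xh /=.
rewrite (ep_sum f) brDl (jacobi_even _ _ (hat_ep0 f)) (jacobi_odd _ _ (hat_ep1 f)).
by apply: memvD; apply: memv_add; apply: memv_brv => //; rewrite ?memv_brv // hW.
Qed.

Lemma brvDl U U' W : (brv (U + U') W <= brv U W + brv U' W)%VS.
Proof.
apply/sbracketvP => f g /memv_addP[u Uu [w Ww ->]] Wg.
by rewrite brDl memv_add // memv_brv.
Qed.
Lemma brvDr U W W' : (brv U (W + W') <= brv U W + brv U W')%VS.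
Proof.
apply/sbracketvP => f g Uf /memv_addP[u Uu [w Ww ->]].
by rewrite brDr memv_add // memv_brv.
Qed.

(** * A simplicity criterion for the second derived algebra *)

Section Criterion.
Variables (L N : {vspace 'End(V)}) (tau h G u : 'End(V)).
Local Notation A := (brv <[tau]> L).
Local Notation L1 := (brv L L).
Local Notation L2 := (brv L1 L1).
Hypothesis L_hat : hatv L.
Hypothesis L_closed : (L1 <= L)%VS.
Hypothesis tau_even : hat tau = tau.
Hypothesis tau_L : tau \in L.
(** Semisimplicity of ad [tau] at weight 0: its kernel and its image together span [L]. *)
Hypothesis tau_split : forall X, X \in L -> exists2 Y, Y \in L & br tau (X - br tau Y) = 0.
Hypothesis N_A : (N <= A)%VS.
Hypothesis tau_NA : tau \in brv N A.
Hypothesis u_neq0 : u <> 0.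
Hypothesis u_NN : u \in brv N N.
Hypothesis N_uA : (N <= brv <[u]> A)%VS.
Hypothesis transitive : forall I, (I <= L)%VS -> I <> 0%VS -> (brv N I <= I)%VS -> u \in I.
Hypothesis h_even : hat h = h.
(** The same decomposition for 1 - ad [h] in place of ad [tau]: what remains of [X] has [h]-weight
    1, the weight on which [NLG] gives no information. *)
Hypothesis h_split : forall X, X \in L ->
  exists2 Y, Y \in L & br h (X - (Y - br h Y)) = X - (Y - br h Y).
(** [h] normalizes [L] but is not assumed to lie in it, since x_i x_{i'} has nonzero divergence. *)
Hypothesis h_L : forall X, X \in L -> br h X \in L.
Hypothesis G_L : G \in L.
Hypothesis G_h : br h G = 2 *: G.
Hypothesis G_G : br G G = 0.
Hypothesis NLG : forall X, X \in L -> X - br h X \in (brv N L + <[G]>)%VS.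

Local Notation T := (<[tau]>%VS).
Let B := (A + brv A A)%VS.

Let T_hat : hatv T. Proof. by apply: hatv_line; left. Qed.
Let A_hat : hatv A. Proof. exact: hatv_brv. Qed.
Let T_L : (T <= L)%VS. Proof. by rewrite -memvE. Qed.
Let A_L : (A <= L)%VS. Proof. exact: subv_trans (brvS T_L (subvv L)) L_closed. Qed.
Let N_L : (N <= L)%VS. Proof. exact: subv_trans N_A A_L. Qed.
Let L0 := (L :&: lker (linfun (br tau)))%VS.
Let L0_L : (L0 <= L)%VS. Proof. exact: capvSl. Qed.
Let L0_hat : hatv L0.
Proof.
move=> f; rewrite !memv_cap !memv_ker !lfunE /= => /andP[Lf /eqP e]; rewrite L_hat //=.
by rewrite -tau_even -hat_br e linear0.
Qed.
Let L_split : (L <= L0 + A)%VS.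
Proof.
apply/subvP => X LX; have [Y LY e] := tau_split LX.
rewrite -[X](subrK (br tau Y)) memv_add //; last by rewrite memv_brv ?memv_line.
rewrite memv_cap memv_ker lfunE /= e eqxx andbT memvB //.
by apply: (subvP A_L); rewrite memv_brv ?memv_line.
Qed.
Let TL0 : (brv T L0 <= 0)%VS.
Proof.
apply/sbracketvP => f g /vlineP[k ->]; rewrite memv_cap memv_ker lfunE /= => /andP[_ /eqP e].
by rewrite brZl e scaler0 mem0v.
Qed.
(** ad [tau] kills [L0], so all of its image is already obtained from [A]. This is what keeps [A]
    inside the derived algebras once [tau] is there. *)
Let A_TA : (A <= brv T A)%VS.
Proof.
apply: subv_trans (brvS (subvv T) L_split) _; apply: subv_trans (brvDr _ _ _) _.
by rewrite subv_add subvv andbT; apply: subv_trans TL0 (sub0v _).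
Qed.
(** By Jacobi, [L0, [tau, L]] lies in [[L0, tau], L] + [tau, [L0, L]], and the first summand is
    zero. *)
Let L0A : (brv L0 A <= A)%VS.
Proof.
apply: subv_trans (brv_jacobi _ L0_hat T_hat) _; rewrite subv_add; apply/andP; split.
  apply: (@subv_trans _ _ (brv 0 L)); first apply: brvS => //.
    exact: subv_trans (brv_sym L0_hat T_hat) TL0.
  by apply/sbracketvP => f g; rewrite memv0 => /eqP -> _; rewrite br0l mem0v.
by apply: brvS => //; apply: subv_trans (brvS L0_L (subvv L)) L_closed.
Qed.
Let A_B : (A <= B)%VS. Proof. exact: addvSl. Qed.
Let AA_B : (brv A A <= B)%VS. Proof. exact: addvSr. Qed.
Let LA_B : (brv L A <= B)%VS.
Proof.
apply: subv_trans (brvS L_split (subvv A)) _; apply: subv_trans (brvDl _ _ _) _.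
by rewrite subv_add AA_B (subv_trans L0A A_B).
Qed.
(** On the summand [A, A], [L0] acts by derivations that preserve [A], while [A] itself only meets
    it inside [A, L]. *)
Let LB : (brv L B <= B)%VS.
Proof.
apply: subv_trans (brvDr _ _ _) _; rewrite subv_add LA_B /=.
apply: subv_trans (brvS L_split (subvv _)) _; apply: subv_trans (brvDl _ _ _) _.
rewrite subv_add; apply/andP; split.
  apply: subv_trans (brv_jacobi _ L0_hat A_hat) _; rewrite subv_add.
  by rewrite !(subv_trans (brvS _ _) AA_B).
apply: subv_trans (brvS (subvv A) (_ : _ <= L)%VS) _.
  exact: subv_trans (brvS A_L A_L) L_closed.
exact: subv_trans (brv_sym A_hat L_hat) LA_B.
Qed.
Let B_hat : hatv B. Proof. by apply: hatvD => //; apply: hatv_brv. Qed.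
Let BL : (brv B L <= B)%VS. Proof. exact: subv_trans (brv_sym B_hat L_hat) LB. Qed.
Let NL_B : (brv N L <= B)%VS.
Proof. exact: subv_trans (brvS (subv_trans N_A A_B) (subvv L)) BL. Qed.

Let A_L1 : (A <= L1)%VS. Proof. exact: brvS. Qed.
Let T_L1 : (T <= L1)%VS.
Proof. by rewrite -memvE; apply: (subvP (brvS N_L A_L)). Qed.
Let A_L2 : (A <= L2)%VS. Proof. exact: subv_trans A_TA (brvS T_L1 A_L1). Qed.
Let N_L2 : (N <= L2)%VS. Proof. exact: subv_trans N_A A_L2. Qed.
Let L1_hat : hatv L1. Proof. exact: hatv_brv. Qed.
Let L2_hat : hatv L2. Proof. exact: hatv_brv. Qed.
Let L2_L1 : (L2 <= L1)%VS. Proof. exact: brvS. Qed.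

Let BG X : X \in L -> X - br h X \in (B + <[G]>)%VS.
Proof. by move=> LX; apply: (subvP (addvS NL_B (subvv _))); apply: NLG. Qed.

(** [BG] puts (1 - c) X into the sum, and 1 - c can be divided out. *)
Let eigenBG X (c : F) : X \in L -> br h X = c *: X -> 1 - c != 0 -> X \in (B + <[G]>)%VS.
Proof.
move=> LX e c1; have := BG LX; rewrite e -{1}[X]scale1r -scalerBl => /(memvZ (1 - c)^-1).
by rewrite scalerA mulVf // scale1r.
Qed.

Let L1_BG : (L1 <= B + <[G]>)%VS.
Proof.
have closed X Y : X \in L -> Y \in L -> br X Y \in L.
  by move=> LX LY; apply: (subvP L_closed); apply: memv_brv.
have Bl X Y : X \in B -> Y \in L -> br X Y \in (B + <[G]>)%VS.
  by move=> BX LY; apply/(subvP (addvSl _ _))/(subvP BL)/memv_brv.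
have Br X Y : X \in L -> Y \in B -> br X Y \in (B + <[G]>)%VS.
  by move=> BX LY; apply/(subvP (addvSl _ _))/(subvP LB)/memv_brv.
have B_L : (B <= L)%VS by rewrite subv_add A_L (subv_trans (brvS A_L A_L)).
have split X : X \in L -> exists X0, exists b, exists k : F, [/\ X0 \in L, br h X0 = X0,
    b \in B & X = X0 + (b + k *: G)].
  (* The remainder [X - (Y - br h Y)] is the part of weight 1, and the subtracted term falls into
     [B] plus multiples of [G]. *)
  move=> LX; have [Y LY e] := h_split LX.
  have /memv_addP[b Bb [_ /vlineP[k ->] eY]] := BG LY.
  exists (X - (Y - br h Y)), b, k; split=> //; last by rewrite -eY subrK.
  by rewrite !memvB // h_L.
apply/sbracketvP => X Y /split[X0 [b [k [LX0 eX Bb ->]]]] /split[Y0 [b' [k' [LY0 eY Bb' ->]]]].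
have LB' : b' \in L by apply: (subvP B_L).
have m1 : br X0 Y0 \in (B + <[G]>)%VS.
  apply: (@eigenBG _ 2); first exact: closed.
    by rewrite jacobi_even // eX eY -mulr2n scaler_nat.
  by rewrite (_ : 1 - 2 = -1) ?oppr_eq0 ?oner_neq0 //; ring.
have three (Z : 'End(V)) : Z + 2 *: Z = 3 *: Z.
  by rewrite -{1}[Z]scale1r -scalerDl; congr (_ *: _); ring.
(* A bracket of [G] (weight 2) with a part of weight 1 has weight 3, and 3 differs from 1 because 2
   is invertible. *)
have c3 : 1 - 3 != 0 :> F by rewrite (_ : 1 - 3 = - 2) ?oppr_eq0 //; ring.
have m2 : br X0 G \in (B + <[G]>)%VS.
  apply: (@eigenBG _ 3) => //; first exact: closed.
  by rewrite jacobi_even // eX G_h brZr three.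
have m3 : br G Y0 \in (B + <[G]>)%VS.
  apply: (@eigenBG _ 3) => //; first exact: closed.
  by rewrite jacobi_even // eY G_h brZl addrC three.
rewrite !(brDl, brDr, brZl, brZr) G_G !scaler0 addr0.
by repeat first [exact: m1 | exact: m2 | exact: m3 | by apply: Bl | by apply: Br
  | apply: memvD | apply: memvZ].
Qed.

(** In a bracket of two elements of B + F G, only [G, G] could leave the ideal [B], and it is
    zero. *)
Let L2_B : (L2 <= B)%VS.
Proof.
apply/sbracketvP => X Y /(subvP L1_BG)/memv_addP[b Bb [_ /vlineP[k ->] ->]].
move=> /(subvP L1_BG)/memv_addP[b' Bb' [_ /vlineP[k' ->] ->]].
have B_L : (B <= L)%VS by rewrite subv_add A_L (subv_trans (brvS A_L A_L)).
rewrite !(brDl, brDr, brZl, brZr) G_G !scaler0 addr0.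
have LB' : b' \in L by apply: (subvP B_L).
by repeat first [by apply: (subvP BL); apply: memv_brv | by apply: (subvP LB); apply: memv_brv
  | apply: memvD | apply: memvZ].
Qed.

Theorem simple_criterion : simple_lie_superalgebra P L2.
Proof.
split.
- by split; [apply/hatvP|apply: brvS].
(* [N] survives in [L2], so a vanishing derived algebra would still contain [N, N] and hence [u]. *)
- move=> e; apply: u_neq0; apply/eqP; rewrite -memv0 -e.
  by apply: (subvP (brvS N_L2 N_L2)).
move=> I [I_L2 /hatvP I_hat I_ideal].
have [->|/eqP I0] := eqVneq I 0%VS; [by left|right].
apply: subv_anti; rewrite I_L2 /=.
have idl (X : {vspace 'End(V)}) : (X <= L2)%VS -> (brv X I <= I)%VS.
  by move=> sX; apply: subv_trans (brvS sX (subvv I)) I_ideal.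
have idr (X : {vspace 'End(V)}) : (X <= L2)%VS -> (brv I X <= I)%VS.
  move=> sX; apply: subv_trans (brvS (subvv I) sX) _.
  exact: subv_trans (brv_sym I_hat L2_hat) I_ideal.
have uI : (<[u]> <= I)%VS.
  rewrite -memvE; apply: transitive I0 (idl _ N_L2) => //.
  by apply: subv_trans I_L2 _; apply: subv_trans L2_L1 L_closed.
have NI : (N <= I)%VS.
  by apply: subv_trans N_uA _; apply: subv_trans (brvS uI A_L2) (idr _ (subvv _)).
have TI : (T <= I)%VS.
  rewrite -memvE; apply: (subvP (idr _ A_L2)).
  exact: (subvP (brvS NI (subvv A))).
have AI : (A <= I)%VS.
  by apply: subv_trans A_TA _; apply: subv_trans (brvS TI (subvv _)) (idr _ A_L2).
apply: subv_trans L2_B _; rewrite subv_add AI /=.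
exact: subv_trans (brvS AI (subvv _)) (idr _ A_L2).
Qed.
End Criterion.
End LieAlgebra.

(** * Divided power superalgebras *)

Lemma exponent_range (p n : nat) (t al : 'I_n -> nat) :
  (forall i, al i < p ^ t i)%N \/ exists i, (p ^ t i <= al i)%N.
Proof.
case: (boolP [forall i, (al i < p ^ t i)%N]) => [/forallP|]; first by left.
by rewrite negb_forall => /existsP[i]; rewrite -leqNgt; right; exists i.
Qed.

(* The algebra O(n; t) (x) Lambda and its operators, known only through their
   values on monomials, so that rewriting never unfolds the coordinates.
   [cf alpha u] is the coefficient of x^(alpha) x_u. *)
Record dp_model (F : fieldType) (p n : nat) (t : 'I_n -> nat) := DPModel {
  dp_char : p \in [pchar F];
  dp_gt2 : (2 < p)%N;
  dp_nge3 : (2 < n)%N;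
  dp_tgt0 : forall i, (0 < t i)%N;
  dp_car :> vectType F;
  xm : ('I_n -> nat) -> {set 'I_n.+1} -> dp_car;
  mul : dp_car -> 'End(dp_car);
  dx : 'I_n -> 'End(dp_car);
  dxi : 'I_n.+1 -> 'End(dp_car);
  par : bool -> 'End(dp_car);
  cf : ('I_n -> nat) -> {set 'I_n.+1} -> dp_car -> F;
  xm_ext : forall alpha beta u, alpha =1 beta -> xm alpha u = xm beta u;
  xm_out : forall alpha u i, (p ^ t i <= alpha i)%N -> xm alpha u = 0;
  xm_ind : forall P : dp_car -> Prop,
    P 0 -> (forall c a b, P a -> P b -> P (c *: a + b)) ->
    (forall alpha u, (forall i, alpha i < p ^ t i)%N -> P (xm alpha u)) ->
    forall a, P a;
  cf_linear : forall alpha u c a b,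
    cf alpha u (c *: a + b) = c * cf alpha u a + cf alpha u b;
  cf_xm : forall alpha u beta v, (forall i, alpha i < p ^ t i)%N ->
    cf alpha u (xm beta v) = ([forall i, alpha i == beta i] && (u == v))%:R;
  cf_inj : forall a, (forall alpha u, (forall i, alpha i < p ^ t i)%N ->
    cf alpha u a = 0) -> a = 0;
  mul_linear : forall c a b, mul (c *: a + b) = c *: mul a + mul b;
  mul_xm : forall alpha u beta v, mul (xm alpha u) (xm beta v) =
    if [disjoint u & v] then
      ((-1) ^+ inversions u v * (\prod_(i < n) 'C(alpha i + beta i, alpha i))%:R) *:
      xm (fun i => (alpha i + beta i)%N) (u :|: v)
    else 0;
  (* The bound is essential: for [alpha r = p ^ t r] the monomial is 0, whereas the monomial with
     lowered exponent need not be. *)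
  dx_xm : forall r alpha u, (alpha r < p ^ t r)%N ->
    dx r (xm alpha u) =
    if alpha r == 0%N then 0 else xm (fun i => (alpha i - (i == r))%N) u;
  dxi_xm : forall j alpha u, dxi j (xm alpha u) =
    if j \in u then (-1) ^+ #|[set k in u | (k < j)%N]| *: xm alpha (u :\ j) else 0;
  par_xm : forall b alpha u,
    par b (xm alpha u) = if odd #|u| == b then xm alpha u else 0
}.

(** * Left multiplication by generators and the odd derivatives *)

Section Operators.
Variables (F : fieldType) (p n : nat) (t : 'I_n -> nat) (M : dp_model F p t).
Implicit Types (a b f g : M) (u v : {set 'I_n.+1}).

Lemma lmulPl c a b g : mul (c *: a + b) g = c *: mul a g + mul b g.
Proof. by rewrite mul_linear add_lfunE scale_lfunE. Qed.
Lemma lmulDl a b g : mul (a + b) g = mul a g + mul b g.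
Proof. by rewrite -[a]scale1r lmulPl !scale1r. Qed.
Lemma lmul0l g : mul 0 g = 0.
Proof. by apply: (addrI (mul 0 g)); rewrite -lmulDl !addr0. Qed.
Lemma lmulZl c a g : mul (c *: a) g = c *: mul a g.
Proof. by rewrite -[c *: a]addr0 lmulPl lmul0l addr0. Qed.
Lemma lmulNl a g : mul (- a) g = - mul a g.
Proof. by rewrite -scaleN1r lmulZl scaleN1r. Qed.
Lemma lmulBl a b g : mul (a - b) g = mul a g - mul b g.
Proof. by rewrite lmulDl lmulNl. Qed.

Definition odd_gen (j : 'I_n.+1) : M := xm M (fun=> 0%N) [set j].
Definition even_gen (i : 'I_n) : M := xm M (fun k => (k == i) : nat) set0.
Definition oneO : M := xm M (fun=> 0%N) set0.
Local Notation e_ j := (mul (odd_gen j)).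
Local Notation x_ i := (mul (even_gen i)).
Local Notation pdo := (dxi M).
Local Notation pde := (dx M).

(** The sign of moving x_j from the front of x_u to its place in increasing order. *)
Definition ksign (j : 'I_n.+1) (u : {set 'I_n.+1}) : F :=
  (-1) ^+ #|[set k in u | (k < j)%N]|.

Lemma ksignK j u : ksign j u * ksign j u = 1.
Proof. by rewrite /ksign -expr2 sqrr_sign. Qed.

Lemma ksignUl j (u v : {set 'I_n.+1}) : [disjoint u & v] ->
  ksign j (u :|: v) = ksign j u * ksign j v.
Proof.
move=> d; rewrite -exprD -cardsUI.
have -> : [set k in u | (k < j)%N] :&: [set k in v | (k < j)%N] = set0.
  apply/setP => k; rewrite !inE; apply/negP => /andP[/andP[ku _] /andP[kv _]].
  by rewrite (disjointFr d ku) in kv.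
rewrite cards0 addn0; congr (_ ^+ _); apply: eq_card => k.
by rewrite !inE andb_orl.
Qed.

Lemma ksign1 j k : ksign j [set k] = (-1) ^+ (k < j)%N.
Proof.
congr (_ ^+ _); case: (boolP (k < j)%N) => kj.
  by transitivity #|[set k]|; [apply: eq_card => i; rewrite !inE;
    case: eqP => // ->|rewrite cards1].
by apply: eq_card0 => i; rewrite !inE; case: eqP => // ->; apply: negPf.
Qed.

Lemma ksignU1 j k (u : {set 'I_n.+1}) : k \notin u ->
  ksign j (k |: u) = (-1) ^+ (k < j)%N * ksign j u.
Proof. by move=> ku; rewrite ksignUl ?ksign1 // disjoints1. Qed.

Lemma ksignD1 j k (u : {set 'I_n.+1}) : k \in u ->
  ksign j (u :\ k) = (-1) ^+ (k < j)%N * ksign j u.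
Proof.
move=> ku; rewrite -{2}(setD1K ku) ksignU1 ?setD11 //.
by rewrite mulrA -expr2 sqrr_sign mul1r.
Qed.

Lemma inversionsE (u v : {set 'I_n.+1}) :
  inversions u v = (\sum_(i in u) #|[set k in v | (k < i)%N]|)%N.
Proof.
rewrite /inversions -sum1_card (partition_big fst (mem u)) /=; last first.
  by case=> i k; rewrite inE /= => /and3P[].
apply: eq_bigr => i iu; rewrite -sum1_card.
rewrite (reindex_onto (fun k => (i, k)) snd) /=.
  by apply: eq_bigl => k; rewrite !inE /= iu !eqxx !andbT.
by case=> i' k; rewrite !inE /= => /andP[_ /eqP ->].
Qed.

(** Inversions are summed over the elements of the first set, so peeling off a generator leaves only
    a [ksign]. In this way products are controlled through multiplication by generators. *)
Lemma sign_inversionsU1 j (u v : {set 'I_n.+1}) : j \notin u ->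
  (-1) ^+ inversions (j |: u) v = ksign j v * (-1) ^+ inversions u v :> F.
Proof. by move=> ju; rewrite !inversionsE big_setU1 //= exprD. Qed.

Lemma inversions0 (v : {set 'I_n.+1}) : inversions set0 v = 0%N.
Proof. by rewrite inversionsE big_set0. Qed.

Lemma sign_inversions1 j (v : {set 'I_n.+1}) : (-1) ^+ inversions [set j] v = ksign j v :> F.
Proof. by rewrite -(setU0 [set j]) sign_inversionsU1 ?inE // inversions0 mulr1. Qed.

Lemma odd_gen_xm j beta v :
  e_ j (xm M beta v) = if j \in v then 0 else ksign j v *: xm M beta (j |: v).
Proof.
rewrite mul_xm disjoints1; case: (j \in v) => //=.
rewrite big1 ?mulr1 ?sign_inversions1 // => i _; by rewrite add0n bin0.
Qed.

Lemma even_gen_xm i beta v :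
  x_ i (xm M beta v) = (beta i).+1%:R *: xm M (fun k => (beta k + (k == i))%N) v.
Proof.
rewrite mul_xm disjoints_subset sub0set inversions0 mul1r set0U.
rewrite (bigD1 i) //= eqxx add1n bin1 big1 ?muln1.
  by congr (_ *: _); apply: xm_ext => k; rewrite addnC.
by move=> k /negPf ->; rewrite bin0.
Qed.

Lemma even_xm_mul alpha beta v :
  mul (xm M alpha set0) (xm M beta v) =
  (\prod_(i < n) 'C(alpha i + beta i, alpha i))%:R *: xm M (fun i => (alpha i + beta i)%N) v.
Proof. by rewrite mul_xm disjoints_subset sub0set inversions0 mul1r set0U. Qed.

Lemma lmul1 a : mul oneO a = a.
Proof.
elim/xm_ind: a => [|c a b Ha Hb|beta v _]; rewrite ?end0 ?endP ?Ha ?Hb //.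
by rewrite even_xm_mul big1 ?scale1r // => i _; rewrite add0n bin0.
Qed.

Lemma lmulr1 a : mul a oneO = a.
Proof.
elim/xm_ind: a => [|c a b Ha Hb|alpha u _].
- by rewrite lmul0l.
- by rewrite lmulPl Ha Hb.
rewrite mul_xm disjoint_sym disjoints_subset sub0set inversionsE big1 => [|i _].
  rewrite big1 ?mul1r ?scale1r => [|i _]; last by rewrite addn0 binn.
  by rewrite setU0; apply: xm_ext => i; rewrite addn0.
by apply: eq_card0 => k; rewrite !inE.
Qed.

Lemma xm_odd_gen j alpha (u : {set 'I_n.+1}) : j \in u ->
  xm M alpha u = ksign j (u :\ j) *: e_ j (xm M alpha (u :\ j)).
Proof. by move=> ju; rewrite odd_gen_xm setD11 scalerA ksignK scale1r setD1K. Qed.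

(** Every monomial arises from a purely even one by left multiplication with odd generators.
    Identities for products thus reduce to divided power monomials and to commutation with
    [e_ j]. *)
Lemma odd_ind (P : M -> Prop) :
  P 0 -> (forall c a b, P a -> P b -> P (c *: a + b)) ->
  (forall alpha, (forall i, alpha i < p ^ t i)%N -> P (xm M alpha set0)) ->
  (forall j a, P a -> P (e_ j a)) -> forall a, P a.
Proof.
move=> P0 PL Px Pe; elim/xm_ind => // alpha u ha.
have PZ c a : P a -> P (c *: a) by move=> Pa; rewrite -[_ *: _]addr0; apply: PL.
move: {2}#|u| (leqnn #|u|) => k; elim: k u => [|k IH] u.
  by rewrite leqn0 cards_eq0 => /eqP ->; apply: Px.
have [->|/set0Pn[j ju]] := eqVneq u set0; first by move=> _; apply: Px.
rewrite (cardsD1 j) ju ltnS => uk; rewrite (xm_odd_gen _ ju).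
exact/PZ/Pe/IH.
Qed.

(** Associativity and supercommutativity are only ever used with a generator as one of the factors;
    this is the first of these rules. *)
Lemma lmul_odd_gen j f g : mul (e_ j f) g = e_ j (mul f g).
Proof.
elim/xm_ind: f => [|c a b Ha Hb|alpha u _].
- by rewrite end0 !lmul0l end0.
- by rewrite endP !lmulPl Ha Hb endP.
elim/xm_ind: g => [|c a b Ha Hb|beta v _]; rewrite ?end0 ?endP ?Ha ?Hb ?endP //.
rewrite odd_gen_xm mul_xm; have [ju|ju] := boolP (j \in u).
  rewrite lmul0l; case: ifP => _; rewrite ?end0 // endZ odd_gen_xm.
  by rewrite inE ju scaler0.
have dE : [disjoint j |: u & v] = (j \notin v) && [disjoint u & v].
  by rewrite !disjoints_subset subUset sub1set inE.
rewrite lmulZl mul_xm dE.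
have [jv|jv] := boolP (j \in v) => /=.
  rewrite scaler0; case: ifP => _; rewrite ?end0 // endZ odd_gen_xm.
  by rewrite inE jv orbT scaler0.
case: (boolP [disjoint u & v]) => duv; last by rewrite end0 scaler0.
rewrite endZ odd_gen_xm inE.
rewrite (negPf ju) (negPf jv) /= !scalerA sign_inversionsU1 // ksignUl //.
rewrite setUA; congr (_ *: _); ring.
Qed.

Lemma odd_gen_anti j k a : e_ j (e_ k a) = - e_ k (e_ j a).
Proof.
elim/xm_ind: a => [|c a b Ha Hb|beta v _]; first by rewrite !end0 oppr0.
  by rewrite !endP Ha Hb opprD scalerN.
rewrite !odd_gen_xm.
have [jv|jv] := boolP (j \in v); have [kv|kv] := boolP (k \in v);
  rewrite ?end0 ?oppr0 // ?endZ ?odd_gen_xm ?in_setU1 ?jv ?kv ?orbT ?scaler0 ?oppr0 //.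
rewrite (negPf jv) (negPf kv) !orbF eq_sym; have [->|kj] := eqVneq j k;
  first by rewrite scaler0 oppr0.
rewrite !scalerA !ksignU1 // setUCA -scaleNr; congr (_ *: _).
case: (ltngtP j k) => [||/val_inj/eqP]; rewrite ?(negPf kj) // => _ /=; ring.
Qed.

(** The canonical anticommutation relation between exterior multiplication and contraction. *)
Lemma pdodd_odd_gen j k a : pdo j (e_ k a) = (j == k)%:R *: a - e_ k (pdo j a).
Proof.
elim/xm_ind: a => [|c a b Ha Hb|beta v _]; first by rewrite !end0 scaler0 subr0.
  by rewrite !endP Ha Hb; vect_ring.
rewrite odd_gen_xm dxi_xm -/(ksign j v).
have [->|jk] := eqVneq j k; have [kv|kv] := boolP (k \in v).
- rewrite end0 endZ odd_gen_xm setD11 scalerA ksignD1 // ltnn mul1r ksignK.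
  by rewrite setD1K // subrr.
- rewrite end0 subr0 endZ dxi_xm setU11 -/(ksign k (k |: v)) setU1K //.
  by rewrite scalerA ksignU1 // ltnn mul1r ksignK.
- case: ifP => jv; rewrite ?end0 ?scale0r ?subr0 //.
  by rewrite endZ odd_gen_xm in_setD1 eq_sym jk kv scaler0 subr0.
case: ifP => jv; rewrite endZ dxi_xm in_setU1 (negPf jk) jv /= -/(ksign _ _);
  last by rewrite scaler0 end0 scale0r subr0.
rewrite endZ odd_gen_xm in_setD1 (negPf kv) andbF scale0r sub0r !scalerA.
rewrite ksignU1 // ksignD1 // -scaleNr.
have -> : (k |: v) :\ j = k |: (v :\ j).
  apply/setP => i; rewrite !inE; case: (eqVneq i k) => [->|] //=.
  by rewrite eq_sym jk.
congr (_ *: _).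
case: (ltngtP j k) => [||/val_inj/eqP]; rewrite ?(negPf jk) // => _ /=; ring.
Qed.

End Operators.

(** * Commutation relations and Leibniz rules *)

Section Relations.
Variables (F : fieldType) (p n : nat) (t : 'I_n -> nat) (M : dp_model F p t).
Let charF := dp_char M.
Let p_gt2 := dp_gt2 M.
Let t_gt0 := dp_tgt0 M.
Implicit Types (a b f g : M) (u v : {set 'I_n.+1}).
Local Notation e_ j := (mul (odd_gen M j)).
Local Notation x_ i := (mul (even_gen M i)).
Local Notation pdo := (dxi M).
Local Notation pde := (dx M).
Local Notation sg := (psign (par M)).

Lemma two_neq0 : 2 != 0 :> F.
Proof.
by rewrite -(dvdn_pcharf charF); apply/negP => /dvdn_leq -/(_ isT); rewrite leqNgt p_gt2.
Qed.

Lemma par_par (b c : bool) : (par M b \o par M c)%VF = if b == c then par M b else 0.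
Proof.
apply/lfunP => a; rewrite comp_lfunE; elim/xm_ind: a => [|k a a' Ha Ha'|al u _].
- by rewrite !end0.
- by rewrite !endP Ha Ha'.
rewrite par_xm; have [->|bc] := eqVneq b c; last rewrite zero_lfunE.
  by case: ifP => h; rewrite ?end0 par_xm h.
by case: ifP => h; rewrite ?end0 // par_xm (eqP h) eq_sym (negPf bc).
Qed.

Lemma par_sum : par M false + par M true = \1%VF.
Proof.
apply/lfunP => a; rewrite add_lfunE id_lfunE; elim/xm_ind: a => [|k a a' Ha Ha'|al u _].
- by rewrite !end0 addr0.
- by rewrite -{3}Ha -{3}Ha' !endP; vect_ring.
by rewrite !par_xm; case: (odd _); rewrite ?addr0 ?add0r.
Qed.

Lemma sg_xm al u : sg (xm M al u) = (-1) ^+ #|u| *: xm M al u.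
Proof.
rewrite psignBE !par_xm -signr_odd.
by case: (odd _); rewrite ?sub0r ?subr0 ?scaleN1r ?scale1r.
Qed.

Lemma sgK a : sg (sg a) = a.
Proof. exact: psignKE par_par par_sum a. Qed.

Lemma sg_e j a : sg (e_ j a) = - e_ j (sg a).
Proof.
elim/xm_ind: a => [|k a a' Ha Ha'|al u _]; first by rewrite !end0 oppr0.
  by rewrite !endP Ha Ha'; vect_ring.
rewrite sg_xm endZ odd_gen_xm; case: ifP => ju; first by rewrite end0 scaler0 oppr0.
by rewrite endZ sg_xm cardsU1 ju exprS; vect_ring.
Qed.

Lemma sg_x i a : sg (x_ i a) = x_ i (sg a).
Proof.
elim/xm_ind: a => [|k a a' Ha Ha'|al u _]; first by rewrite !end0.
  by rewrite !endP Ha Ha'.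
by rewrite sg_xm endZ even_gen_xm endZ sg_xm; vect_ring.
Qed.

Lemma sg_pdo j a : sg (pdo j a) = - pdo j (sg a).
Proof.
elim/xm_ind: a => [|k a a' Ha Ha'|al u _]; first by rewrite !end0 oppr0.
  by rewrite !endP Ha Ha'; vect_ring.
rewrite sg_xm endZ dxi_xm; case: ifP => ju; last by rewrite end0 scaler0 oppr0.
by rewrite endZ sg_xm [#|u|](cardsD1 j) ju exprS; vect_ring.
Qed.

Lemma sg_pde i a : sg (pde i a) = pde i (sg a).
Proof.
elim/xm_ind: a => [|k a a' Ha Ha'|al u hal]; first by rewrite !end0.
  by rewrite !endP Ha Ha'.
rewrite sg_xm endZ dx_xm //; case: ifP => _; first by rewrite end0 scaler0.
by rewrite sg_xm.
Qed.

Lemma e_x j i a : e_ j (x_ i a) = x_ i (e_ j a).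
Proof.
elim/xm_ind: a => [|k a a' Ha Ha'|al u _]; first by rewrite !end0.
  by rewrite !endP Ha Ha'.
rewrite odd_gen_xm even_gen_xm endZ odd_gen_xm; case: ifP => _; first by rewrite end0 scaler0.
by rewrite endZ even_gen_xm; vect_ring.
Qed.

Lemma pdo_x j i a : pdo j (x_ i a) = x_ i (pdo j a).
Proof.
elim/xm_ind: a => [|k a a' Ha Ha'|al u _]; first by rewrite !end0.
  by rewrite !endP Ha Ha'.
rewrite dxi_xm even_gen_xm endZ dxi_xm; case: ifP => _; last by rewrite end0 scaler0.
by rewrite endZ even_gen_xm; vect_ring.
Qed.

Lemma x_x i k a : x_ i (x_ k a) = x_ k (x_ i a).
Proof.
elim/xm_ind: a => [|c a a' Ha Ha'|al u _]; first by rewrite !end0.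
  by rewrite !endP Ha Ha'.
rewrite !even_gen_xm !endZ !even_gen_xm !scalerA; congr (_ *: _).
  by rewrite -!natrM [(k == i)]eq_sym; congr (_%:R); case: eqP => [->|]; lia.
by apply: xm_ext => l; lia.
Qed.

Lemma mul_even_gen i f g : mul (x_ i f) g = x_ i (mul f g).
Proof.
elim/xm_ind: f => [|c a b Ha Hb|al u _]; first by rewrite end0 !lmul0l end0.
  by rewrite endP !lmulPl Ha Hb endP.
elim/xm_ind: g => [|c a b Ha Hb|be v _]; rewrite ?end0 ?endP ?Ha ?Hb //.
rewrite even_gen_xm lmulZl !mul_xm; case: ifP => _; last by rewrite end0 scaler0.
rewrite endZ even_gen_xm !scalerA.
set A := xm _ _ _; set B := xm _ _ _; have -> : A = B by apply: xm_ext => k; lia.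
congr (_ *: _); rewrite mulrCA -mulrA; congr (_ * _); rewrite -!natrM; congr (_%:R).
rewrite (bigD1 i) //= [in RHS](bigD1 i) //= eqxx !addn1.
rewrite (eq_bigr (fun k => 'C(al k + be k, al k))); last first.
  by move=> k /negPf ->; rewrite addn0.
(* With a and b the i-th exponents: (a + 1) C(a + b + 1, a + 1) = (a + b + 1) C(a + b, a). *)
by rewrite mulnA addSn -mul_bin_diag /= [RHS]mulnAC [in RHS]mulnC; lia.
Qed.

Lemma mulr_even_gen i f g : mul f (x_ i g) = x_ i (mul f g).
Proof.
elim/xm_ind: f => [|c a b Ha Hb|al u _]; first by rewrite !lmul0l end0.
  by rewrite !lmulPl Ha Hb endP.
elim/xm_ind: g => [|c a b Ha Hb|be v _]; rewrite ?end0 ?endP ?Ha ?Hb //.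
rewrite even_gen_xm endZ !mul_xm; case: ifP => _; last by rewrite end0 scaler0.
rewrite endZ even_gen_xm !scalerA.
set A := xm _ _ _; set B := xm _ _ _; have -> : A = B by apply: xm_ext => k; lia.
congr (_ *: _); rewrite mulrCA -mulrA; congr (_ * _); rewrite -!natrM; congr (_%:R).
rewrite (bigD1 i) //= [in RHS](bigD1 i) //= eqxx !addn1.
rewrite (eq_bigr (fun k => 'C(al k + be k, al k))); last first.
  by move=> k /negPf ->; rewrite addn0.
have e : ((be i).+1 * 'C(al i + (be i).+1, al i) = (al i + be i).+1 * 'C(al i + be i, al i))%N.
  by rewrite addnS (mul_bin_down (al i + be i).+1) subSn ?leq_addr // addKn.
by rewrite mulnA e [RHS]mulnAC; congr (_ * _)%N; rewrite mulnC.
Qed.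

Lemma mulr_odd_gen j f g : mul f (e_ j g) = e_ j (mul (sg f) g).
Proof.
elim/odd_ind: f => [|c a b Ha Hb|al hal|k a Ha]; first by rewrite end0 !lmul0l end0.
- by rewrite endP !lmulPl Ha Hb endP.
- rewrite sg_xm cards0 scale1r.
  elim/xm_ind: g => [|c a b Ha Hb|be v _]; rewrite ?end0 ?endP ?Ha ?Hb //.
  rewrite odd_gen_xm even_xm_mul; case: ifP => jv;
    first by rewrite end0 endZ odd_gen_xm jv scaler0.
  by rewrite !endZ even_xm_mul odd_gen_xm jv; vect_ring.
by rewrite lmul_odd_gen Ha sg_e lmulNl lmul_odd_gen endN odd_gen_anti.
Qed.

Lemma sg_mul f g : sg (mul f g) = mul (sg f) (sg g).
Proof.
elim/odd_ind: f => [|c a b Ha Hb|al hal|k a Ha]; first by rewrite lmul0l !end0 lmul0l.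
- by rewrite lmulPl !endP Ha Hb lmulPl.
- rewrite sg_xm cards0 scale1r.
  elim/xm_ind: g => [|c a b Ha Hb|be v _]; rewrite ?end0 ?endP ?Ha ?Hb //.
  by rewrite even_xm_mul sg_xm !endZ sg_xm even_xm_mul; vect_ring.
by rewrite lmul_odd_gen !sg_e lmulNl lmul_odd_gen Ha.
Qed.

Lemma pdo_mul j f g : pdo j (mul f g) = mul (pdo j f) g + mul (sg f) (pdo j g).
Proof.
elim/odd_ind: f => [|c a b Ha Hb|al hal|k a Ha]; first by rewrite !end0 !lmul0l end0 addr0.
- by rewrite !endP !lmulPl !endP Ha Hb; vect_ring.
- rewrite sg_xm cards0 scale1r dxi_xm inE lmul0l add0r.
  elim/xm_ind: g => [|c a b Ha Hb|be v _]; rewrite ?end0 ?endP ?Ha ?Hb //.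
  rewrite even_xm_mul endZ !dxi_xm; case: ifP => _; last by rewrite end0 scaler0.
  by rewrite endZ even_xm_mul; vect_ring.
rewrite lmul_odd_gen !pdodd_odd_gen Ha sg_e lmulNl lmulBl lmulZl !lmul_odd_gen endD.
by vect_ring.
Qed.

Lemma pde_e i j a : pde i (e_ j a) = e_ j (pde i a).
Proof.
elim/xm_ind: a => [|k a a' Ha Ha'|al u hal]; first by rewrite !end0.
  by rewrite !endP Ha Ha'.
rewrite odd_gen_xm dx_xm //; case: ifP => ju; case: ifP => al0;
  rewrite ?end0 ?odd_gen_xm ?ju //.
  by rewrite endZ dx_xm // al0 scaler0.
by rewrite endZ dx_xm // al0.
Qed.

(** From a C(p^q, a) = p^q C(p^q - 1, a - 1): if p did not divide the binomial coefficient, p^q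
    would divide a, which is too small. *)
Lemma p_dvd_bin (q a : nat) : (0 < a < p ^ q)%N -> (p %| 'C(p ^ q, a))%N.
Proof.
have p_pr := pcharf_prime charF.
case: a => // a /andP[_ aq]; apply: contraLR aq => pC; rewrite -leqNgt dvdn_leq //.
have : (p ^ q %| a.+1 * 'C(p ^ q, a.+1))%N by rewrite -mul_bin_diag dvdn_mulr.
by rewrite mulnC Gauss_dvdr // coprimeXl // prime_coprime.
Qed.

(** On divided powers this is Pascal's rule, together with the fact that truncation at p^(t_i) is
    compatible with it in characteristic p. *)
Lemma pde_mul i f g : pde i (mul f g) = mul (pde i f) g + mul f (pde i g).
Proof.
elim/odd_ind: f => [|c a b Ha Hb|al hal|k a Ha]; first by rewrite !end0 !lmul0l end0 addr0.
- by rewrite !endP !lmulPl !endP Ha Hb; vect_ring.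
- elim/xm_ind: g => [|c a b Ha Hb|be v hbe]; rewrite ?end0 ?addr0 ?endP ?Ha ?Hb //.
    by vect_ring.
  rewrite even_xm_mul endZ [pde i (xm M al _)]dx_xm // [pde i (xm M be _)]dx_xm //.
  set R := (\prod_(k < n | k != i) 'C(al k + be k, al k))%N.
  pose ga k := (al k + be k - (k == i))%N.
  have El : mul (if al i == 0%N then 0 else xm M (fun k =>
    (al k - (k == i))%N) set0) (xm M be v)
      = (if al i == 0%N then 0 else ('C((al i + be i).-1, (al i).-1) * R)%:R) *: xm M ga v.
    case: eqP => ai; first by rewrite lmul0l scale0r.
    rewrite even_xm_mul (bigD1 i) //= eqxx.
    rewrite (eq_bigr (fun k => 'C(al k + be k, al k))); last by move=> k /negPf ->;
      rewrite subn0.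
    congr (_ *: _); last by apply: xm_ext => k; rewrite /ga; case: eqP => [->|]; lia.
    by congr ('C(_, _) * _)%:R; lia.
  have Er : mul (xm M al set0) (if be i == 0%N then 0 else xm M (fun k =>
    (be k - (k == i))%N) v)
      = (if be i == 0%N then 0 else ('C((al i + be i).-1, al i) * R)%:R) *: xm M ga v.
    case: eqP => bi; first by rewrite end0 scale0r.
    rewrite even_xm_mul (bigD1 i) //= eqxx.
    rewrite (eq_bigr (fun k => 'C(al k + be k, al k))); last by move=> k /negPf ->;
      rewrite subn0.
    congr (_ *: _); last by apply: xm_ext => k; rewrite /ga; case: eqP => [->|]; lia.
    by congr ('C(_, _) * _)%:R; lia.
  rewrite El Er (bigD1 i) //= -/R -scalerDl {El Er}.
  have [ab0|ab0] := posnP (al i + be i)%N.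
    have [a0 b0] : al i = 0%N /\ be i = 0%N by lia.
    have abq : (al i + be i < p ^ t i)%N by have := hal i; lia.
    by rewrite dx_xm // a0 b0 /= scaler0 addr0 scale0r.
  have binE : ('C(al i + be i, al i) = (if al i == 0 then 0 else 'C((al i + be i).-1,
    (al i).-1))
      + (if be i == 0 then 0 else 'C((al i + be i).-1, al i)))%N.
    case: (al i) (be i) ab0 => [|k] [|l] // _; rewrite ?bin0 ?addn0 ?binn //.
    by rewrite addSn /= binS addnC.
  have cE : (if al i == 0%N then 0 else ('C((al i + be i).-1, (al i).-1) * R)%:R)
      + (if be i == 0%N then 0 else ('C((al i + be i).-1, al i) * R)%:R)
      = ('C(al i + be i, al i) * R)%:R :> F.
    by rewrite binE mulnDl natrD; do 2 case: ifP => _.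
  rewrite {}cE; have [abq|] := ltnP (al i + be i) (p ^ t i).
    by rewrite dx_xm // (gtn_eqF ab0).
  (* At total exponent exactly p^(t_i) the product is truncated to 0 while the two terms on the
     right need not be. Their coefficients add up to C(p^(t_i), al_i), which p divides. Beyond that
     exponent the monomial on the right is truncated too. *)
  rewrite leq_eqVlt => /orP[/eqP qE|qab].
    have : (p %| 'C(p ^ t i, al i))%N.
      by apply: p_dvd_bin; have := hal i; have := hbe i; lia.
    rewrite (dvdn_pcharf charF) => /eqP C0.
    rewrite (@xm_out _ _ _ _ _ _ _ i) -?qE // end0 scaler0.
    by rewrite natrM C0 mul0r scale0r.
  rewrite (@xm_out _ _ _ _ _ _ _ i) 1?ltnW // end0 scaler0.
  by rewrite (@xm_out _ _ _ _ _ _ _ i) ?scaler0 // /ga eqxx; lia.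
by rewrite lmul_odd_gen pde_e Ha endD pde_e !lmul_odd_gen.
Qed.

Lemma expn_gt1 i : (1 < p ^ t i)%N.
Proof. by rewrite -(exp1n (t i)) ltn_exp2r // (ltn_trans _ p_gt2). Qed.

Lemma even_gen_in i k : ((k == i) < p ^ t k)%N.
Proof. by apply: leq_trans (expn_gt1 k); case: eqP. Qed.

Lemma pde_even_gen i k : pde i (even_gen M k) = (i == k)%:R *: oneO M.
Proof.
rewrite dx_xm ?even_gen_in //; have [->|ik] /= := eqVneq i k; last by rewrite scale0r.
by rewrite scale1r; apply: xm_ext => l; rewrite subnn.
Qed.

Lemma pde_x i k a : pde i (x_ k a) = (i == k)%:R *: a + x_ k (pde i a).
Proof. by rewrite pde_mul pde_even_gen lmulZl lmul1. Qed.

Lemma pdo_pdo j k a : pdo j (pdo k a) = - pdo k (pdo j a).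
Proof.
elim/odd_ind: a => [|c a b Ha Hb|al hal|l a Ha]; first by rewrite !end0 oppr0.
- by rewrite !endP Ha Hb; vect_ring.
- by rewrite !dxi_xm !inE !end0 oppr0.
rewrite !(pdodd_odd_gen, endB, endZ) Ha.
by rewrite endN; vect_ring.
Qed.

Lemma pde_pdo i j a : pde i (pdo j a) = pdo j (pde i a).
Proof.
elim/odd_ind: a => [|c a b Ha Hb|al hal|l a Ha]; first by rewrite !end0.
- by rewrite !endP Ha Hb.
- rewrite dxi_xm inE end0 dx_xm //; case: ifP => _; first by rewrite end0.
  by rewrite dxi_xm inE.
by rewrite pde_e !pdodd_odd_gen endB endZ pde_e Ha.
Qed.

Lemma pde_pde i k a : pde i (pde k a) = pde k (pde i a).
Proof.
elim/odd_ind: a => [|c a b Ha Hb|al hal|l a Ha]; first by rewrite !end0.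
- by rewrite !endP Ha Hb.
- have [->//|ik] := eqVneq i k.
  have h l : (al l - (l == k) < p ^ t l)%N by rewrite (leq_ltn_trans (leq_subr _ _)).
  have h' l : (al l - (l == i) < p ^ t l)%N by rewrite (leq_ltn_trans (leq_subr _ _)).
  rewrite !dx_xm //; do 2 case: ifP => ?;
    rewrite ?end0 ?dx_xm //= ?(negPf ik) 1?[k == i]eq_sym ?(negPf ik) ?subn0.
  - by case: ifP; rewrite // => /eqP; lia.
  - by case: ifP; rewrite // => /eqP; lia.
  do 2 case: ifP => ?; try lia; apply: xm_ext => l; lia.
by rewrite !pde_e Ha.
Qed.
End Relations.

(** * The contact bracket *)

Section Contact.
Variables (F : fieldType) (p n : nat) (t : 'I_n -> nat) (M : dp_model F p t).
Implicit Types (a b c f g : M) (i j k : 'I_n) (u v : {set 'I_n.+1}).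
Local Notation x i := (mul (even_gen M i)).
Local Notation xi i := (mul (odd_gen M (inod i))).
Local Notation z := (mul (odd_gen M ord_max)).
Local Notation d i := (dx M i).
Local Notation di i := (dxi M (inod i)).
Local Notation pz := (dxi M ord_max).
Local Notation sg := (psign (par M)).
Local Notation one := (oneO M).

Lemma inod_max i : (inod i == ord_max) = false.
Proof. by apply/negP => /eqP/(congr1 val) /= e; have := ltn_ord i; rewrite e ltnn. Qed.
Lemma max_inod i : (ord_max == inod i) = false.
Proof. by rewrite eq_sym inod_max. Qed.
Lemma inod_eq i j : (inod i == inod j) = (i == j).
Proof. by apply/eqP/eqP => [/(congr1 val) /= /val_inj|->]. Qed.

Lemma end_sum (f : 'End(M)) (I : Type) (r : seq I) (P : pred I) (E : I -> M) :
  f (\sum_(i <- r | P i) E i) = \sum_(i <- r | P i) f (E i).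
Proof. exact: linear_sum. Qed.

Lemma mul_suml (I : Type) (r : seq I) (P : pred I) (E : I -> M) a :
  mul (\sum_(i <- r | P i) E i) a = \sum_(i <- r | P i) mul (E i) a.
Proof. by elim/big_rec2: _ => [|i y1 y2 _ <-]; rewrite ?lmul0l ?lmulDl. Qed.

Lemma sum_delta i (E : 'I_n -> M) : \sum_j (i == j)%:R *: E j = E i.
Proof.
rewrite (bigD1 i) //= eqxx scale1r big1 ?addr0 // => j ji.
by rewrite eq_sym (negPf ji) scale0r.
Qed.

Lemma pdo_sq (j : 'I_n.+1) a : dxi M j (dxi M j a) = 0.
Proof.
apply: (scalerI (two_neq0 M)); rewrite scaler0 scaler_nat mulr2n {1}pdo_pdo addNr //.
Qed.

Lemma di_x i j a : di i (x j a) = x j (di i a). Proof. exact: pdo_x. Qed.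
Lemma di_xi i j a : di i (xi j a) = (i == j)%:R *: a - xi j (di i a).
Proof. by rewrite pdodd_odd_gen inod_eq. Qed.
Lemma di_z i a : di i (z a) = - z (di i a).
Proof. by rewrite pdodd_odd_gen inod_max scale0r sub0r. Qed.
Lemma pz_xi i a : pz (xi i a) = - xi i (pz a).
Proof. by rewrite pdodd_odd_gen max_inod scale0r sub0r. Qed.
Lemma pz_z a : pz (z a) = a - z (pz a).
Proof. by rewrite pdodd_odd_gen eqxx scale1r. Qed.

(* The operators below are sealed (extracted from opaque proofs) so that
   unification never unfolds them. *)
Lemma eul_subproof : {f : 'End(M) | forall a, f a = \sum_i (x i (d i a) + xi i (di i a))}.
Proof.
exists (\sum_i ((x i \o d i) + (xi i \o di i))%VF) => a.
by rewrite sum_lfunE; apply: eq_bigr => i _; rewrite add_lfunE !comp_lfunE.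
Qed.
Definition eul : 'End(M) := sval eul_subproof.

Lemma eulE a : eul a = \sum_i (x i (d i a) + xi i (di i a)).
Proof. exact: (svalP eul_subproof). Qed.

Lemma eul_mul f g : eul (mul f g) = mul (eul f) g + mul f (eul g).
Proof.
rewrite !eulE mul_suml end_sum -big_split; apply: eq_bigr => i _ /=.
rewrite pde_mul pdo_mul !endD mulr_even_gen mulr_odd_gen lmulDl mul_even_gen lmul_odd_gen.
by vect_ring.
Qed.

Lemma sg_eul a : sg (eul a) = eul (sg a).
Proof.
rewrite !eulE end_sum; apply: eq_bigr => i _.
by rewrite endD sg_x sg_pde sg_e sg_pdo endN opprK.
Qed.

Lemma eul_one : eul one = 0.
Proof.
rewrite eulE big1 // => i _; rewrite dxi_xm inE end0 addr0 dx_xm ?end0 //.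
by rewrite (leq_trans _ (expn_gt1 M i)).
Qed.

Lemma mul_one_r f : mul f one = f. Proof. exact: lmulr1. Qed.

Lemma eul_x i a : eul (x i a) = x i (eul a) + x i a.
Proof.
rewrite eul_mul; have -> : eul (even_gen M i) = even_gen M i; last by rewrite addrC.
rewrite -{1}(mul_one_r (even_gen M i)) eulE.
under eq_bigr => j _ do rewrite di_x pde_x [di j one]dxi_xm inE !end0 addr0 endD endZ
  [d j one]dx_xm ?(leq_trans _ (expn_gt1 M j)) // !end0 addr0 mul_one_r eq_sym.
by rewrite sum_delta.
Qed.

Lemma eul_xi i a : eul (xi i a) = xi i (eul a) + xi i a.
Proof.
rewrite eul_mul; have -> : eul (odd_gen M (inod i)) = odd_gen M (inod i);
  last by rewrite addrC.
rewrite -{1}(mul_one_r (odd_gen M (inod i))) eulE.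
under eq_bigr => j _ do rewrite pde_e di_xi [di j one]dxi_xm inE !end0 subr0 endZ
  [d j one]dx_xm ?(leq_trans _ (expn_gt1 M j)) // !end0 add0r mul_one_r eq_sym.
by rewrite sum_delta.
Qed.

Lemma d_eul i a : d i (eul a) = eul (d i a) + d i a.
Proof.
rewrite !eulE end_sum.
under eq_bigr => j _ do rewrite endD pde_x pde_e pde_pdo pde_pde -addrA addrC.
by rewrite big_split /= sum_delta.
Qed.

Lemma di_eul i a : di i (eul a) = eul (di i a) + di i a.
Proof.
rewrite !eulE end_sum.
under eq_bigr => j _ do rewrite endD di_x di_xi pdo_pdo endN opprK -pde_pdo
  addrCA addrC.
by rewrite big_split /= sum_delta.
Qed.

Lemma pz_eul a : pz (eul a) = eul (pz a).
Proof.
rewrite !eulE end_sum; apply: eq_bigr => i _.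
by rewrite endD pdo_x -pde_pdo pz_xi pdo_pdo endN opprK.
Qed.

(* nab i and nabp i are D_KO(x_i) and D_KO(x_{i'}), see Dk_x and Dk_xi. *)
Lemma nab_subproof : {f : 'I_n -> 'End(M) | forall i a, f i a = di i a - x i (pz a)}.
Proof.
exists (fun i => di i - (x i \o pz))%VF => i a.
by rewrite add_lfunE opp_lfunE comp_lfunE.
Qed.
Definition nab : 'I_n -> 'End(M) := sval nab_subproof.
Lemma nabE i a : nab i a = di i a - x i (pz a).
Proof. exact: (svalP nab_subproof). Qed.

Lemma nabp_subproof : {f : 'I_n -> 'End(M) | forall i a, f i a = - d i a - xi i (pz a)}.
Proof.
exists (fun i => - d i - (xi i \o pz))%VF => i a.
by rewrite add_lfunE !opp_lfunE comp_lfunE.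
Qed.
Definition nabp : 'I_n -> 'End(M) := sval nabp_subproof.
Lemma nabpE i a : nabp i a = - d i a - xi i (pz a).
Proof. exact: (svalP nabp_subproof). Qed.

Lemma nab_mul i f g : nab i (mul f g) = mul (nab i f) g + mul (sg f) (nab i g).
Proof.
rewrite !nabE !pdo_mul endB lmulBl endD mul_even_gen mulr_even_gen; vect_ring.
Qed.

Lemma nabp_mul i f g : nabp i (mul f g) = mul (nabp i f) g + mul f (nabp i g).
Proof.
rewrite !nabpE pdo_mul pde_mul endB endN lmulBl lmulNl endD.
by rewrite lmul_odd_gen mulr_odd_gen; vect_ring.
Qed.

Lemma nab_sg i a : nab i (sg a) = - sg (nab i a).
Proof. by rewrite !nabE endB sg_x !sg_pdo endN; vect_ring. Qed.
Lemma nabp_sg i a : nabp i (sg a) = sg (nabp i a).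
Proof. by rewrite !nabpE endB endN sg_e sg_pde sg_pdo endN opprK. Qed.

Lemma nab_d i j a : nab i (d j a) = d j (nab i a) + (i == j)%:R *: pz a.
Proof. by rewrite !nabE endB pde_x -!pde_pdo eq_sym; vect_ring. Qed.
Lemma nab_di i j a : nab i (di j a) = - di j (nab i a).
Proof. by rewrite !nabE endB di_x pdo_pdo [pz _]pdo_pdo !endN; vect_ring. Qed.
Lemma nab_pz i a : nab i (pz a) = - pz (nab i a).
Proof. by rewrite !nabE endB pdo_x [di i (pz a)]pdo_pdo !pdo_sq end0; vect_ring. Qed.
Lemma nab_eul i a : nab i (eul a) = eul (nab i a) + di i a + x i (pz a).
Proof. by rewrite !nabE endB di_eul pz_eul eul_x; vect_ring. Qed.

Lemma nabp_d i j a : nabp i (d j a) = d j (nabp i a).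
Proof. by rewrite !nabpE endB endN pde_e pde_pde -pde_pdo. Qed.
Lemma nabp_di i j a : nabp i (di j a) = di j (nabp i a) + (i == j)%:R *: pz a.
Proof. by rewrite !nabpE endB endN di_xi pde_pdo [pz _]pdo_pdo endN eq_sym; vect_ring. Qed.
Lemma nabp_pz i a : nabp i (pz a) = pz (nabp i a).
Proof. by rewrite !nabpE endB endN pz_xi pde_pdo pdo_sq end0 !oppr0. Qed.
Lemma nabp_eul i a : nabp i (eul a) = eul (nabp i a) - d i a + xi i (pz a).
Proof. by rewrite !nabpE endB endN d_eul pz_eul eul_xi; vect_ring. Qed.

(* D_KO, with the signs (-1)^p(a) absorbed in the parity automorphism. *)
Lemma Dk_subproof : {f : M -> 'End(M) | forall a c, f a c =
  \sum_i (mul (d i a) (di i c) + mul (di i (sg a)) (d i c))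
  + mul (pz (sg a)) (eul c) + mul (eul a - 2 *: a) (pz c)}.
Proof.
exists (fun a => \sum_i ((mul (d i a) \o di i) + (mul (di i (sg a)) \o d i))%VF
  + (mul (pz (sg a)) \o eul)%VF + (mul (eul a - 2 *: a) \o pz)%VF) => a c.
rewrite !add_lfunE sum_lfunE !comp_lfunE; congr (_ + _ + _).
by apply: eq_bigr => i _; rewrite add_lfunE !comp_lfunE.
Qed.
Definition Dk : M -> 'End(M) := sval Dk_subproof.

Lemma DkE a c : Dk a c = \sum_i (mul (d i a) (di i c) + mul (di i (sg a)) (d i c))
  + mul (pz (sg a)) (eul c) + mul (eul a - 2 *: a) (pz c).
Proof. exact: (svalP Dk_subproof). Qed.

Lemma nab_Dk i b c : nab i (Dk b c) = Dk (nab i b) c - Dk (sg b) (nab i c).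
Proof.
apply/eqP; rewrite eq_sym subr_eq eq_sym; apply/eqP.
rewrite !DkE !endD !sgK end_sum.
(* The terms with [i == j], due to [nab i] not commuting with [d i], cancel below against those
   produced by the Euler operator. *)
have key j : nab i (mul (d j b) (di j c) + mul (di j (sg b)) (d j c)) +
    (mul (d j (sg b)) (di j (nab i c)) + mul (di j b) (d j (nab i c))) =
    mul (d j (nab i b)) (di j c) + mul (di j (sg (nab i b))) (d j c) +
    (i == j)%:R *: (mul (pz b) (di j c) - mul (di j b) (pz c)).
  rewrite endD !nab_mul !nab_d !nab_di !nab_sg !sg_pde !sg_pdo !sgK !endD !endN !endZ.
  by rewrite !lmulDl !lmulNl !lmulZl; vect_ring.
transitivity (\sum_j (nab i (mul (d j b) (di j c) + mul (di j (sg b)) (d j c)) +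
    (mul (d j (sg b)) (di j (nab i c)) + mul (di j b) (d j (nab i c)))) +
    nab i (mul (pz (sg b)) (eul c)) + mul (pz b) (eul (nab i c))
    + nab i (mul (eul b - 2 *: b) (pz c)) + mul (eul (sg b) - 2 *: sg b) (pz (nab i c))).
  by rewrite [in RHS]big_split /=; vect_ring.
under eq_bigr => j _ do rewrite key.
rewrite big_split /= sum_delta !nab_mul nab_pz nab_eul nab_sg nab_pz !endB nab_eul !endZ
  sg_eul.
rewrite !(lmulDl, lmulBl, lmulNl, lmulZl, endD, endN, endB, endZ, sg_pdo, sgK).
by rewrite mul_even_gen mulr_even_gen; vect_ring.
Qed.

Lemma nabp_Dk i b c : nabp i (Dk b c) = Dk (nabp i b) c + Dk b (nabp i c).
Proof.
rewrite !DkE !endD end_sum.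
have key j : nabp i (mul (d j b) (di j c) + mul (di j (sg b)) (d j c)) =
    mul (d j (nabp i b)) (di j c) + mul (di j (sg (nabp i b))) (d j c) +
    (mul (d j b) (di j (nabp i c)) + mul (di j (sg b)) (d j (nabp i c))) +
    (i == j)%:R *: (mul (d j b) (pz c) + mul (pz (sg b)) (d j c)).
  rewrite endD !nabp_mul !nabp_d !nabp_di !nabp_sg !endD !endZ.
  by rewrite !lmulDl !lmulZl; vect_ring.
under eq_bigr => j _ do rewrite key.
rewrite !big_split /= !sum_delta !nabp_mul !nabp_pz nabp_eul nabp_sg !endB nabp_eul !endZ.
rewrite !(lmulDl, lmulBl, lmulNl, lmulZl, endD, endN, endB, endZ).
by rewrite lmul_odd_gen mulr_odd_gen sg_pdo sgK lmulNl endN; vect_ring.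
Qed.
End Contact.

(** * The grading and its transitivity *)

Section Degree.
Variables (F : fieldType) (p n : nat) (t : 'I_n -> nat) (M : dp_model F p t).
Implicit Types (a b c f g : M) (i j k : 'I_n) (u v : {set 'I_n.+1}).
Local Notation x i := (mul (even_gen M i)).
Local Notation xi i := (mul (odd_gen M (inod i))).
Local Notation z := (mul (odd_gen M ord_max)).
Local Notation d i := (dx M i).
Local Notation di i := (dxi M (inod i)).
Local Notation pz := (dxi M ord_max).
Local Notation sg := (psign (par M)).
Local Notation one := (oneO M).
Local Notation nab := (nab M).
Local Notation nabp := (nabp M).
Local Notation eul := (eul M).

Definition deg (al : 'I_n -> nat) u : nat :=
  (\sum_i al i + #|u| + (ord_max \in u))%N.

(** Integer degrees allow lowering operators without case distinctions; negative degrees contain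
    only 0. As a predicate closed under linear combinations, it lets operators be checked on
    monomials alone. *)
Inductive homog (s : int) : M -> Prop :=
| homog0 : homog s 0
| homogL l a b : homog s a -> homog s b -> homog s (l *: a + b)
| homog_in al u : (forall i, al i < p ^ t i)%N -> (deg al u)%:Z = s -> homog s (xm M al u).

Lemma homog_xm s al u : (deg al u)%:Z = s -> homog s (xm M al u).
Proof.
have [h e|[i h] _] := exponent_range p t al; first exact: homog_in.
by rewrite (xm_out _ _ h); apply: homog0.
Qed.

Lemma homogZ s l a : homog s a -> homog s (l *: a).
Proof. by move=> ha; rewrite -[_ *: _]addr0; apply: homogL => //; apply: homog0. Qed.
Lemma homogD s a b : homog s a -> homog s b -> homog s (a + b).
Proof. by move=> ha hb; rewrite -[a]scale1r; apply: homogL. Qed.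
Lemma homogN s a : homog s a -> homog s (- a).
Proof. by rewrite -scaleN1r; apply: homogZ. Qed.
Lemma homogB s a b : homog s a -> homog s b -> homog s (a - b).
Proof. by move=> ha hb; apply: homogD => //; apply: homogN. Qed.
Lemma homog_sum s (I : Type) (r : seq I) (P : pred I) (E : I -> M) :
  (forall l, P l -> homog s (E l)) -> homog s (\sum_(l <- r | P l) E l).
Proof. by move=> h; elim/big_ind: _ => //; [apply: homog0|apply: homogD]. Qed.

Lemma homog_end s r (f : 'End(M)) :
  (forall al u, (forall i, al i < p ^ t i)%N -> homog ((deg al u)%:Z + r) (f (xm M al u))) ->
  forall a, homog s a -> homog (s + r) (f a).
Proof.
move=> h a; elim=> [|l b c _ Hb _ Hc|al u hal <-]; last exact: h.
- by rewrite end0; apply: homog0.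
- by rewrite endP; apply: homogL.
Qed.

Lemma homog_d s i a : homog s a -> homog (s - 1) (d i a).
Proof.
apply: homog_end => al u hal; rewrite dx_xm //; case: eqP => ai; first exact: homog0.
apply: homog_xm; rewrite /deg (bigD1 i) //= [in RHS](bigD1 i) //= eqxx.
rewrite (eq_bigr al); last by move=> k /negPf ->; rewrite subn0.
lia.
Qed.

Lemma degU1 al (j : 'I_n.+1) u : j \notin u ->
  deg al (j |: u) = (deg al u + 1 + (j == ord_max))%N.
Proof.
move=> ju; rewrite /deg cardsU1 ju in_setU1 [_ == j]eq_sym.
have [<-|_] := eqVneq j ord_max; rewrite ?(negPf ju) /=.
- by lia.
by case: (_ \in u) => /=; lia.
Qed.

Lemma homog_dxi s (j : 'I_n.+1) a : homog s a ->
  homog (s - (1 + (j == ord_max))%N%:Z) (dxi M j a).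
Proof.
apply: homog_end => al u hal; rewrite dxi_xm; case: ifP => ju; last exact: homog0.
apply/homogZ/homog_xm; rewrite -{2}(setD1K ju) degU1 ?setD11 //.
by move: (deg _ _) => q; case: (j == _); lia.
Qed.

Lemma homog_mul s r f g : homog s f -> homog r g -> homog (s + r) (mul f g).
Proof.
move=> hf hg; elim: hf => [|l b c _ Hb _ Hc|al u hal <-].
- by rewrite lmul0l; apply: homog0.
- by rewrite lmulPl; apply: homogL.
rewrite addrC; apply: homog_end hg => be v hbe; rewrite mul_xm; case: ifP => duv;
  last exact: homog0.
apply/homogZ/homog_xm; rewrite /deg big_split /= cardsU disjoint_setI0 // cards0 subn0 in_setU.
have : (ord_max \in u) && (ord_max \in v) = false.
  by apply/negP => /andP[mu mv]; rewrite (disjointFr duv mu) in mv.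
by case: (_ \in u); case: (_ \in v) => //=; lia.
Qed.

Lemma homog_sg s a : homog s a -> homog s (sg a).
Proof.
rewrite -{2}[s]addr0; apply: homog_end => al u hal; rewrite sg_xm addr0.
exact/homogZ/homog_xm.
Qed.

Lemma homog_even_gen i : homog 1 (even_gen M i).
Proof.
apply: homog_xm; rewrite /deg cards0 inE !addn0 (bigD1 i) //= eqxx big1 ?addn0 //.
by move=> k /negPf ->.
Qed.

Lemma homog_odd_gen (j : 'I_n.+1) : homog (1 + (j == ord_max))%N (odd_gen M j).
Proof. by apply: homog_xm; rewrite /deg cards1 inE eq_sym big1. Qed.

Lemma homog_x s i a : homog s a -> homog (s + 1) (x i a).
Proof. by move=> ha; rewrite addrC; apply: homog_mul => //; apply: homog_even_gen. Qed.
Lemma homog_xi s i a : homog s a -> homog (s + 1) (xi i a).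
Proof.
move=> ha; rewrite addrC; apply: homog_mul => //.
by have := homog_odd_gen (inod i); rewrite inod_max.
Qed.
Lemma homog_z s a : homog s a -> homog (s + 2) (z a).
Proof. by move=> ha; rewrite addrC; apply: homog_mul => //; have := homog_odd_gen ord_max;
  rewrite eqxx. Qed.
Lemma homog_di s i a : homog s a -> homog (s - 1) (di i a).
Proof. by move=> /(homog_dxi (inod i)); rewrite inod_max. Qed.
Lemma homog_pz s a : homog s a -> homog (s - 2) (pz a).
Proof. by move=> /(homog_dxi ord_max); rewrite eqxx. Qed.

Lemma homog_eq s r a : homog s a -> s = r -> homog r a. Proof. by move=> ? <-. Qed.

Lemma homog_eul s a : homog s a -> homog s (eul a).
Proof.
move=> ha; rewrite eulE; apply: homog_sum => i _; apply: homogD.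
  by apply: homog_eq; [apply/homog_x/homog_d/ha|lia].
by apply: homog_eq; [apply/homog_xi/homog_di/ha|lia].
Qed.

Lemma homog_nab s i a : homog s a -> homog (s - 1) (nab i a).
Proof.
move=> ha; rewrite nabE; apply: homogB; first exact: homog_di.
by apply: homog_eq; [apply/homog_x/homog_pz/ha|lia].
Qed.
Lemma homog_nabp s i a : homog s a -> homog (s - 1) (nabp i a).
Proof.
move=> ha; rewrite nabpE; apply: homogB; first by apply: homogN; apply: homog_d.
by apply: homog_eq; [apply/homog_xi/homog_pz/ha|lia].
Qed.

Lemma homog_Dk s r a b : homog s a -> homog r b -> homog (s + r - 2) (Dk a b).
Proof.
move=> ha hb; rewrite DkE; apply: homogD; last first.
  apply: (@homog_eq (s + (r - 2))); last by lia.
  by apply: homog_mul; [apply: homogB; [apply: homog_eul|apply: homogZ]|apply: homog_pz].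
apply: homogD; last first.
  apply: (@homog_eq (s - 2 + r)); last by lia.
  by apply: homog_mul; [apply/homog_pz/homog_sg|apply: homog_eul].
apply: homog_sum => i _; apply: (@homog_eq ((s - 1) + (r - 1))); last by lia.
by apply: homogD; apply: homog_mul;
  [apply: homog_d|apply: homog_di|apply/homog_di/homog_sg|apply: homog_d].
Qed.

Lemma cf0 al u : cf al u (0 : M) = 0.
Proof.
have := cf_linear al u 1 (0 : M) 0; rewrite scale1r addr0 mul1r => e.
by apply: (addrI (cf al u (0 : M))); rewrite addr0 -e.
Qed.
Lemma cfD al u a b : cf al u (a + b) = cf al u a + cf al u b.
Proof. by rewrite -[a]scale1r cf_linear mul1r scale1r. Qed.
Lemma cfZ al u l a : cf al u (l *: a) = l * cf al u a.
Proof. by rewrite -[l *: a]addr0 cf_linear cf0 addr0. Qed.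
Lemma cfB al u a b : cf al u (a - b) = cf al u a - cf al u b.
Proof. by rewrite cfD -scaleN1r cfZ mulN1r. Qed.

Lemma cf_ext al be u a : (forall i, al i < p ^ t i)%N -> al =1 be -> cf al u a = cf be u a.
Proof.
move=> hal e; elim/xm_ind: a => [|l b c Hb Hc|ga v _]; first by rewrite !cf0.
  by rewrite !cf_linear Hb Hc.
have hbe i : (be i < p ^ t i)%N by rewrite -e.
by rewrite !cf_xm //; congr ((_ && _)%:R); apply: eq_forallb => i; rewrite e.
Qed.

Lemma homog_cf s a al u : (forall i, al i < p ^ t i)%N -> homog s a -> (deg al u)%:Z != s ->
  cf al u a = 0.
Proof.
move=> hal ha ds; elim: ha => [|l b c _ Hb _ Hc|be v _ e]; first exact: cf0.
  by rewrite cf_linear Hb Hc mulr0 addr0.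
rewrite cf_xm //; case: andP => // -[/forallP h /eqP uv]; move: ds.
by rewrite -e uv /deg (eq_bigr be) ?eqxx // => i _; apply/eqP.
Qed.

Lemma homog_uniq s r a : homog s a -> homog r a -> s != r -> a = 0.
Proof.
move=> hs hr sr; apply: cf_inj => al u hal.
have [e|/homog_cf ->//] := eqVneq ((deg al u)%:Z) s.
by apply: (homog_cf hal hr); rewrite e.
Qed.

Lemma homog_neg s a : homog s a -> s < 0 -> a = 0.
Proof.
move=> hs s0; apply: cf_inj => al u hal; apply: (homog_cf hal hs).
by apply: contraTneq s0 => <-.
Qed.

Lemma homog_decomp a : exists K, exists s : nat -> M,
  (forall k : nat, homog k%:Z (s k)) /\ a = \sum_(k < K) s k.
Proof.
(* The vanishing of the components from [K] on is carried along so that decompositions of different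
   lengths can be added. *)
suff [K [s [h1 [h2 h3]]]] : exists K, exists s : nat ->
  M, (forall k : nat, homog k%:Z (s k)) /\
    (forall k : nat, (K <= k)%N -> s k = 0) /\ a = \sum_(k < K) s k by exists K, s.
elim/xm_ind: a => [|l a b [K [s [h1 [h2 ->]]]] [L [r [h1' [h2' ->]]]]|al u hal].
- by exists 0%N, (fun=> 0); split; [move=> k; apply: homog0|rewrite big_ord0].
- exists (maxn K L), (fun k : nat => l *: s k + r k); split; [|split].
  + by move=> k; apply: homogL.
  + by move=> k; rewrite geq_max => /andP[/h2 -> /h2' ->]; rewrite scaler0 addr0.
  have ext N (e : nat -> M) : (forall k : nat, (N <= k)%N -> e k = 0) ->
      forall N', (N <= N')%N -> \sum_(k < N) e k = \sum_(k < N') e k.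
    move=> he N' NN'; rewrite (big_ord_widen N' e NN') big_mkcond.
    by apply: eq_bigr => k _; case: ltnP => // /he.
  rewrite (ext K s h2 (maxn K L)) ?leq_maxl // (ext L r h2' (maxn K L)) ?leq_maxr //.
  by rewrite big_split /= -scaler_sumr.
exists (deg al u).+1, (fun k : nat => if k == deg al u then xm M al u else 0); split; [|split].
- by move=> k; case: eqP => [->|_]; [apply: homog_xm|apply: homog0].
- by move=> k; case: eqP => // ->; rewrite ltnn.
rewrite big_ord_recr /= eqxx big1 ?add0r // => k _.
by rewrite ltn_eqF.
Qed.

Lemma homog_sum0 K (r : int) (s : nat -> M) : (forall k : nat, homog (k%:Z + r) (s k)) ->
  \sum_(k < K) s k = 0 -> forall k : nat, (k < K)%N -> s k = 0.
Proof.
move=> hs e k kK; apply: cf_inj => al u hal.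
have [dk|/(homog_cf hal (hs k))//] := eqVneq ((deg al u)%:Z) (k%:Z + r).
rewrite -(cf0 al u) -e (bigD1 (Ordinal kK)) //= cfD.
suff -> : cf al u (\sum_(i < K | i != Ordinal kK) s i) = 0 by rewrite addr0.
elim/big_rec: _ => [|i y ik IH]; first exact: cf0.
rewrite cfD IH addr0; apply: (homog_cf hal (hs i)); rewrite dk.
by apply: contra ik => /eqP h; apply/eqP/val_inj => /=; lia.
Qed.

Lemma homog_case0 s a : homog s a -> s = 0 -> exists l, a = l *: one.
Proof.
elim=> [|l b c _ Hb _ Hc|al u hal e] s0; first by exists 0; rewrite scale0r.
  have [k ->] := Hb s0; have [k' ->] := Hc s0.
  by exists (l * k + k'); rewrite scalerDl scalerA.
exists 1; rewrite scale1r; move: e; rewrite s0 /deg => e.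
have u0 : u = set0 by apply/eqP; rewrite -cards_eq0; lia.
rewrite u0; apply: xm_ext => i; apply/eqP; rewrite -leqn0.
by have : (\sum_i al i <= 0)%N; [lia|rewrite (bigD1 i) //=; lia].
Qed.

(** As x_{2n+1} has degree 2, degree 1 is spanned by the other generators. *)
Lemma homog_ind1 (P : M -> Prop) : P 0 -> (forall l a b, P a -> P b -> P (l *: a + b)) ->
  (forall i, P (even_gen M i)) -> (forall i, P (odd_gen M (inod i))) ->
  forall s a, homog s a -> s = 1 -> P a.
Proof.
move=> P0 PL Px Pxi s a; elim=> [|l b c _ Hb _ Hc|al u hal e] s1 //; first by apply: PL; auto.
move: e; rewrite s1 /deg => e.
have [u0|/set0Pn[j ju]] := eqVneq u set0.
  have [i ai] : exists i, (0 < al i)%N.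
    case: (boolP [exists i, (0 < al i)%N]) => [/existsP//|].
    rewrite negb_exists => /forallP h; move: e; rewrite u0 cards0 inE big1 // => i _.
    by apply/eqP; rewrite -leqn0 leqNgt; apply: h.
  rewrite u0 (_ : xm M al set0 = even_gen M i) //; apply: xm_ext => k.
  move: e; rewrite u0 cards0 inE (bigD1 i) //=; have [->|ki] := eqVneq k i; first by lia.
  by rewrite (bigD1 k) //=; lia.
have [jn u1] : j != ord_max /\ #|u :\ j| = 0%N.
  move: e; rewrite (cardsD1 j) ju; case: (eqVneq j ord_max) => [<-|_]; rewrite ?ju; lia.
have jn' : (j < n)%N.
  by move: (ltn_ord j); rewrite ltnS leq_eqVlt => /orP[/eqP h|//]; case/eqP: jn; apply/val_inj.
rewrite (_ : xm M al u = odd_gen M (inod (Ordinal jn'))) //.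
have -> : u = [set inod (Ordinal jn')].
  rewrite -(setD1K ju) (cards0_eq u1) setU0; congr [set _]; exact: val_inj.
apply: xm_ext => i; move: e; rewrite (cardsD1 j) ju (bigD1 i) //=; lia.
Qed.

Lemma cf_d i al u a : (forall k, al k < p ^ t k)%N -> (0 < al i)%N ->
  cf al u a = cf (fun k => (al k - (k == i))%N) u (d i a).
Proof.
move=> hal ai; elim/xm_ind: a => [|l a b Ha Hb|be v hbe]; first by rewrite end0 !cf0.
  by rewrite endP !cf_linear Ha Hb.
have hal' k : (al k - (k == i) < p ^ t k)%N by apply: leq_ltn_trans (hal k); apply: leq_subr.
rewrite dx_xm // cf_xm //; have [bi|bi] := eqVneq (be i) 0%N.
  rewrite cf0; case: andP => // -[/forallP/(_ i)/eqP]; lia.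
rewrite cf_xm //; congr ((_ && _)%:R); apply: eq_forallb => k.
by have [->|_] := eqVneq k i; lia.
Qed.

Lemma cf_dxi (j : 'I_n.+1) al u a : (forall k, al k < p ^ t k)%N -> j \in u ->
  cf al u a = ksign F j (u :\ j) * cf al (u :\ j) (dxi M j a).
Proof.
move=> hal ju; elim/xm_ind: a => [|l a b Ha Hb|be v hbe]; first by rewrite end0 !cf0 mulr0.
  by rewrite endP !cf_linear Ha Hb; ring.
rewrite dxi_xm cf_xm //; case: ifP => jv; last first.
  rewrite cf0 mulr0; case: andP => // -[_ /eqP uv]; by rewrite -uv ju in jv.
rewrite cfZ cf_xm // -/(ksign F j v).
have -> : (u :\ j == v :\ j) = (u == v).
  by apply/eqP/eqP => [h|-> //]; rewrite -(setD1K ju) h setD1K.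
have [->|uv] := eqVneq u v; last by rewrite !andbF !mulr0.
by rewrite ksignD1 // ltnn mul1r mulrA ksignK mul1r.
Qed.

(** The Heisenberg relation: the operators of degree -1 generate -2 [pz], which is D_KO(1). It lets
    statements about [pz] be deduced from those about [nab] and [nabp]. *)
Lemma nab_nabp i a : nab i (nabp i a) - nabp i (nab i a) = - (2 *: pz a).
Proof.
rewrite !nabE !nabpE !(endB, endN, pdo_x, di_x, di_xi, pz_xi, pde_x, pde_pdo, pdo_sq, end0,
  eqxx).
rewrite [di i (pz a)]pdo_pdo !endN !scale1r.
by vect_ring.
Qed.

(* Transitivity of the grading. *)
Lemma nab_const a : (forall i, nab i a = 0) -> (forall i, nabp i a = 0) ->
  exists l, a = l *: one.
Proof.
move=> h h'.
have i0 : 'I_n := Ordinal (ltn_trans (isT : 0 < 2)%N (dp_nge3 M)).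
have pza : pz a = 0.
  have := nab_nabp i0 a; rewrite h h' !end0 subr0 => /esym/eqP.
  by rewrite oppr_eq0 scaler_eq0 (negPf (two_neq0 M)) => /eqP.
have dia i : di i a = 0 by have := h i; rewrite nabE pza end0 subr0.
have da i : d i a = 0.
  by have := h' i; rewrite nabpE pza end0 subr0 => /eqP; rewrite oppr_eq0 => /eqP.
have h0 i : (0 < p ^ t i)%N := ltnW (expn_gt1 M i).
exists (cf (fun=> 0%N) set0 a); apply/eqP; rewrite -subr_eq0; apply/eqP.
apply: cf_inj => al u hal; rewrite cfB cfZ /oneO cf_xm //.
have [u0|/set0Pn[j ju]] := eqVneq u set0; last first.
  rewrite andbF mulr0 subr0 (cf_dxi _ hal ju).
  suff -> : dxi M j a = 0 by rewrite cf0 mulr0.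
  have [->//|jn] := eqVneq j ord_max.
  have jn' : (j < n)%N.
    by move: (ltn_ord j); rewrite ltnS leq_eqVlt => /orP[/eqP e|//]; case/eqP: jn;
      apply/val_inj.
  by rewrite -(dia (Ordinal jn')); congr (dxi _ _ _); apply: val_inj.
rewrite u0 andbT; case: (boolP [forall i, al i == 0%N]) => [/forallP al0|].
  rewrite mulr1; apply/eqP; rewrite subr_eq0; apply/eqP.
  by apply: cf_ext => // i; apply/eqP.
rewrite negb_forall mulr0 subr0 => /existsP[i ai].
by rewrite (@cf_d i) ?lt0n // da cf0.
Qed.
End Degree.

(** * D_KO turns the contact bracket into the commutator *)

Section Bracket.
Variables (F : fieldType) (p n : nat) (t : 'I_n -> nat) (M : dp_model F p t).
Implicit Types (a b c f g : M) (i j k : 'I_n) (u v : {set 'I_n.+1}).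
Local Notation x i := (mul (even_gen M i)).
Local Notation xi i := (mul (odd_gen M (inod i))).
Local Notation z := (mul (odd_gen M ord_max)).
Local Notation d i := (dx M i).
Local Notation di i := (dxi M (inod i)).
Local Notation pz := (dxi M ord_max).
Local Notation sg := (psign (par M)).
Local Notation p0 := (par M false).
Local Notation p1 := (par M true).
Local Notation one := (oneO M).
Local Notation nab := (nab M).
Local Notation nabp := (nabp M).
Local Notation eul := (eul M).

Lemma DkPl l a b c : Dk (l *: a + b) c = l *: Dk a c + Dk b c.
Proof.
rewrite !DkE !endP.
under eq_bigr => i _ do rewrite !endP !lmulPl addrACA -scalerDr.
rewrite big_split /= -scaler_sumr !lmulPl.
have -> : l *: eul a + eul b - 2 *: (l *: a + b) = l *: (eul a - 2 *: a) + (eul b - 2 *: b).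
  by vect_ring.
by rewrite lmulPl; vect_ring.
Qed.
Lemma Dk0l c : Dk (0 : M) c = 0.
Proof. by apply: (addrI (Dk (1 *: 0 : M) c));
  rewrite -{1}[Dk _ c]scale1r scaler0 -DkPl scaler0 !addr0. Qed.
Lemma DkDl a b c : Dk (a + b) c = Dk a c + Dk b c.
Proof. by rewrite -[a]scale1r DkPl !scale1r. Qed.
Lemma DkZl l a c : Dk (l *: a) c = l *: Dk a c.
Proof. by rewrite -[l *: a]addr0 DkPl Dk0l addr0. Qed.
Lemma DkNl a c : Dk (- a) c = - Dk a c.
Proof. by rewrite -scaleN1r DkZl scaleN1r. Qed.
Lemma DkBl a b c : Dk (a - b) c = Dk a c - Dk b c.
Proof. by rewrite DkDl DkNl. Qed.

Lemma sg_Dk a c : sg (Dk a c) = - Dk (sg a) (sg c).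
Proof.
rewrite !DkE !endD end_sum !opprD -sumrN; congr (_ + _ + _).
- apply: eq_bigr => i _; rewrite endD !sg_mul !sg_pde !sg_pdo !lmulNl endN sgK.
  by vect_ring.
- by rewrite sg_mul sg_pdo sg_eul lmulNl.
by rewrite sg_mul sg_pdo endB endZ sg_eul endN.
Qed.

Lemma p0E a : p0 a = a - p1 a.
Proof. exact: PfE (par_sum M) a. Qed.
Lemma sg_p0 a : sg (p0 a) = p0 a.
Proof. by rewrite psignE ?PPE; [rewrite scaler0 subr0|exact: par_par..|exact: par_sum]. Qed.
Lemma sg_p1 a : sg (p1 a) = - p1 a.
Proof. by rewrite psignE ?PPE; [vect_ring|exact: par_par..|exact: par_sum]. Qed.
Lemma p1E a : p1 a = 2^-1 *: (a - sg a).
Proof.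
rewrite psignE; last exact: par_sum.
by rewrite opprB addrC subrK scalerA mulVf ?scale1r // (two_neq0 M).
Qed.
Lemma p0E' a : p0 a = 2^-1 *: (a + sg a).
Proof. by rewrite p0E p1E; have h2 := two_neq0 M; vect_field. Qed.

(* The bracket <a, b> with [D_KO(a), D_KO(b)] = D_KO(<a, b>), see br_Dk. *)
Lemma ko_subproof : {f : M -> M -> M | forall a b, f a b = Dk a b - 2 *: mul (pz (sg a)) b}.
Proof. by exists (fun a b => Dk a b - 2 *: mul (pz (sg a)) b). Qed.
Definition ko : M -> M -> M := sval ko_subproof.
Lemma koE a b : ko a b = Dk a b - 2 *: mul (pz (sg a)) b.
Proof. exact: (svalP ko_subproof). Qed.

Lemma nab_ko i a b : nab i (ko a b) = ko (nab i a) b - ko (sg a) (nab i b).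
Proof.
rewrite !koE endB endZ nab_Dk nab_mul nab_pz nab_sg !sg_pdo endN sgK opprK.
by rewrite lmulNl; vect_ring.
Qed.

Lemma nabp_ko i a b : nabp i (ko a b) = ko (nabp i a) b + ko a (nabp i b).
Proof. by rewrite !koE endB endZ nabp_Dk nabp_mul nabp_pz nabp_sg; vect_ring. Qed.

Lemma sg_ko a b : sg (ko a b) = - ko (sg a) (sg b).
Proof. by rewrite !koE endB endZ sg_Dk sg_mul sg_pdo lmulNl; vect_ring. Qed.

Lemma koPl l a a' b : ko (l *: a + a') b = l *: ko a b + ko a' b.
Proof. by rewrite !koE DkPl !endP lmulPl; vect_ring. Qed.
Lemma koPr l a b b' : ko a (l *: b + b') = l *: ko a b + ko a b'.
Proof. by rewrite !koE !endP; vect_ring. Qed.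

(** Deduced from [nab_Dk] and [nabp_Dk] through the Heisenberg relation, so the defining sum of [Dk]
    is not expanded again. *)
Lemma pz_Dk b c : pz (Dk b c) = Dk (pz b) c - Dk (sg b) (pz c).
Proof.
have [i _] : exists i : 'I_n, true by exists (Ordinal (ltn_trans (isT : 0 < 2)%N (dp_nge3 M))).
apply: (scalerI (two_neq0 M)); apply: oppr_inj.
rewrite -(nab_nabp i) nabp_Dk nab_Dk endD endB !nab_Dk !nabp_Dk nabp_sg.
have e a : 2 *: pz a = - (nab i (nabp i a) - nabp i (nab i a)) by rewrite nab_nabp opprK.
by rewrite scalerBr -DkZl -(endZ (Dk (sg b))) (e b) (e c) !(DkNl, DkDl, endN, endD); vect_ring.
Qed.

Lemma d_one i : d i one = 0.
Proof. by rewrite dx_xm // (leq_trans _ (expn_gt1 M i)). Qed.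
Lemma dxi_one (j : 'I_n.+1) : dxi M j one = 0.
Proof. by rewrite dxi_xm inE. Qed.
Lemma sg_one : sg one = one. Proof. by rewrite sg_xm cards0 scale1r. Qed.
Lemma x_one i : x i one = even_gen M i. Proof. exact: lmulr1. Qed.
Lemma xi_one i : xi i one = odd_gen M (inod i). Proof. exact: lmulr1. Qed.

Lemma Dk_one c : Dk one c = - (2 *: pz c).
Proof.
rewrite DkE big1 => [|i _]; last by rewrite sg_one d_one dxi_one !lmul0l addr0.
by rewrite sg_one dxi_one eul_one lmul0l sub0r lmulNl lmulZl lmul1 !add0r.
Qed.

Lemma Dk_x i c : Dk (even_gen M i) c = nab i c.
Proof.
rewrite -x_one DkE.
under eq_bigr => j _ do rewrite sg_x sg_one pde_x di_x d_one dxi_one !end0 addr0 lmul0l addr0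
  lmulZl lmul1 eq_sym.
rewrite sum_delta sg_x sg_one pdo_x dxi_one end0 lmul0l addr0 eul_x eul_one end0 add0r.
by rewrite lmulBl lmulZl mul_even_gen lmul1 nabE; vect_ring.
Qed.

Lemma Dk_xi i c : Dk (odd_gen M (inod i)) c = nabp i c.
Proof.
rewrite -xi_one DkE.
under eq_bigr => j _ do rewrite sg_e sg_one endN pde_e di_xi d_one dxi_one !end0 subr0
  lmul0l add0r
  lmulNl lmulZl lmul1 eq_sym -scalerN.
rewrite sum_delta sg_e sg_one endN pz_xi dxi_one end0 oppr0 oppr0 lmul0l addr0 eul_xi
  eul_one end0 add0r.
by rewrite lmulBl lmulZl lmul_odd_gen lmul1 nabpE; vect_ring.
Qed.

Lemma ko_one b : ko one b = - (2 *: pz b).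
Proof. by rewrite !koE Dk_one sg_one dxi_one lmul0l scaler0 subr0. Qed.
Lemma ko_x i b : ko (even_gen M i) b = nab i b.
Proof. by rewrite !koE Dk_x -x_one sg_x sg_one pdo_x dxi_one end0 lmul0l scaler0 subr0. Qed.
Lemma ko_xi i b : ko (odd_gen M (inod i)) b = nabp i b.
Proof.
by rewrite !koE Dk_xi -xi_one sg_e sg_one endN pz_xi dxi_one end0 !oppr0 lmul0l scaler0 subr0.
Qed.

Lemma Dk_1r a : Dk a one = 0.
Proof.
rewrite DkE big1 => [|i _]; last by rewrite d_one dxi_one !end0 addr0.
by rewrite eul_one dxi_one !end0 !addr0.
Qed.

Lemma ko_oner a : ko a one = - (2 *: pz (sg a)).
Proof. by rewrite !koE Dk_1r lmulr1 sub0r. Qed.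

Lemma ko_xr i a : ko a (even_gen M i) = nab i (sg a).
Proof.
rewrite !koE -x_one DkE.
under eq_bigr => j _ do rewrite pde_x di_x d_one dxi_one !end0 add0r addr0 endZ lmulr1 eq_sym.
rewrite sum_delta pdo_x dxi_one !end0 addr0 eul_x eul_one end0 add0r mulr_even_gen lmulr1 nabE.
by vect_ring.
Qed.

Lemma ko_xir i a : ko a (odd_gen M (inod i)) = - nabp i a.
Proof.
rewrite !koE -xi_one DkE.
under eq_bigr => j _ do rewrite pde_e di_xi d_one dxi_one !end0 subr0 addr0 endZ lmulr1 eq_sym.
rewrite sum_delta pz_xi dxi_one !end0 oppr0 end0 addr0 eul_xi eul_one end0 add0r mulr_odd_gen.
by rewrite sg_pdo sgK lmulNl endN lmulr1 nabpE; vect_ring.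
Qed.

(* The failure of [a |-> Dk a] to be a homomorphism, evaluated at [c]. *)
Definition Xk a b c := Dk a (Dk b c) + Dk (sg b) (Dk (p0 a) c) - Dk b (Dk (p1 a) c) - Dk
  (ko a b) c.

(** The defect is equivariant under the negative part, so applying [nab i] yields defects of smaller
    total degree. Being odd, [nab i] exchanges the projections [p0] and [p1], whence the signs. *)
Lemma nab_Xk i a b c :
  nab i (Xk a b c) = Xk (nab i a) b c - Xk (sg a) (nab i b) c + Xk (sg a) (sg b) (nab i c).
Proof.
have e0 : p0 (nab i a) = nab i (p1 a) by rewrite p0E' p1E endZ endB nab_sg opprK.
have e1 : p1 (nab i a) = nab i (p0 a) by rewrite p1E p0E' endZ endD nab_sg.
have e2 : p0 (sg a) = p0 a by rewrite !p0E' sgK addrC.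
have e3 : p1 (sg a) = - p1 a by rewrite !p1E sgK -opprB scalerN.
rewrite /Xk !(endB, endD) e0 e1 e2 e3 !nab_Dk !endB nab_ko sg_ko !nab_sg !sgK.
rewrite !sg_p0 !sg_p1 !(DkDl, DkNl, DkBl, endN, endB).
by vect_ring.
Qed.

Lemma nabp_Xk i a b c : nabp i (Xk a b c) = Xk (nabp i a) b c + Xk a (nabp i b) c + Xk a b
  (nabp i c).
Proof.
have e0 : p0 (nabp i a) = nabp i (p0 a) by rewrite !p0E' endZ endD nabp_sg.
have e1 : p1 (nabp i a) = nabp i (p1 a) by rewrite !p1E endZ endB nabp_sg.
rewrite /Xk !(endB, endD) e0 e1 !nabp_Dk !endD nabp_ko !nabp_sg.
by rewrite !(DkDl, endD); vect_ring.
Qed.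

Lemma XkPa l a a' b c : Xk (l *: a + a') b c = l *: Xk a b c + Xk a' b c.
Proof. by rewrite /Xk koPl !(DkPl, endP); vect_ring. Qed.
Lemma XkPb l a b b' c : Xk a (l *: b + b') c = l *: Xk a b c + Xk a b' c.
Proof. by rewrite /Xk koPr !(DkPl, endP); vect_ring. Qed.
Lemma XkPc l a b c c' : Xk a b (l *: c + c') = l *: Xk a b c + Xk a b c'.
Proof. by rewrite /Xk !(endP); vect_ring. Qed.
Lemma Xk0a b c : Xk 0 b c = 0.
Proof.
have := XkPa (-1) 0 0 b c; rewrite scaler0 addr0 => {1}->; by rewrite scaleN1r addNr.
Qed.
Lemma Xk0b a c : Xk a 0 c = 0.
Proof.
have := XkPb (-1) a 0 0 c; rewrite scaler0 addr0 => {1}->; by rewrite scaleN1r addNr.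
Qed.
Lemma Xk0c a b : Xk a b 0 = 0.
Proof.
have := XkPc (-1) a b 0 0; rewrite scaler0 addr0 => {1}->; by rewrite scaleN1r addNr.
Qed.

(** This and the next lemmas start the induction on the degree: the first or second argument has
    degree at most 1, or the third is constant. In the first two cases the rules [pz_Dk], [nab_Dk]
    and [nabp_Dk] suffice. *)
Lemma Xk_1 b c : Xk one b c = 0.
Proof.
rewrite /Xk p0E' p1E sg_one subrr scaler0 Dk0l end0 DkZl DkDl !Dk_one ko_one endZ pz_Dk.
by rewrite DkNl DkZl endD endN endZ; have h2 := two_neq0 M; vect_field.
Qed.
Lemma Xk_x i b c : Xk (even_gen M i) b c = 0.
Proof.
have s : sg (even_gen M i) = even_gen M i by rewrite -x_one sg_x sg_one.
rewrite /Xk p0E' p1E s subrr scaler0 Dk0l end0 DkZl DkDl !Dk_x ko_x endZ nab_Dk.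
by rewrite endD; have h2 := two_neq0 M; vect_field.
Qed.
Lemma Xk_xi i b c : Xk (odd_gen M (inod i)) b c = 0.
Proof.
have s : sg (odd_gen M (inod i)) = - odd_gen M (inod i) by rewrite -xi_one sg_e sg_one.
rewrite /Xk p0E' p1E s subrr scaler0 Dk0l end0 opprK DkZl DkDl !Dk_xi ko_xi endZ nabp_Dk.
by rewrite endD; have h2 := two_neq0 M; vect_field.
Qed.
Lemma Xk_1r a c : Xk a one c = 0.
Proof.
rewrite /Xk p0E' p1E ko_oner sg_one !Dk_one !DkZl DkNl DkZl !DkDl DkNl endN !endZ !endD endN.
by rewrite !pz_Dk sgK; have h2 := two_neq0 M; vect_field.
Qed.
Lemma Xk_xr i a c : Xk a (even_gen M i) c = 0.
Proof.
have s : sg (even_gen M i) = even_gen M i by rewrite -x_one sg_x sg_one.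
rewrite /Xk p0E' p1E ko_xr s !Dk_x !DkZl !DkDl DkNl !endZ !endD endN.
by rewrite !nab_Dk sgK; have h2 := two_neq0 M; vect_field.
Qed.
Lemma Xk_xir i a c : Xk a (odd_gen M (inod i)) c = 0.
Proof.
have s : sg (odd_gen M (inod i)) = - odd_gen M (inod i) by rewrite -xi_one sg_e sg_one.
rewrite /Xk p0E' p1E ko_xir s DkNl !Dk_xi !DkZl !DkDl !DkNl !endZ !endD endN.
by rewrite !nabp_Dk; have h2 := two_neq0 M; vect_field.
Qed.
Lemma Xk_onec a b : Xk a b one = 0.
Proof. by rewrite /Xk !Dk_1r !end0 addr0 !subr0. Qed.

Lemma homog_ko s r a b : homog s a -> homog r b -> homog (s + r - 2) (ko a b).
Proof.
move=> ha hb; rewrite koE; apply: homogB; first exact: homog_Dk.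
apply/homogZ/(@homog_eq _ _ _ _ _ (s - 2 + r)); last by lia.
by apply: homog_mul => //; apply/homog_pz/homog_sg.
Qed.

Lemma homog_p s r a : homog s a -> homog s (par M r a).
Proof.
by move=> ha; case: r; rewrite ?p1E ?p0E'; apply: homogZ;
  [apply: homogB|apply: homogD] => //; apply: homog_sg.
Qed.

Lemma homog_Xk s r q a b c : homog s a -> homog r b -> homog q c ->
  homog (s + r + q - 4) (Xk a b c).
Proof.
move=> ha hb hc; apply: homogB; last first.
  by apply: (@homog_eq _ _ _ _ _ (s + r - 2 + q - 2)); [apply: homog_Dk => //;
    apply: homog_ko|lia].
apply: homogB; last first.
  by apply: (@homog_eq _ _ _ _ _ (r + (s + q - 2) - 2)); [apply: homog_Dk => //;
    apply: homog_Dk => //; apply: homog_p|lia].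
apply: homogD.
  by apply: (@homog_eq _ _ _ _ _ (s + (r + q - 2) - 2)); [apply: homog_Dk => //;
    apply: homog_Dk|lia].
apply: (@homog_eq _ _ _ _ _ (r + (s + q - 2) - 2)); last lia.
by apply: homog_Dk; [apply: homog_sg|apply: homog_Dk => //; apply: homog_p].
Qed.

Lemma Xk_small s a b c : homog s a -> s < 2 -> Xk a b c = 0.
Proof.
move=> ha s2.
have [s1|[s0|sn]] : s = 1 \/ s = 0 \/ s < 0 by lia.
- move: s a ha s1 {s2}; apply: homog_ind1; first exact: Xk0a.
  + by move=> l a a' ea ea'; rewrite XkPa ea ea' scaler0 addr0.
  + by move=> i; apply: Xk_x.
  by move=> i; apply: Xk_xi.
- have [l ->] := homog_case0 ha s0.
  by rewrite -[l *: _]addr0 XkPa Xk_1 Xk0a scaler0 addr0.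
by rewrite (homog_neg ha sn) Xk0a.
Qed.
Lemma Xk_smallr s a b c : homog s b -> s < 2 -> Xk a b c = 0.
Proof.
move=> ha s2.
have [s1|[s0|sn]] : s = 1 \/ s = 0 \/ s < 0 by lia.
- move: s b ha s1 {s2}; apply: homog_ind1; first exact: Xk0b.
  + by move=> l b b' ea ea'; rewrite XkPb ea ea' scaler0 addr0.
  + by move=> i; apply: Xk_xr.
  by move=> i; apply: Xk_xir.
- have [l ->] := homog_case0 ha s0.
  by rewrite -[l *: _]addr0 XkPb Xk_1r Xk0b scaler0 addr0.
by rewrite (homog_neg ha sn) Xk0b.
Qed.
Lemma Xk_smallc s a b c : homog s c -> s <= 0 -> Xk a b c = 0.
Proof.
move=> ha s0; have [e|ne] := eqVneq s 0.
  have [l ->] := homog_case0 ha e.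
  by rewrite -[l *: _]addr0 XkPc Xk_onec Xk0c scaler0 addr0.
by rewrite (homog_neg ha) ?Xk0c //; lia.
Qed.

(** Outside the base cases s, r >= 2 and q >= 1, so the defect has degree s + r + q - 4 >= 1, and a
    constant of positive degree is zero. *)
Lemma Xk_homog (N : nat) : forall s r q a b c, homog s a -> homog r b -> homog q c ->
  s + r + q <= N%:Z ->
  Xk a b c = 0.
Proof.
elim: N => [|N IH] s r q a b c ha hb hc hN;
  (have [s2|s2] : s < 2 \/ 2 <= s by lia); (try by apply: Xk_small ha _);
  (have [r2|r2] : r < 2 \/ 2 <= r by lia); (try by apply: Xk_smallr hb _);
  (have [q1|q1] : q <= 0 \/ 1 <= q by lia); (try by apply: Xk_smallc hc _); first by lia.
have [|i|l e] := @nab_const _ _ _ _ M (Xk a b c).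
- move=> i; rewrite nab_Xk.
  rewrite (IH _ _ _ _ _ _ (homog_nab i ha) hb hc); last by lia.
  rewrite (IH _ _ _ _ _ _ (homog_sg ha) (homog_nab i hb) hc); last by lia.
  rewrite (IH _ _ _ _ _ _ (homog_sg ha) (homog_sg hb) (homog_nab i hc)); last by lia.
  by rewrite subr0 addr0.
- rewrite nabp_Xk.
  rewrite (IH _ _ _ _ _ _ (homog_nabp i ha) hb hc); last by lia.
  rewrite (IH _ _ _ _ _ _ ha (homog_nabp i hb) hc); last by lia.
  rewrite (IH _ _ _ _ _ _ ha hb (homog_nabp i hc)); last by lia.
  by rewrite !addr0.
apply: (homog_uniq (homog_Xk ha hb hc)).
  rewrite e; apply/homogZ/(@homog_xm _ _ _ _ _ 0); rewrite /deg cards0 inE big1 //.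
by lia.
Qed.

Lemma Xk_eq0 a b c : Xk a b c = 0.
Proof.
have h l u : homog (deg l u)%:Z (xm M l u) by apply: homog_xm.
elim/xm_ind: a => [|l a a' Ha Ha'|al u _]; [exact: Xk0a|by rewrite XkPa Ha Ha' scaler0 addr0|].
elim/xm_ind: b => [|l b b' Hb Hb'|be v _]; [exact: Xk0b|by rewrite XkPb Hb Hb' scaler0 addr0|].
elim/xm_ind: c => [|l c c' Hc Hc'|ga w _]; [exact: Xk0c|by rewrite XkPc Hc Hc' scaler0 addr0|].
by apply: (@Xk_homog (deg al u + deg be v + deg ga w)); [apply: h..|rewrite !PoszD].
Qed.

End Bracket.

(** * The divergence *)

Section Divergence.
Variables (F : fieldType) (p n : nat) (t : 'I_n -> nat) (M : dp_model F p t) (lam : F).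
Implicit Types (a b c f g : M) (i j k : 'I_n) (u v : {set 'I_n.+1}).
Local Notation x i := (mul (even_gen M i)).
Local Notation xi i := (mul (odd_gen M (inod i))).
Local Notation z := (mul (odd_gen M ord_max)).
Local Notation d i := (dx M i).
Local Notation di i := (dxi M (inod i)).
Local Notation pz := (dxi M ord_max).
Local Notation sg := (psign (par M)).
Local Notation one := (oneO M).
Local Notation nab := (nab M).
Local Notation nabp := (nabp M).
Local Notation eul := (eul M).

Lemma Del_subproof : {f : 'End(M) | forall a, f a = \sum_i d i (di i a)}.
Proof.
exists (\sum_i (d i \o di i)%VF) => a.
by rewrite sum_lfunE; apply: eq_bigr => i _; rewrite comp_lfunE.
Qed.
(** The odd Laplacian of Batalin and Vilkovisky. *)
Definition Del : 'End(M) := sval Del_subproof.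
Lemma DelE a : Del a = \sum_i d i (di i a). Proof. exact: (svalP Del_subproof). Qed.

(* Up to the parity automorphism and a factor 2, the divergence div_lambda. *)
Lemma rho_subproof :
  {f : 'End(M) | forall a, f a = Del a + (eul (pz a) - (n%:R * lam) *: pz a)}.
Proof.
exists (Del + ((eul - (n%:R * lam) *: \1) \o pz))%VF => a.
by rewrite add_lfunE comp_lfunE add_lfunE opp_lfunE scale_lfunE id_lfunE.
Qed.
Definition rho : 'End(M) := sval rho_subproof.
Lemma rhoE a : rho a = Del a + (eul (pz a) - (n%:R * lam) *: pz a).
Proof. exact: (svalP rho_subproof). Qed.

Lemma nab_Del i a : nab i (Del a) = - Del (nab i a) + pz (di i a).
Proof.
rewrite !DelE end_sum -sumrN.
under eq_bigr => j _ do rewrite nab_d nab_di endN.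
rewrite big_split /= sum_delta; congr (_ + _).
Qed.

Lemma nabp_Del i a : nabp i (Del a) = Del (nabp i a) + d i (pz a).
Proof.
rewrite !DelE end_sum.
under eq_bigr => j _ do rewrite nabp_d nabp_di endD endZ.
by rewrite big_split /= sum_delta.
Qed.

(** [rho] supercommutes with the negative part, which makes its kernel stable under it. *)
Lemma nab_rho i a : nab i (rho a) = - rho (nab i a).
Proof.
rewrite !rhoE endD endB endZ nab_Del nab_eul nab_pz endN pdo_sq end0 [di i (pz a)]pdo_pdo.
by vect_ring.
Qed.
Lemma nabp_rho i a : nabp i (rho a) = rho (nabp i a).
Proof.
rewrite !rhoE endD endB endZ nabp_Del nabp_eul nabp_pz pdo_sq end0.
by vect_ring.
Qed.

Lemma sg_Del a : sg (Del a) = - Del (sg a).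
Proof. by rewrite !DelE end_sum -sumrN; apply: eq_bigr => i _; rewrite sg_pde sg_pdo endN. Qed.
Lemma sg_rho a : sg (rho a) = - rho (sg a).
Proof. by rewrite !rhoE endD endB endZ sg_Del sg_eul sg_pdo endN; vect_ring. Qed.
Lemma pz_Del a : pz (Del a) = - Del (pz a).
Proof. by rewrite !DelE end_sum -sumrN; apply: eq_bigr => i _;
  rewrite -pde_pdo pdo_pdo endN. Qed.

Lemma homog_Del s a : homog s a -> homog (s - 2) (Del a).
Proof.
move=> ha; rewrite DelE; apply: homog_sum => i _.
by apply: (@homog_eq _ _ _ _ _ (s - 1 - 1)); [apply/homog_d/homog_di|lia].
Qed.
Lemma homog_rho s a : homog s a -> homog (s - 2) (rho a).
Proof.
move=> ha; rewrite rhoE; apply: homogD; first exact: homog_Del.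
by apply: homogB; [apply/homog_eul/homog_pz|apply/homogZ/homog_pz].
Qed.

Lemma x_d_xm i al u : (forall k, al k < p ^ t k)%N ->
  x i (d i (xm M al u)) = (al i)%:R *: xm M al u.
Proof.
move=> hal; rewrite dx_xm //; have [->|ai] := eqVneq (al i) 0%N; first by rewrite end0 scale0r.
rewrite even_gen_xm eqxx; congr (_ *: _); first by congr (_%:R); lia.
by apply: xm_ext => k; have [->|] := eqVneq k i; lia.
Qed.

Lemma e_dxi_xm (j : 'I_n.+1) al u :
  mul (odd_gen M j) (dxi M j (xm M al u)) = (j \in u)%:R *: xm M al u.
Proof.
rewrite dxi_xm; have [ju|ju] := boolP (j \in u); last by rewrite end0 scale0r.
by rewrite endZ odd_gen_xm setD11 scalerA ksignD1 // ltnn mul1r ksignK setD1K.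
Qed.

Lemma eul_homog s a : homog s a -> eul a + 2 *: z (pz a) = s%:~R *: a.
Proof.
elim=> [|l b c _ Hb _ Hc|al u hal <-]; first by rewrite !end0 !scaler0 addr0.
  by rewrite scalerDr scalerA mulrC -scalerA -Hb -Hc !endP; vect_ring.
rewrite eulE (eq_bigr (fun i => ((al i)%:R + (inod i \in u)%:R) *: xm M al u)); last first.
  by move=> i _; rewrite x_d_xm // e_dxi_xm scalerDl.
rewrite -scaler_suml e_dxi_xm scalerA -scalerDl; congr (_ *: _).
rewrite big_split /= -!natr_sum /deg -pmulrn !natrD -addrA.
have -> : #|u| = (\sum_(i < n) (inod i \in u) + (ord_max \in u))%N.
  rewrite -sum1_card big_mkcond big_ord_recr /=.
  under eq_bigr => i _ do rewrite -mulrb.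
  by case: (ord_max \in u).
by rewrite natrD; ring.
Qed.

Lemma eul_homog2 a : homog 2 a -> eul a = 2 *: a - 2 *: z (pz a).
Proof. by move=> /eul_homog <-; rewrite addrK. Qed.

(** In degree 2 the derivative [pz] is a scalar and [eul a = 2 a - 2 z (pz a)], so all terms with
    [pz] cancel. The Buttin bracket, the odd Poisson bracket in x_1, ..., x_2n, remains. *)
Lemma ko_deg2 a b : homog 2 a -> homog 2 b ->
  ko a b = \sum_i (mul (d i a) (di i b) + mul (di i (sg a)) (d i b)).
Proof.
move=> ha hb; have [l el] : exists l, pz a = l *: one.
  by apply: (homog_case0 (s := 0)) => //; apply: (homog_eq (homog_pz ha)).
have [r er] : exists l, pz b = l *: one.
  by apply: (homog_case0 (s := 0)) => //; apply: (homog_eq (homog_pz hb)).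
rewrite koE DkE !eul_homog2 // -[pz (sg a)]opprK -sg_pdo el er !endZ sg_one lmulNl lmulZl.
rewrite lmul1 !lmulNl !lmulZl !lmul1 !(lmulBl, lmulZl) !lmulr1.
by vect_ring.
Qed.

Lemma sum_anti (E : 'I_n -> 'I_n -> M) : (forall i j, E i j = - E j i) ->
  \sum_i \sum_j E i j = 0.
Proof.
move=> h; apply: (scalerI (two_neq0 M)); rewrite scaler0 scaler_nat mulr2n.
rewrite {1}exchange_big -big_split big1 // => i _ /=.
by rewrite -big_split big1 // => j _ /=; rewrite h addNr.
Qed.

(** Expanding [Del] of the Buttin bracket gives four double sums. In two of them the summand is
    antisymmetric in i and j; the other two cancel each other after exchanging the indices. *)
Lemma rho_ko_deg2 a b : homog 2 a -> homog 2 b -> rho (ko a b) = 0.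
Proof.
move=> ha hb; have [l el] : exists l, pz a = l *: one.
  by apply: (homog_case0 (s := 0)) => //; apply: (homog_eq (homog_pz ha)).
have [r er] : exists l, pz b = l *: one.
  by apply: (homog_case0 (s := 0)) => //; apply: (homog_eq (homog_pz hb)).
have pk : pz (ko a b) = 0.
  rewrite ko_deg2 // end_sum big1 // => i _; rewrite endD !pdo_mul -!pde_pdo.
  rewrite ![pz (di i _)]pdo_pdo -[pz (sg a)]opprK -sg_pdo el er !(endN,
    endZ) sg_one d_one dxi_one.
  by rewrite !(scaler0, oppr0, lmul0l, end0, addr0).
rewrite rhoE pk end0 scaler0 subr0 addr0 ko_deg2 // DelE.
have dd0 i j c : homog 1 c -> d i (di j c) = 0.
  by move=> hc; apply: (homog_neg (s := 1 - 1 - 1)) => //; apply/homog_d/homog_di.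
have ha1 i : homog 1 (d i a) by apply: (homog_eq (homog_d i ha)).
have hb1 i : homog 1 (d i b) by apply: (homog_eq (homog_d i hb)).
have ha2 i : homog 1 (di i (sg a)) by apply: (homog_eq (homog_di i (homog_sg ha))).
have hb2 i : homog 1 (di i b) by apply: (homog_eq (homog_di i hb)).
have leib f g j : homog 1 f -> homog 1 g ->
    d j (di j (mul f g)) = mul (di j f) (d j g) + mul (d j (sg f)) (di j g).
  move=> hf hg; rewrite pdo_mul endD !pde_mul (dd0 _ _ _ hf) (dd0 _ _ _ hg).
  by rewrite lmul0l add0r end0 addr0.
rewrite (eq_bigr (fun j =>
  \sum_i (mul (di j (d i a)) (d j (di i b)) + mul (d j (sg (d i a))) (di j (di i b))
  + (mul (di j (di i (sg a))) (d j (d i b)) + mul (d j (sg (di i (sg a)))) (di j (d i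
    b)))))); last first.
  move=> j _; rewrite !end_sum; apply: eq_bigr => i _; by rewrite !endD !leib.
under eq_bigr => j _ do rewrite !big_split /=.
rewrite !big_split /= addrACA.
rewrite [X in _ + X + _]sum_anti; last first.
  by move=> i j; rewrite pde_pde pdo_pdo lmulNl.
rewrite [X in _ + (X + _)]sum_anti; last first.
  by move=> i j; rewrite !sg_pde pde_pde pdo_pdo endN.
rewrite addr0 add0r [X in _ + X]exchange_big -big_split big1 // => i _ /=.
rewrite -big_split big1 // => j _ /=.
by rewrite sg_pdo sgK endN lmulNl -!pde_pdo subrr.
Qed.

Lemma sg_ker a : rho a = 0 -> rho (sg a) = 0.
Proof. by move=> ra; rewrite -[rho _]opprK -sg_rho ra end0 oppr0. Qed.
Lemma nab_ker i a : rho a = 0 -> rho (nab i a) = 0.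
Proof. by move=> ra; rewrite -[rho _]opprK -nab_rho ra end0 oppr0. Qed.
Lemma nabp_ker i a : rho a = 0 -> rho (nabp i a) = 0.
Proof. by move=> ra; rewrite -nabp_rho ra end0. Qed.
Lemma pz_rho a : pz (rho a) = - rho (pz a).
Proof.
rewrite !rhoE !(endD, endN) pz_Del pz_eul endZ !pdo_sq.
by rewrite !(end0, scaler0, oppr0, addr0).
Qed.
Lemma pz_ker a : rho a = 0 -> rho (pz a) = 0.
Proof. by move=> ra; rewrite -[rho _]opprK -pz_rho ra end0 oppr0. Qed.

Lemma ko0l b : ko (0 : M) b = 0.
Proof. by have := koPl (-1) 0 0 b; rewrite scaler0 addr0 scaleN1r addNr. Qed.
Lemma ko0r a : ko a (0 : M) = 0.
Proof. by have := koPr (-1) a 0 0; rewrite scaler0 addr0 scaleN1r addNr. Qed.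
Lemma koZl l a b : ko (l *: a) b = l *: ko a b.
Proof. by rewrite -[l *: a]addr0 koPl ko0l addr0. Qed.
Lemma koZr l a b : ko a (l *: b) = l *: ko a b.
Proof. by rewrite -[l *: b]addr0 koPr ko0r addr0. Qed.
Lemma koDl a a' b : ko (a + a') b = ko a b + ko a' b.
Proof. by rewrite -[a]scale1r koPl !scale1r. Qed.
Lemma koDr a b b' : ko a (b + b') = ko a b + ko a b'.
Proof. by rewrite -[b]scale1r koPr !scale1r. Qed.

Lemma rho_ko_small s a b : homog s a -> s < 2 -> rho b = 0 -> rho (ko a b) = 0.
Proof.
move=> ha s2 rb.
have [s1|[s0|sn]] : s = 1 \/ s = 0 \/ s < 0 by lia.
- move: s a ha s1 {s2}; apply: homog_ind1.
  + by rewrite ko0l end0.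
  + by move=> l a a' ea ea'; rewrite koPl endP ea ea' scaler0 addr0.
  + by move=> i; rewrite ko_x nab_ker.
  by move=> i; rewrite ko_xi nabp_ker.
- have [l ->] := homog_case0 ha s0.
  by rewrite koZl ko_one !(endZ, endN) pz_ker // scaler0 oppr0 scaler0.
by rewrite (homog_neg ha sn) ko0l end0.
Qed.
Lemma rho_ko_smallr s a b : homog s b -> s < 2 -> rho a = 0 -> rho (ko a b) = 0.
Proof.
move=> hb s2 ra.
have [s1|[s0|sn]] : s = 1 \/ s = 0 \/ s < 0 by lia.
- move: s b hb s1 {s2}; apply: homog_ind1.
  + by rewrite ko0r end0.
  + by move=> l b b' eb eb'; rewrite koPr endP eb eb' scaler0 addr0.
  + by move=> i; rewrite ko_xr nab_ker // sg_ker.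
  by move=> i; rewrite ko_xir endN nabp_ker // oppr0.
- have [l ->] := homog_case0 hb s0.
  by rewrite koZr ko_oner !(endZ, endN) pz_ker ?sg_ker // scaler0 oppr0 scaler0.
by rewrite (homog_neg hb sn) ko0r end0.
Qed.

(** The divergence of the bracket has degree s + r - 4. Once s, r >= 2, a constant is excluded by
    its degree except for s = r = 2, hence the separate treatment of that case. *)
Lemma rho_ko_homog (N : nat) : forall s r a b, homog s a -> homog r b -> s + r <= N%:Z + 4 ->
  rho a = 0 -> rho b = 0 -> rho (ko a b) = 0.
Proof.
elim: N => [|N IH] s r a b ha hb hN ra rb;
  (have [s2|s2] : s < 2 \/ 2 <= s by lia); (try by apply: rho_ko_small ha _ _);
  (have [r2|r2] : r < 2 \/ 2 <= r by lia); (try by apply: rho_ko_smallr hb _ _).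
  by apply: rho_ko_deg2; [apply: homog_eq ha _|apply: homog_eq hb _]; lia.
have [e4|n4] := eqVneq (s + r) 4.
  by apply: rho_ko_deg2; [apply: homog_eq ha _|apply: homog_eq hb _]; lia.
have [i|i|l e] := @nab_const _ _ _ _ M (rho (ko a b)).
- rewrite nab_rho nab_ko endB (IH _ _ _ _ (homog_nab i ha) hb) ?nab_ker //; last by lia.
  by rewrite (IH _ _ _ _ (homog_sg ha) (homog_nab i hb)) ?subrr ?oppr0 ?nab_ker ?sg_ker //;
    lia.
- rewrite nabp_rho nabp_ko endD (IH _ _ _ _ (homog_nabp i ha) hb) ?nabp_ker //; last by lia.
  by rewrite (IH _ _ _ _ ha (homog_nabp i hb)) ?addr0 ?nabp_ker //; lia.
apply: (homog_uniq (homog_rho (homog_ko ha hb))).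
  rewrite e; apply/homogZ/(@homog_xm _ _ _ _ _ 0); rewrite /deg cards0 inE big1 //.
by lia.
Qed.

Lemma rho_ko a b : rho a = 0 -> rho b = 0 -> rho (ko a b) = 0.
Proof.
have [K [s [hs ->]]] := homog_decomp a; have [L [r [hr ->]]] := homog_decomp b.
rewrite !end_sum => rs rr.
(* [rho] is homogeneous of degree -2, so it kills each component of an element that it kills. *)
have {}rs (k : nat) : (k < K)%N -> rho (s k) = 0.
  apply: (@homog_sum0 _ _ _ _ M K (- 2%:Z) (fun k : nat => rho (s k))) => // i.
  exact/homog_rho/hs.
have {}rr (k : nat) : (k < L)%N -> rho (r k) = 0.
  apply: (@homog_sum0 _ _ _ _ M L (- 2%:Z) (fun k : nat => rho (r k))) => // i.
  exact/homog_rho/hr.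
elim/big_ind: _ => [|a1 a2 h1 h2|k _]; first by rewrite ko0l end0.
  by rewrite koDl endD h1 h2 addr0.
elim/big_ind: _ => [|b1 b2 h1 h2|l _]; first by rewrite ko0r end0.
  by rewrite koDr endD h1 h2 addr0.
apply: (@rho_ko_homog (k + l)%N _ _ _ _ (hs k) (hr l)); rewrite ?rs ?rr //; lia.
Qed.

End Divergence.

(** * Torus weights and the homotopy for the odd Laplacian *)

Section Weights.
Variables (F : fieldType) (p n : nat) (t : 'I_n -> nat) (M : dp_model F p t) (lam : F).
Implicit Types (a b c f g q : M) (i j k l : 'I_n) (u v : {set 'I_n.+1}).
Local Notation x i := (mul (even_gen M i)).
Local Notation xi i := (mul (odd_gen M (inod i))).
Local Notation z := (mul (odd_gen M ord_max)).
Local Notation d i := (dx M i).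
Local Notation di i := (dxi M (inod i)).
Local Notation pz := (dxi M ord_max).
Local Notation sg := (psign (par M)).
Local Notation one := (oneO M).
Local Notation nab := (nab M).
Local Notation nabp := (nabp M).
Local Notation eul := (eul M).
Local Notation Del := (Del M).
Local Notation rho := (rho M lam).

(* The toral element h_i = x_i x_{i'}; W i is its adjoint action. *)
Definition hh i : M := x i (xi i one).
Definition W i : 'End(M) := Dk (hh i).

Lemma sg_hh i : sg (hh i) = - hh i.
Proof. by rewrite /hh sg_x sg_e sg_one endN. Qed.
Lemma pz_hh i : pz (hh i) = 0.
Proof. by rewrite /hh pdo_x pz_xi dxi_one !(end0, oppr0). Qed.
Lemma d_hh i j : d i (hh j) = (i == j)%:R *: xi j one.
Proof. by rewrite /hh pde_x pde_e d_one !end0 addr0. Qed.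
Lemma di_hh i j : di i (hh j) = (i == j)%:R *: x j one.
Proof. by rewrite /hh di_x di_xi dxi_one end0 subr0 endZ. Qed.
Lemma eul_hh i : eul (hh i) = 2 *: hh i.
Proof. by rewrite /hh eul_x eul_xi eul_one end0 add0r scaler_nat. Qed.

Lemma WE i a : W i a = xi i (di i a) - x i (d i a).
Proof.
rewrite /W DkE eul_hh subrr lmul0l addr0 sg_hh endN pz_hh oppr0 lmul0l addr0.
under eq_bigr => j _ do rewrite endN d_hh di_hh lmulNl !lmulZl lmul_odd_gen mul_even_gen !lmul1
  [j == i]eq_sym -scalerBr.
by rewrite sum_delta.
Qed.

Lemma ko_hh i a : ko (hh i) a = W i a.
Proof. by rewrite koE sg_hh endN pz_hh oppr0 lmul0l scaler0 subr0. Qed.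

Lemma W_xm i al u : (forall k, al k < p ^ t k)%N ->
  W i (xm M al u) = ((inod i \in u)%:R - (al i)%:R) *: xm M al u.
Proof. by move=> hal; rewrite WE e_dxi_xm x_d_xm // scalerBl. Qed.

Lemma W_x i k a : W i (x k a) = x k (W i a) - (i == k)%:R *: x k a.
Proof.
rewrite !WE di_x e_x pde_x !(endD, endN, endZ) [x i (x k _)]x_x.
by have [->|_] := eqVneq i k; rewrite ?scale1r ?scale0r; vect_ring.
Qed.
Lemma W_xi i k a : W i (xi k a) = xi k (W i a) + (i == k)%:R *: xi k a.
Proof.
rewrite !WE di_xi pde_e -e_x !endB endZ odd_gen_anti.
by have [->|_] := eqVneq i k; rewrite ?scale1r ?scale0r; vect_ring.
Qed.
Lemma W_z i a : W i (z a) = z (W i a).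
Proof. by rewrite !WE di_z pde_e -e_x !endB endN odd_gen_anti opprK. Qed.
Lemma W_one i : W i one = 0.
Proof. by rewrite WE d_one dxi_one !end0 subr0. Qed.
Lemma W_hh i k : W i (hh k) = 0.
Proof. by rewrite /hh W_x W_xi W_one end0 add0r endZ subrr. Qed.
Lemma W_pz i a : W i (pz a) = pz (W i a).
Proof. by rewrite !WE endB pz_xi pdo_x -pde_pdo [di i (pz a)]pdo_pdo endN. Qed.
Lemma W_eul i a : W i (eul a) = eul (W i a).
Proof. by rewrite !WE endB eul_xi eul_x di_eul d_eul !endD; vect_ring. Qed.

Lemma Del_x i a : Del (x i a) = x i (Del a) + di i a.
Proof.
rewrite !DelE end_sum; under eq_bigr => j _ do rewrite di_x pde_x addrC eq_sym.
by rewrite big_split /= sum_delta.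
Qed.
Lemma Del_xi i a : Del (xi i a) = d i a - xi i (Del a).
Proof.
rewrite !DelE end_sum -sumrN.
under eq_bigr => j _ do rewrite di_xi endB endZ pde_e eq_sym.
by rewrite big_split /= sum_delta.
Qed.
Lemma Del_z a : Del (z a) = - z (Del a).
Proof. by rewrite !DelE end_sum -sumrN; apply: eq_bigr => j _; rewrite di_z endN pde_e. Qed.
Lemma Del_one : Del one = 0.
Proof. by rewrite DelE big1 // => j _; rewrite dxi_one end0. Qed.
Lemma Del_di i a : Del (di i a) = - di i (Del a).
Proof. by rewrite !DelE end_sum -sumrN; apply: eq_bigr => j _;
  rewrite -pde_pdo pdo_pdo endN. Qed.
Lemma Del_d i a : Del (d i a) = d i (Del a).
Proof. by rewrite !DelE end_sum; apply: eq_bigr => j _; rewrite -pde_pdo pde_pde. Qed.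
Lemma Del_eul a : Del (eul a) = eul (Del a) + 2 *: Del a.
Proof.
rewrite !DelE end_sum scaler_sumr -big_split; apply: eq_bigr => j _ /=.
by rewrite di_eul endD d_eul scaler_nat mulr2n addrA.
Qed.
Lemma Del_Del a : Del (Del a) = 0.
Proof.
rewrite [Del (Del a)]DelE DelE.
under eq_bigr => j _ do rewrite !end_sum.
by apply: sum_anti => i j; rewrite -!pde_pdo pde_pde pdo_pdo !endN.
Qed.
Lemma Del_hh i : Del (hh i) = one.
Proof. by rewrite /hh Del_x Del_xi di_xi d_one dxi_one Del_one !end0 subr0 end0 add0r eqxx
  scale1r subr0. Qed.

Lemma W_Del i a : W i (Del a) = Del (W i a).
Proof.
by rewrite !WE endB Del_xi Del_x Del_di Del_d -pde_pdo endN; vect_ring.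
Qed.
Lemma W_rho i a : W i (rho a) = rho (W i a).
Proof. by rewrite !rhoE endD endB endZ W_Del W_eul W_pz. Qed.

(* [x_i xi_i] gives a contracting homotopy of [Del] on weights other than [1]. *)
Lemma Del_homotopy i a : Del (x i (xi i a)) = a - W i a - x i (xi i (Del a)).
Proof. by rewrite Del_x Del_xi di_xi eqxx scale1r WE endB; vect_ring. Qed.

(* The divergence-free element with x_{2n+1}-part Delta q, for q without x_{2n+1}. *)
Definition bq q : M := z (Del q) - (eul q - (2 + n%:R * lam) *: q).

Lemma bqP s q q' : bq (s *: q + q') = s *: bq q + bq q'.
Proof. by rewrite /bq !endP; vect_ring. Qed.

Lemma bq0 : bq 0 = 0.
Proof. by rewrite /bq !end0 scaler0 !subr0. Qed.
Lemma bqZ s q : bq (s *: q) = s *: bq q.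
Proof. by rewrite -[s *: q]addr0 bqP bq0 addr0. Qed.

Lemma pz_bq q : pz q = 0 -> pz (bq q) = Del q.
Proof.
move=> pq; rewrite /bq !endB endZ pz_z pz_eul pz_Del pq !end0 scaler0 !subr0.
by rewrite oppr0 end0 subr0.
Qed.
(** As [Del] squares to 0 and Del eul = eul Del + 2 Del, the second part of [bq q] contributes -(eul
    - n lambda)(Del q), the opposite of the term from [pz]. The constant 2 + n lambda in [bq] is
    chosen for this. *)
Lemma rho_bq q : pz q = 0 -> rho (bq q) = 0.
Proof.
move=> pq; rewrite rhoE (pz_bq pq) /bq !endB endZ Del_z Del_Del Del_eul end0.
by vect_ring.
Qed.
(** Up to a value of [Del], which [Q_Del] will absorb, [bq] carries partial derivatives to the
    action of the negative part. *)
Lemma nab_bq i q : pz q = 0 -> nab i (bq q) = bq (di i q) - Del (x i q).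
Proof.
move=> pq; rewrite nabE (pz_bq pq) /bq !endB endZ di_z di_eul Del_di Del_x endN.
by vect_ring.
Qed.
Lemma nabp_bq i q : pz q = 0 -> nabp i (bq q) = Del (xi i q) - bq (d i q).
Proof.
move=> pq; rewrite nabpE (pz_bq pq) /bq !endB endZ pde_e d_eul Del_d Del_xi.
by vect_ring.
Qed.
Lemma W_bq i q : W i (bq q) = bq (W i q).
Proof. by rewrite /bq !endB endZ W_z W_Del W_eul. Qed.

Definition topO : M := xm M (fun i => (p ^ t i).-1) [set~ ord_max].

Lemma pz_xm al u : ord_max \notin u -> pz (xm M al u) = 0.
Proof. by move=> /negPf mu; rewrite dxi_xm mu. Qed.

Lemma pz_topO : pz topO = 0.
Proof. by rewrite pz_xm // !inE eqxx. Qed.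

(** * Elements reached by brackets with the part of degree -1 *)

Section NegativeSpan.
(** [Q a] stands for the membership of D(a) in [N, L] + F G. *)
Variable Q : M -> Prop.
Hypothesis Q0 : Q 0.
Hypothesis QL : forall s a b, Q a -> Q b -> Q (s *: a + b).
Hypothesis Q_nab : forall i b, rho b = 0 -> Q (nab i b).
Hypothesis Q_nabp : forall i b, rho b = 0 -> Q (nabp i b).
Hypothesis Q_topO : Q (bq topO).

Let QD a b : Q a -> Q b -> Q (a + b).
Proof. by move=> ha hb; rewrite -[a]scale1r; apply: QL. Qed.
Let QZ s a : Q a -> Q (s *: a).
Proof. by move=> ha; rewrite -[_ *: _]addr0; apply: QL. Qed.
Let QN a : Q a -> Q (- a).
Proof. by rewrite -scaleN1r; apply: QZ. Qed.

(** The Heisenberg relation writes [pz b] through [nab] and [nabp] applied to divergence-free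
    elements. *)
Lemma Q_pz b : rho b = 0 -> Q (pz b).
Proof.
move=> rb; have [i _] : exists i : 'I_n,
  true by exists (Ordinal (ltn_trans (isT : 0 < 2)%N (dp_nge3 M))).
have -> : pz b = - 2^-1 *: (nab i (nabp i b) - nabp i (nab i b)).
  by rewrite nab_nabp scaleNr scalerN opprK scalerA mulVf ?scale1r // (two_neq0 M).
by apply: QZ; apply: QD; [apply/Q_nab/nabp_ker|apply/QN/Q_nabp/nab_ker].
Qed.

(** [Del q] is the x_{2n+1}-coefficient of the divergence-free element [bq q]. *)
Lemma Q_Del q : pz q = 0 -> Q (Del q).
Proof. by move=> pq; rewrite -(pz_bq pq); apply/Q_pz/rho_bq. Qed.

Lemma Q_bq_di i q : pz q = 0 -> Q (bq (di i q)).
Proof.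
move=> pq; have -> : bq (di i q) = nab i (bq q) + Del (x i q) by rewrite nab_bq // subrK.
by apply: QD; [apply/Q_nab/rho_bq|apply: Q_Del; rewrite pdo_x pq end0].
Qed.
Lemma Q_bq_d i q : pz q = 0 -> Q (bq (d i q)).
Proof.
move=> pq; have -> : bq (d i q) = - nabp i (bq q) + Del (xi i q) by rewrite nabp_bq //
  opprB subrK.
by apply: QD; [apply/QN/Q_nabp/rho_bq|apply: Q_Del; rewrite pz_xi pq end0 oppr0].
Qed.

(** A monomial with an exponent that can still grow is a derivative [d i], and one missing an odd
    variable other than x_{2n+1} is a derivative [di i]. Only [topO] is neither. *)
Lemma Q_bq_xm al u : (forall i, al i < p ^ t i)%N -> ord_max \notin u -> Q (bq (xm M al u)).
Proof.
move=> hal mu; case: (boolP [exists i, (al i).+1 < p ^ t i]%N) => [/existsP[i hi]|].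
  have -> : xm M al u = d i (xm M (fun k => (al k + (k == i))%N) u).
    rewrite dx_xm ?eqxx ?addn1 //=; apply: xm_ext => k.
    by case: eqP; lia.
  by apply/Q_bq_d/pz_xm.
rewrite negb_exists => /forallP alt.
case: (boolP [exists i : 'I_n, inod i \notin u]) => [/existsP[i iu]|].
  have -> : xm M al u = di i (xi i (xm M al u)).
    by rewrite di_xi eqxx scale1r dxi_xm (negPf iu) end0 subr0.
  by apply: Q_bq_di; rewrite pz_xi pz_xm // end0 oppr0.
rewrite negb_exists => /forallP ut.
rewrite (_ : xm M al u = topO) // /topO.
have -> : u = [set~ ord_max].
  apply/setP => j; rewrite !inE; have [->|jm] := eqVneq j ord_max; first exact: negPf.
  have jn : (j < n)%N.
    by move: (ltn_ord j); rewrite ltnS leq_eqVlt => /orP[/eqP e|//]; case/eqP: jm;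
      apply/val_inj.
  by have := ut (Ordinal jn); rewrite negbK (_ : inod _ = j) //; apply: val_inj.
by apply: xm_ext => i; have := alt i; have := hal i; lia.
Qed.

Lemma Q_bq q : pz q = 0 -> Q (bq q).
Proof.
(* [q - z (pz q)] is the projection onto the elements without x_{2n+1}. It is linear in [q], so the
   induction can run over all [q] without the hypothesis [pz q = 0]. *)
move=> pq; have -> : q = q - z (pz q) by rewrite pq end0 subr0.
elim/xm_ind: q {pq} => [|s a b Ha Hb|al u hal].
- by rewrite !end0 subr0 -[0](scaler0 _ 0) -[_ *: 0]addr0 bqP; apply: QL;
  rewrite /bq !end0 scaler0 !subr0.
- rewrite (_ : _ - _ = s *: (a - z (pz a)) + (b - z (pz b))); last by rewrite !endP; vect_ring.
  by rewrite bqP; apply: QL.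
rewrite e_dxi_xm; have [mu|mu] := boolP (ord_max \in u).
  by rewrite scale1r subrr /bq !end0 scaler0 !subr0.
by rewrite scale0r subr0; apply: Q_bq_xm.
Qed.

Lemma Q_W i b : rho b = 0 -> Q (b - W i b).
Proof.
move=> rb; set f := pz b; set g := b - z f.
have rf : Del f = 0.
  have := pz_ker rb; rewrite rhoE -/f /f pdo_sq end0 scaler0 subr0 addr0 //.
have pf : pz f = 0 by rewrite /f pdo_sq.
have pg : pz g = 0 by rewrite /g endB pz_z pf end0 subr0 subrr.
have Dg : Del g = - (eul f - (n%:R * lam) *: f).
  rewrite /g endB Del_z rf end0 oppr0 subr0.
  by apply/eqP; rewrite -addr_eq0; apply/eqP; rewrite -rhoE.
(* [Del_homotopy] applies to both terms. For f it has no remainder, as Del f = 0; for g the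
   remainder is x_i x_{i'} (eul f - n lambda f), which cancels the second part of
   [bq (x i (xi i f))]. *)
have -> : b - W i b = bq (x i (xi i f)) + Del (x i (xi i g)).
  have -> : b = z f + g by rewrite /g addrC subrK.
  rewrite endD W_z /bq !Del_homotopy rf Dg !end0 subr0 eul_x eul_xi !endB !endN !endB !endZ
    !endD.
  by vect_ring.
by apply: QD; [apply: Q_bq|apply: Q_Del]; rewrite pdo_x pz_xi ?pf ?pg !(end0, oppr0).
Qed.
End NegativeSpan.

(** The weight is 1 - (p^(t_i) - 1) = 2 - p^(t_i), and p^(t_i) vanishes in [F]. *)
Lemma W_topO i : W i topO = 2 *: topO.
Proof.
have h k : (0 < p ^ t k)%N := ltnW (expn_gt1 M k).
rewrite W_xm => [|k]; last by rewrite prednK.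
rewrite !inE inod_max; congr (_ *: _).
have e : ((p ^ t i).-1)%:R + 1 = 0 :> F.
  rewrite natr1 prednK // natrX; have /andP[_ /eqP ->] := dp_char M.
  by rewrite expr0n (gtn_eqF (dp_tgt0 M i)).
by rewrite -[RHS]subr0 -e /=; ring.
Qed.

Lemma deg_le al u : (forall k, al k < p ^ t k)%N ->
  (deg al u <= \sum_i (p ^ t i).-1 + n + 2)%N.
Proof.
move=> hal; rewrite /deg; apply: (@leq_trans (\sum_i (p ^ t i).-1 + n.+1 + 1)); last by lia.
apply: leq_add; last by case: (_ \in _).
apply: leq_add; first by apply: leq_sum => i _; have := hal i; lia.
by have := max_card (mem u); rewrite card_ord.
Qed.

(** With D the degree of [topO], the bracket would have degree 2 D - 2, whereas no monomial exceeds
    degree D + 2; and D >= 3 n > 4. *)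
Lemma ko_bq_topO : ko (bq topO) (bq topO) = 0.
Proof.
have ht : homog (\sum_i (p ^ t i).-1 + n)%N%:Z topO.
  by apply: homog_xm; rewrite /deg cardsC1 card_ord !inE eqxx addn0.
have hb : homog (\sum_i (p ^ t i).-1 + n)%N%:Z (bq topO).
  apply: homogB; first by apply: (homog_eq (homog_z (homog_Del ht))); lia.
  by apply: homogB; [apply: homog_eul|apply: homogZ].
have big : (2 * n <= \sum_i (p ^ t i).-1)%N.
  rewrite (_ : (2 * n = \sum_(i < n) 2)%N); last by rewrite sum_nat_const card_ord mulnC.
  apply: leq_sum => i _.
  have : (p ^ 1 <= p ^ t i)%N by rewrite leq_pexp2l ?(dp_tgt0 M) // (ltn_trans _ (dp_gt2 M)).
  have := dp_gt2 M; lia.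
apply: cf_inj => al u hal; apply: (homog_cf hal (homog_ko hb hb)).
by have := deg_le u hal; have := dp_nge3 M; lia.
Qed.
End Weights.

(** * Simplicity *)

Section Simplicity.
Variables (F : fieldType) (p n : nat) (t : 'I_n -> nat) (M : dp_model F p t) (lam : F).
Implicit Types (a b c f g q : M) (i j k l : 'I_n) (u v : {set 'I_n.+1}).
Local Notation x i := (mul (even_gen M i)).
Local Notation xi i := (mul (odd_gen M (inod i))).
Local Notation xg i := (even_gen M i).
Local Notation xig i := (odd_gen M (inod i)).
Local Notation pz := (dxi M ord_max).
Local Notation sg := (psign (par M)).
Local Notation one := (oneO M).
Local Notation nab := (nab M).
Local Notation nabp := (nabp M).
Local Notation Del := (Del M).
Local Notation rho := (rho M lam).
Local Notation hh := (hh M).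
Local Notation W := (W M).
Local Notation bq := (bq lam).
Local Notation br := (sbracket (par M)).
Local Notation brv := (sbracketv (par M)).
Local Notation hat := (hat (par M)).

Let two0 := two_neq0 M.
Let PP := @par_par _ _ _ _ M.
Let PS := @par_sum _ _ _ _ M.

Lemma DkP s a b : Dk (s *: a + b) = s *: Dk a + Dk b.
Proof. by apply/lfunP => c; rewrite DkPl add_lfunE scale_lfunE. Qed.
Lemma Dk0 : Dk (0 : M) = 0.
Proof. by apply/lfunP => c; rewrite Dk0l zero_lfunE. Qed.
Lemma DkD a b : Dk (a + b) = Dk a + Dk b.
Proof. by rewrite -[a]scale1r DkP !scale1r. Qed.
Lemma DkZ s a : Dk (s *: a) = s *: Dk a.
Proof. by rewrite -[s *: a]addr0 DkP Dk0 addr0. Qed.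
Lemma DkN a : Dk (- a) = - Dk a.
Proof. by rewrite -scaleN1r DkZ scaleN1r. Qed.
Lemma DkB a b : Dk (a - b) = Dk a - Dk b.
Proof. by rewrite DkD DkN. Qed.

Lemma hat_Dk a : hat (Dk a) = - Dk (sg a).
Proof. by apply/lfunP => c; rewrite hatE opp_lfunE sg_Dk sgK. Qed.

Lemma br_Dk a b : br (Dk a) (Dk b) = Dk (ko a b).
Proof.
rewrite brE // ep0E // ep1E // !hat_Dk opprK -DkB -DkD -!DkZ -p1E -p0E'.
apply/lfunP => c; rewrite !(add_lfunE, opp_lfunE, comp_lfunE) opprK.
by apply/eqP; rewrite -subr_eq0; apply/eqP; rewrite -[RHS](Xk_eq0 a b c) /Xk; vect_ring.
Qed.

Lemma nab_DkE i : nab i = Dk (xg i).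
Proof. by apply/lfunP => c; rewrite Dk_x. Qed.
Lemma nabp_DkE i : nabp i = Dk (xig i).
Proof. by apply/lfunP => c; rewrite Dk_xi. Qed.
Lemma br_nab i a : br (nab i) (Dk a) = Dk (nab i a).
Proof. by rewrite nab_DkE br_Dk ko_x -nab_DkE. Qed.
Lemma br_nabp i a : br (nabp i) (Dk a) = Dk (nabp i a).
Proof. by rewrite nabp_DkE br_Dk ko_xi -nabp_DkE. Qed.

Lemma rho_x i : rho (xg i) = 0.
Proof.
rewrite rhoE -x_one Del_x Del_one dxi_one pdo_x dxi_one !end0 scaler0.
by rewrite !(subr0, addr0).
Qed.
Lemma rho_xi i : rho (xig i) = 0.
Proof.
rewrite rhoE -xi_one Del_xi Del_one d_one pz_xi dxi_one !(end0, oppr0) scaler0.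
by rewrite !(subr0, addr0).
Qed.
Lemma rho_hh i : rho (hh i) = one.
Proof. by rewrite rhoE Del_hh pz_hh end0 scaler0 subr0 addr0. Qed.

(* An operator acting on monomials with weights in the prime field satisfies
   [K ^ p = K], so its powers project on its kernel. *)
Lemma prime_weights_split (K : 'End(M)) :
  (forall al u, (forall i, al i < p ^ t i)%N ->
     exists2 w : F, K (xm M al u) = w *: xm M al u & w ^+ p = w) ->
  forall a, K (a - K (iter p.-2 K a)) = 0.
Proof.
move=> hK a; have p2 : p = p.-2.+2 by have := dp_gt2 M; lia.
apply/eqP; rewrite endB subr_eq0 eq_sym; apply/eqP.
rewrite -!iterS -p2; elim/xm_ind: a => [|s a b Ha Hb|al u hal].
- by rewrite iter_fix ?end0.
- have iP m : iter m K (s *: a + b) = s *: iter m K a + iter m K b.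
    by elim: m => //= m ->; rewrite endP.
  by rewrite iP Ha Hb endP.
have [w e wp] := hK al u hal.
have iE m : iter m K (xm M al u) = w ^+ m *: xm M al u.
  by elim: m => [|m IH]; rewrite ?expr0 ?scale1r //= IH endZ e scalerA -exprSr.
by rewrite iE wp e.
Qed.

(** The prime subfield, as the fixed points of Frobenius; no integer representatives have to be
    carried along. *)
Definition primeF (w : F) := w ^+ p = w.
Lemma primeF_nat m : primeF m%:R.
Proof. exact: (pFrobenius_aut_nat (dp_char M)). Qed.
Lemma primeFD w w' : primeF w -> primeF w' -> primeF (w + w').
Proof.
move=> e e'; have := pFrobenius_autD_comm (dp_char M) (mulrC w w').
by rewrite !pFrobenius_autE e e'.
Qed.
Lemma primeFM w w' : primeF w -> primeF w' -> primeF (w * w').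
Proof. by move=> e e'; rewrite /primeF exprMn e e'. Qed.
Lemma primeFN w : primeF w -> primeF (- w).
Proof.
move=> e; rewrite -mulN1r; apply: primeFM => //.
have -> : -1 = (p.-1)%:R :> F; last exact: primeF_nat.
apply/eqP; rewrite eq_sym -addr_eq0 natr1 prednK; last by have := dp_gt2 M; lia.
by have /andP[_] := dp_char M.
Qed.
Lemma primeF_sum (E : 'I_n -> F) : (forall i, primeF (E i)) -> primeF (\sum_i E i).
Proof.
by move=> h; elim/big_ind: _ => //; [exact: (primeF_nat 0)|exact: primeFD].
Qed.

(** The weights (1, -(n - 1), 1, ..., 1) have sum zero and serve unless n - 1 = 0 in [F]; in that
    case (2, -1, 1, ..., 1) has sum n - 1 = 0. *)
Lemma sum_zero_weights : exists c : 'I_n -> F,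
  [/\ forall i, c i != 0, forall i, primeF (c i) & \sum_i c i = 0].
Proof.
have n3 := dp_nge3 M; pose i0 := Ordinal (ltn_trans (isT : 0 < 2)%N n3).
pose i1 := Ordinal (ltn_trans (isT : 1 < 2)%N n3).
pose c (s r : F) i := if i == i0 then s else if i == i1 then r else 1.
have cS s r : \sum_i c s r i = s + r + (n.-2)%:R.
  rewrite (bigD1 i0) //= (bigD1 i1) //= {1}/c eqxx {1}/c eqxx /= addrA; congr (_ + _).
  rewrite (eq_bigr (fun=> 1)) => [|i /andP[/negPf e /negPf e']]; last by rewrite /c e e'.
  rewrite sumr_const; congr (_%:R).
  have := cardC (pred2 i0 i1); rewrite card_ord card2 (_ : i0 != i1 = true) // => e.
  rewrite (@eq_card _ _ [predC pred2 i0 i1]) => [|i]; last by rewrite !inE negb_or.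
  by move: e; move: #|_| => q /=; lia.
have cP s r : primeF s -> primeF r -> forall i, primeF (c s r i).
  by move=> ps pr i; rewrite /c; case: ifP => // _; case: ifP => // _; apply: (primeF_nat 1).
have cN s r : s != 0 -> r != 0 -> forall i, c s r i != 0.
  by move=> ps pr i; rewrite /c; case: ifP => // _; case: ifP => // _; apply: oner_neq0.
have n1 : (n.-1)%:R = (n.-2)%:R + 1 :> F by rewrite natr1; congr (_%:R); lia.
have [e|ne] := eqVneq ((n.-1)%:R : F) 0.
  exists (c 2 (-1)); split.
  - by apply: cN => //; rewrite oppr_eq0 oner_neq0.
  - by apply: cP; [apply: primeF_nat|apply/primeFN/(primeF_nat 1)].
  by rewrite cS -[RHS]e n1; ring.
exists (c 1 (- (n.-1)%:R)); split.
- by apply: cN; rewrite ?oppr_eq0 ?oner_neq0.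
- by apply: cP; [apply: (primeF_nat 1)|apply/primeFN/primeF_nat].
by rewrite cS n1; ring.
Qed.

Lemma third_index i j : exists k, (k != i) && (k != j).
Proof.
apply/existsP; apply: contraLR (dp_nge3 M); rewrite negb_exists -leqNgt => /forallP h.
rewrite -[n]card_ord -cardsT (leq_trans (subset_leq_card (_ : _ \subset [set i; j]))) //.
  by apply/subsetP => k _; have := h k; rewrite negb_and !negbK !inE.
by rewrite cards2; case: eqP.
Qed.

(** * The toral element tau and the verification of the criterion *)

Section Weighted.
Variable c : 'I_n -> F.
Hypothesis c0 : forall i, c i != 0.
Hypothesis cP : forall i, primeF (c i).
Hypothesis cS : \sum_i c i = 0.

Definition wtau : M := \sum_i c i *: hh i.

Lemma Dk_wtau a : Dk wtau a = \sum_i c i *: W i a.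
Proof.
rewrite /wtau; elim/big_rec2: _ => [|i y1 y2 _ <-]; first exact: Dk0l.
by rewrite DkPl.
Qed.

Lemma sg_wtau : sg wtau = - wtau.
Proof. by rewrite /wtau end_sum -sumrN; apply: eq_bigr => i _; rewrite endZ sg_hh scalerN. Qed.
Lemma pz_wtau : pz wtau = 0.
Proof. by rewrite /wtau end_sum big1 // => i _; rewrite endZ pz_hh scaler0. Qed.
Lemma ko_wtau a : ko wtau a = Dk wtau a.
Proof. by rewrite koE sg_wtau endN pz_wtau oppr0 lmul0l scaler0 subr0. Qed.
Lemma rho_wtau : rho wtau = 0.
Proof.
rewrite /wtau end_sum (eq_bigr (fun i => c i *: one)); last by move=> i _; rewrite endZ rho_hh.
by rewrite -scaler_suml cS scale0r.
Qed.
Lemma wtau_rho a : Dk wtau (rho a) = rho (Dk wtau a).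
Proof. by rewrite !Dk_wtau end_sum; apply: eq_bigr => i _; rewrite endZ W_rho. Qed.

Lemma wtau_split a : Dk wtau (a - Dk wtau (iter p.-2 (Dk wtau) a)) = 0.
Proof.
apply: prime_weights_split => al u hal.
exists (\sum_i c i * ((inod i \in u)%:R - (al i)%:R)).
  by rewrite Dk_wtau scaler_suml; apply: eq_bigr => i _; rewrite W_xm // scalerA.
apply: primeF_sum => i; apply: primeFM => //.
by apply: primeFD; [apply: primeF_nat|apply/primeFN/primeF_nat].
Qed.

Lemma wtau_x k a : (forall i, W i a = 0) -> Dk wtau (x k a) = - c k *: x k a.
Proof.
move=> h; rewrite Dk_wtau -(sum_delta k (fun i => - c i *: x k a)); apply: eq_bigr => i _.
rewrite W_x h end0 sub0r eq_sym; have [->|_] := eqVneq k i; rewrite ?scale1r ?scale0r.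
  by rewrite scalerN scaleNr.
by rewrite oppr0 scaler0.
Qed.
Lemma wtau_xi k a : (forall i, W i a = 0) -> Dk wtau (xi k a) = c k *: xi k a.
Proof.
move=> h; rewrite Dk_wtau -(sum_delta k (fun i => c i *: xi k a)); apply: eq_bigr => i _.
rewrite W_xi h end0 add0r eq_sym; have [->|_] := eqVneq k i; rewrite ?scale1r ?scale0r //.
by rewrite scaler0.
Qed.
Lemma wtau_bq q s : Dk wtau q = s *: q -> Dk wtau (bq q) = s *: bq q.
Proof.
move=> e; rewrite -bqZ -e !Dk_wtau.
transitivity (\sum_i bq (c i *: W i q)).
  by apply: eq_bigr => i _; rewrite bqZ W_bq.
by elim/big_rec2: _ => [|i y1 y2 _ ->]; rewrite ?bq0 // bqZ -bqP.
Qed.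

Variable L : {vspace 'End(M)}.
Hypothesis LP : forall f : 'End(M), f \in L <-> exists2 a, rho a = 0 & f = Dk a.

Let N : {vspace 'End(M)} := (\sum_i <[nab i]> + \sum_i <[nabp i]>)%VS.
Local Notation A := (brv <[Dk wtau]> L).

Let LDk a : rho a = 0 -> Dk a \in L. Proof. by move=> ra; apply/LP; exists a. Qed.
Let nabN i : nab i \in N.
Proof. by rewrite (subvP (addvSl _ _)) // (subvP (sumv_sup i _ (subvv _))) ?memv_line. Qed.
Let nabpN i : nabp i \in N.
Proof. by rewrite (subvP (addvSr _ _)) // (subvP (sumv_sup i _ (subvv _))) ?memv_line. Qed.
Let N_sub (S : {vspace 'End(M)}) : (forall i, nab i \in S) -> (forall i, nabp i \in S) ->
  (N <= S)%VS.
Proof.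
move=> h h'; rewrite subv_add; apply/andP; split; apply/subv_sumP => i _; rewrite -memvE.
  exact: h.
exact: h'.
Qed.

Let eigenA a s : rho a = 0 -> Dk wtau a = s *: a -> s != 0 -> Dk a \in A.
Proof.
move=> ra e s0; have -> : a = ko wtau (s^-1 *: a).
  by rewrite ko_wtau endZ e scalerA mulVf // scale1r.
by rewrite -br_Dk memv_brv ?memv_line // LDk // endZ ra scaler0.
Qed.

Let W1 i : W i one = 0. Proof. exact: W_one. Qed.

Lemma simple_SKO : simple_lie_superalgebra (par M) (brv (brv L L) (brv L L)).
Proof.
pose i0 : 'I_n := Ordinal (ltn_trans (isT : 0 < 2)%N (dp_nge3 M)).
apply: (simple_criterion two0 PP PS (L := L) (N := N) (tau := Dk wtau) (h := Dk (hh i0))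
  (G := Dk (bq (topO M))) (u := Dk one)).
- move=> _ /LP[a ra ->]; rewrite hat_Dk -DkN; apply: LDk.
  by rewrite endN sg_ker // oppr0.
- apply/sbracketvP => _ _ /LP[a ra ->] /LP[b rb ->]; rewrite br_Dk; apply: LDk.
  exact: rho_ko.
- by rewrite hat_Dk sg_wtau DkN opprK.
- exact/LDk/rho_wtau.
(* The power p - 1 of ad tau projects onto the nonzero weights, so its power p - 2 provides a
   preimage of that component. *)
- move=> _ /LP[a ra ->]; exists (Dk (iter p.-2 (Dk wtau) a)).
    apply: LDk; elim: p.-2 => //= m IH; by rewrite -wtau_rho IH end0.
  by rewrite br_Dk ko_wtau -DkB br_Dk ko_wtau wtau_split Dk0.
- apply: N_sub => k.
    rewrite nab_DkE; apply: (@eigenA _ (- c k)); rewrite ?oppr_eq0 // ?rho_x //.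
    by rewrite -x_one wtau_x.
  rewrite nabp_DkE; apply: (@eigenA _ (c k)) => //; first exact: rho_xi.
  by rewrite -xi_one wtau_xi.
(* For a third index k, x_{k'} (h_i - h_j) is divergence-free because the two divergences cancel. It
   has weight c_k, and [nab k] removes the factor x_{k'}. *)
- have homog_mem i j : Dk (hh i - hh j) \in brv N A.
    have [k /andP[ki kj]] := third_index i j.
    have hq m : k != m -> dx M k (hh m) = 0.
      by move=> /negPf e; rewrite d_hh e scale0r.
    have hq' m : k != m -> dxi M (inod k) (hh m) = 0.
      by move=> /negPf e; rewrite di_hh e scale0r.
    have -> : hh i - hh j = nab k (xi k (hh i - hh j)).
      rewrite nabE di_xi eqxx scale1r pz_xi !endB !hq' // !pz_hh.
      by rewrite !(subrr, end0, oppr0, subr0).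
    rewrite -br_nab; apply: memv_brv; first exact: nabN.
    apply: (@eigenA _ (c k)) => //.
      rewrite rhoE Del_xi pz_xi !(endB, endN) !Del_hh !hq // !pz_hh.
      by rewrite !(subrr, end0, oppr0, scaler0, subr0, addr0).
    by apply: wtau_xi => m; rewrite endB !W_hh subrr.
  have wtau_mem (S : {vspace 'End(M)}) : (forall i, Dk (hh i - hh i0) \in S) -> Dk wtau \in S.
    (* Subtracting h_{i0} from every term changes nothing, as the coefficients sum to 0. *)
    move=> hS; have -> : wtau = \sum_i c i *: (hh i - hh i0).
      rewrite (eq_bigr (fun i => c i *: hh i - c i *: hh i0)); last by move=> i _;
        rewrite scalerBr.
      by rewrite sumrB -scaler_suml cS scale0r subr0.
    elim/big_rec: _ => [|i y _ IH]; first by rewrite Dk0 mem0v.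
    by rewrite DkP; apply: memvD => //; apply: memvZ.
  by apply: wtau_mem => i.
(* D_KO(1) sends x_{2n+1} to the nonzero constant -2. *)
- move=> /lfunP/(_ (odd_gen M ord_max)); rewrite zero_lfunE Dk_one => /eqP.
  rewrite oppr_eq0 scaler_eq0 (negPf two0) -(lmulr1 (odd_gen M ord_max)) pz_z dxi_one end0
    subr0.
  move=> /eqP e; have := congr1 (cf (fun=> 0%N) set0) e; rewrite cf0 /oneO cf_xm; last first.
    by move=> i; rewrite ltnW ?(expn_gt1 M).
  case: andP => [_ /eqP|[]]; first by rewrite oner_eq0.
  by split=> //; apply/forallP.
- have -> : one = ko (xg i0) (xig i0).
    by rewrite ko_x -xi_one nabE di_xi eqxx scale1r pz_xi !dxi_one !(end0, oppr0, subr0).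
  by rewrite -br_Dk -nab_DkE -nabp_DkE memv_brv.
(* D(1) acts as -2 [pz], so bracketing it with [bq q] returns [Del q]. For j different from k, [Del]
   of x_k h_j is x_k, and similarly x_{k'} up to sign, with q of nonzero weight. *)
- have uq q s : pz q = 0 -> Dk wtau q = s *: q -> s != 0 -> Dk (Del q) \in brv <[Dk one]> A.
    move=> pq e s0; rewrite -(pz_bq lam pq).
    have -> : pz (bq q) = - 2^-1 *: ko one (bq q).
      by rewrite ko_one scalerN scaleNr opprK scalerA mulVf // scale1r.
    rewrite DkZ memvZ // -br_Dk memv_brv ?memv_line // (@eigenA _ s) ?rho_bq //.
    exact: wtau_bq.
  apply: N_sub => k.
    have [j /andP[jk _]] := third_index k k.
    have -> : nab k = Dk (Del (x k (hh j))).
      rewrite Del_x Del_hh x_one di_hh eq_sym (negPf jk) scale0r addr0; exact: nab_DkE.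
    apply: (@uq _ (- c k)); rewrite ?oppr_eq0 //; first by rewrite pdo_x pz_hh end0.
    by apply: wtau_x => i; apply: W_hh.
  have [j /andP[jk _]] := third_index k k.
  have -> : nabp k = - Dk (Del (xi k (hh j))).
    by rewrite Del_xi Del_hh xi_one d_hh eq_sym (negPf jk) scale0r sub0r DkN opprK;
      exact: nabp_DkE.
  rewrite memvN; apply: (@uq _ (c k)) => //; first by rewrite pz_xi pz_hh end0 oppr0.
  by apply: wtau_xi => i; apply: W_hh.
- move=> I IL I0 NI.
  have [a a0 aI] : exists2 a, a != 0 & Dk a \in I.
    have /(subvP IL)/LP[a ra e] := memv_pick I.
    exists a; last by rewrite -e memv_pick.
    apply/eqP => a0; apply: I0; apply/eqP; rewrite -vpick0 e a0 Dk0 //.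
  have [K [s [hs ea]]] := homog_decomp a.
  (* Induction on the number of degree components: an operator of degree -1 kills the component of
     degree 0 and shifts the others down. If all [nab i] and [nabp i] kill [a], it is a nonzero
     constant. *)
  elim: K s a hs ea a0 aI => [|K IH] s a hs ea a0 aI.
    by move: a0; rewrite ea big_ord0 eqxx.
  have low (f : 'End(M)) : (forall r b, homog r b -> homog (r - 1) (f b)) ->
      f a = \sum_(m < K) f (s m.+1).
    move=> hf; rewrite ea end_sum big_ord_recl /= (_ : f (s 0%N) = 0) ?add0r //.
    by apply: (homog_neg (hf _ _ (hs 0%N))).
  have step (f : 'End(M)) : (forall r b, homog r b -> homog (r - 1) (f b)) -> f a != 0 ->
      Dk (f a) \in I -> Dk one \in I.
    move=> hf fa fI; apply: (IH (fun m => f (s m.+1)) (f a)) => //; last exact: low.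
    by move=> m; apply: (homog_eq (hf _ _ (hs m.+1))); lia.
  case: (boolP [exists i, nab i a != 0]) => [/existsP[i ni]|].
    apply: step ni _; first by move=> r b; apply: homog_nab.
    by rewrite -br_nab; apply: (subvP NI); apply: memv_brv.
  rewrite negb_exists => /forallP h.
  case: (boolP [exists i, nabp i a != 0]) => [/existsP[i ni]|].
    apply: step ni _; first by move=> r b; apply: homog_nabp.
    by rewrite -br_nabp; apply: (subvP NI); apply: memv_brv.
  rewrite negb_exists => /forallP h'.
  have [i|i|l el] := @nab_const _ _ _ _ M a; first by apply/eqP; have := h i; rewrite negbK.
    by apply/eqP; have := h' i; rewrite negbK.
  have l0 : l != 0 by apply: contraNneq a0 => l0; rewrite el l0 scale0r.
  by move: aI; rewrite el DkZ => /(memvZ l^-1); rewrite scalerA mulVf // scale1r.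
- by rewrite hat_Dk sg_hh DkN opprK.
(* The projection argument again, now for 1 - ad h, whose kernel is the space of weight 1. *)
- move=> _ /LP[a ra ->]; pose K := (\1 - W i0)%VF.
  have KE b : K b = b - W i0 b by rewrite add_lfunE opp_lfunE id_lfunE.
  exists (Dk (iter p.-2 K a)).
    by apply: LDk; elim: p.-2 => //= m IH; rewrite KE endB -W_rho IH end0 subrr.
  rewrite br_Dk ko_hh -!DkB -KE br_Dk ko_hh; congr Dk; set e := a - _.
  apply/eqP; rewrite eq_sym -subr_eq0 -KE; apply/eqP; apply: prime_weights_split => al u hal.
  exists (1 - ((inod i0 \in u)%:R - (al i0)%:R));
    first by rewrite KE W_xm // [RHS]scalerBl scale1r.
  apply: primeFD; first exact: (primeF_nat 1).
  by apply: primeFN; apply: primeFD; [apply: primeF_nat|apply/primeFN/primeF_nat].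
- by move=> _ /LP[a ra ->]; rewrite br_Dk ko_hh; apply: LDk; rewrite -W_rho ra end0.
- by apply: LDk; apply: rho_bq; apply: pz_topO.
- by rewrite br_Dk ko_hh W_bq W_topO bqZ DkZ.
- by rewrite br_Dk ko_bq_topO Dk0.
move=> _ /LP[b rb ->]; rewrite br_Dk ko_hh -DkB.
apply: (Q_W (lam := lam) (Q := fun a => Dk a \in (brv N L + <[Dk (bq (topO M))]>)%VS)) => //.
- by rewrite Dk0 mem0v.
- by move=> s a a' ha ha'; rewrite DkP; apply: memvD => //; apply: memvZ.
- move=> i a ra; apply: (subvP (addvSl _ _)); rewrite -br_nab memv_brv // LDk //.
- move=> i a ra; apply: (subvP (addvSl _ _)); rewrite -br_nabp memv_brv // LDk //.
by apply: (subvP (addvSr _ _)); rewrite memv_line.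
Qed.
End Weighted.
End Simplicity.

(** [sg a] is the difference of the even and odd parts, so the parity automorphism in [Dk] unfolds
    to the signs (-1)^b of the original definition of D_KO. *)
Lemma Dk_par (F : fieldType) (p n : nat) (t : 'I_n -> nat) (M : dp_model F p t) (a c : M) :
  let D b := \sum_i (mul (dx M i (par M b a)) (dxi M (inod i) c)
      + (-1) ^+ b *: mul (dxi M (inod i) (par M b a)) (dx M i c))
    + (-1) ^+ b *: mul (dxi M ord_max (par M b a)) (eul M c)
    + mul (eul M (par M b a) - 2 *: par M b a) (dxi M ord_max c) in
  Dk a c = D false + D true.
Proof.
move=> D; rewrite /D -{1}(_ : par M false a + par M true a = a); last by rewrite p0E subrK.
have e : psign (par M) (par M false a + par M true a) = par M false a - par M true a.
  by rewrite endD sg_p0 sg_p1.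
rewrite DkE e; move: (par M false a) (par M true a) => a0 a1.
rewrite expr0 expr1 !endB !endD !lmulBl !lmulDl !scale1r !scaleN1r.
under eq_bigr => i _ do rewrite endD endB lmulDl lmulBl.
under [in RHS]eq_bigr => i _ do rewrite scale1r.
under [X in _ = _ + (X + _ + _)]eq_bigr => i _ do rewrite scaleN1r.
rewrite !big_split /= !sumrN scalerDr lmulDl.
by rewrite ?lmulBl ?lmulNl; vect_ring.
Qed.

(** * The coordinate model *)

Section Monomials.
Variables (F : fieldType) (p n : nat) (t : 'I_n -> nat).
Local Notation O := (superO F p t).
Local Notation xm := (@xmon F p n t).

Definition mon (m : monomial p t) : O := xm (fun i => m.1 i) m.2.

Lemma monE m m' : mon m m' = (m' == m)%:R.
Proof.
rewrite ffunE; congr (_ %:R); congr nat_of_bool.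
case: m m' => [a u] [b v] /=; rewrite xpair_eqE; congr (_ && _).
apply/forallP/eqP => [h|-> //]; apply/ffunP => i; apply/val_inj/eqP/h.
Qed.

Lemma superO_sum (a : O) : a = \sum_m a m *: mon m.
Proof.
apply/ffunP => m; rewrite sum_ffunE (bigD1 m) //= ffunE monE eqxx big1 ?addr0.
  by rewrite /GRing.scale /= mulr1.
by move=> k kNm; rewrite ffunE monE eq_sym (negPf kNm) scaler0.
Qed.

Lemma on_monomials_mon (W : lmodType F) (f : monomial p t -> W) m :
  on_monomials f (mon m) = f m.
Proof.
rewrite /on_monomials (bigD1 m) //= monE eqxx scale1r big1 ?addr0 // => k kNm.
by rewrite monE (negPf kNm) scale0r.
Qed.

Lemma superO_ind (P : O -> Prop) :
  P 0 -> (forall c a b, P a -> P b -> P (c *: a + b)) -> (forall m, P (mon m)) ->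
  forall a, P a.
Proof.
move=> P0 PL Pm a; rewrite (superO_sum a); elim/big_rec: _ => // m b _ Pb.
exact: PL.
Qed.

Lemma eq_xmon (alpha beta : 'I_n -> nat) u : alpha =1 beta -> xm alpha u = xm beta u.
Proof.
move=> e; apply/ffunP => m; rewrite !ffunE; congr ((_ && _)%:R).
by apply: eq_forallb => i; rewrite e.
Qed.

Lemma xmon_out (alpha : 'I_n -> nat) u i : (p ^ t i <= alpha i)%N -> xm alpha u = 0.
Proof.
move=> h; apply/ffunP => m; rewrite !ffunE; case: forallP => // /(_ i) /eqP e.
by move: h; rewrite leqNgt -e ltn_ord.
Qed.

Lemma xmon_in (alpha : 'I_n -> nat) u :
  (forall i, alpha i < p ^ t i)%N ->
    exists2 m, xm alpha u = mon m & (forall i, m.1 i = alpha i :> nat) /\ m.2 = u.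
Proof.
move=> h; exists ([ffun i => Ordinal (h i)] : {dffun forall i, 'I_(p ^ t i)}, u).
  by apply: eq_xmon => i /=; rewrite ffunE.
by split=> // i /=; rewrite ffunE.
Qed.

Lemma lfun_monE (W : vectType F) (f : monomial p t -> W) m :
  linfun (on_monomials f) (mon m) = f m.
Proof. by rewrite lfunE /= on_monomials_mon. Qed.

Lemma pdodd_xmon j alpha u :
  pdodd F p t j (xm alpha u) =
  if j \in u then (-1) ^+ #|[set k in u | (k < j)%N]| *: xm alpha (u :\ j) else 0.
Proof.
have [al|[i hi]] := exponent_range p t alpha; last first.
  by rewrite !(xmon_out _ hi) linear0 scaler0 if_same.
have [m -> [e1 e2]] := xmon_in u al; by rewrite /pdodd lfun_monE e2 (eq_xmon _ e1).
Qed.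

Lemma pdeven_xmon r alpha u : (alpha r < p ^ t r)%N ->
  pdeven F p t r (xm alpha u) =
  if alpha r == 0%N then 0 else xm (fun i => (alpha i - (i == r))%N) u.
Proof.
move=> hr; have [al|[i hi]] := exponent_range p t alpha; last first.
  rewrite (xmon_out _ hi) linear0 (@xmon_out _ _ i) ?if_same //.
  by move=> /=; case: eqP => [e|_]; [move: hr; rewrite -e ltnNge hi|rewrite subn0].
have [m -> [e1 e2]] := xmon_in u al.
by rewrite /pdeven lfun_monE e1 e2; case: ifP => // _; apply: eq_xmon => i; rewrite e1.
Qed.

Lemma parity_xmon b alpha u :
  parity F p t b (xm alpha u) = if odd #|u| == b then xm alpha u else 0.
Proof.
have [al|[i hi]] := exponent_range p t alpha; last first.
  by rewrite !(xmon_out _ hi) linear0 if_same.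
have [m -> [e1 e2]] := xmon_in u al.
by rewrite /parity lfun_monE /mon e2.
Qed.

Lemma lmul_xmon alpha u beta v :
  lmul (xm alpha u) (xm beta v) =
  if [disjoint u & v] then
    ((-1) ^+ inversions u v * (\prod_(i < n) 'C(alpha i + beta i, alpha i))%:R) *:
    xm (fun i => (alpha i + beta i)%N) (u :|: v)
  else 0.
Proof.
have [al|[i hi]] := exponent_range p t alpha; last first.
  rewrite !(xmon_out _ hi) /lmul linear0 lfunE /= (@xmon_out _ _ i) ?scaler0 ?if_same //.
  exact: leq_trans (leq_addr _ _).
have [be|[i hi]] := exponent_range p t beta; last first.
  rewrite !(xmon_out _ hi) linear0 (@xmon_out _ _ i) ?scaler0 ?if_same //.
  exact: leq_trans (leq_addl _ _).
have [m -> [e1 e2]] := xmon_in u al.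
have [m' -> [e1' e2']] := xmon_in v be.
rewrite /lmul on_monomials_mon lfun_monE /mulmon e2 e2'; case: ifP => // _.
congr (_ *: _); last by apply: eq_xmon => i; rewrite e1 e1'.
by congr (_ * _%:R); apply: eq_bigr => i _; rewrite e1 e1'.
Qed.

End Monomials.

(** * The coordinate algebra as an instance of the interface *)

Section Instance.
Variables (F : fieldType) (p n : nat) (t : 'I_n -> nat).
Hypothesis charF : p \in [pchar F].
Hypothesis p_gt2 : (2 < p)%N.
Hypothesis n_ge3 : (2 < n)%N.
Hypothesis t_gt0 : forall i : 'I_n, (0 < t i)%N.
Local Notation O := (superO F p t).

(** Written as a sum over at most one monomial, so that [al] needs no proof of being in range; out
    of range the value is 0. *)
Definition coef (al : 'I_n -> nat) (u : {set 'I_n.+1}) (a : O) : F :=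
  \sum_(m : monomial p t | [forall i, m.1 i == al i :> nat] && (m.2 == u)) a m.

Lemma coef_in al u (m : monomial p t) a :
  (forall i, m.1 i = al i :> nat) -> m.2 = u -> coef al u a = a m.
Proof.
move=> e1 e2; rewrite /coef (big_pred1 m) // => k.
case: m e1 e2 => [a1 u1] /= e1 <-; case: k => [a2 u2] /=; rewrite xpair_eqE; congr (_ && _).
apply/forallP/eqP => [h|-> i]; last by rewrite e1.
by apply/ffunP => i; apply/val_inj; rewrite /= (eqP (h i)) e1.
Qed.

Lemma coef_linear al u (s : F) (a b : O) : coef al u (s *: a + b) = s * coef al u a + coef
  al u b.
Proof.
rewrite /coef mulr_sumr -big_split /=; apply: eq_bigr => m _; by rewrite !ffunE.
Qed.

Lemma coef_xmon al u be v : (forall i, al i < p ^ t i)%N ->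
  coef al u (xmon F p t be v) = ([forall i, al i == be i] && (u == v))%:R.
Proof.
move=> hal; have [m _ [e1 e2]] := xmon_in F u hal.
rewrite (coef_in _ e1 e2) ffunE e2; congr (_ && _)%:R.
by apply: eq_forallb => i; rewrite e1.
Qed.

Lemma coef_inj (a : O) :
  (forall al u, (forall i, al i < p ^ t i)%N -> coef al u a = 0) -> a = 0.
Proof.
by move=> h; apply/ffunP => m; rewrite ffunE -(h (fun i => m.1 i) m.2) // (coef_in (m := m)).
Qed.

Lemma superO_xmon_ind (P : O -> Prop) :
  P 0 -> (forall c a b, P a -> P b -> P (c *: a + b)) ->
  (forall al u, (forall i, al i < p ^ t i)%N -> P (xmon F p t al u)) -> forall a, P a.
Proof. by move=> P0 PL Px; apply: superO_ind => // m; apply: Px => i; apply: ltn_ord. Qed.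

Lemma lmul_linear (c : F) (a b : O) : lmul (c *: a + b) = c *: lmul a + lmul b.
Proof. by rewrite /lmul linearP. Qed.

Definition superO_model : dp_model F p t :=
  @DPModel F p n t charF p_gt2 n_ge3 t_gt0 O (xmon F p t) (@lmul F p n t) (pdeven F p t)
    (pdodd F p t) (parity F p t) coef
    (@eq_xmon F p n t) (@xmon_out F p n t) superO_xmon_ind coef_linear
    coef_xmon coef_inj lmul_linear (@lmul_xmon F p n t) (@pdeven_xmon F p n t) (@pdodd_xmon
      F p n t)
    (@parity_xmon F p n t).
Local Notation Mo := superO_model.

Lemma eulerE (a : O) : euler F p t a = eul Mo a.
Proof.
rewrite (eulE (M := Mo) a) /euler sum_lfunE big_sumType /= big_split /=.
by congr (_ + _); apply: eq_bigr => i _; rewrite comp_lfunE.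
Qed.

Lemma DKO_Dk (a : O) : DKO a = Dk (M := Mo) a.
Proof.
apply/lfunP => c; rewrite (Dk_par (M := Mo)) /DKO sum_lfunE big_bool addrC.
have h b : DKO_hom b (parity F p t b a) c = \sum_i (mul (dx Mo i (par Mo b a)) (dxi Mo
  (inod i) c)
      + (-1) ^+ b *: mul (dxi Mo (inod i) (par Mo b a)) (dx Mo i c))
    + (-1) ^+ b *: mul (dxi Mo ord_max (par Mo b a)) (eul Mo c)
    + mul (eul Mo (par Mo b a) - 2 *: par Mo b a) (dxi Mo ord_max c).
  rewrite /DKO_hom /TH_hom !add_lfunE scale_lfunE !comp_lfunE !eulerE; congr (_ + _ + _).
  rewrite sum_lfunE big_sumType /= addrC -big_split; apply: eq_bigr => i _ /=.
  by rewrite !scale_lfunE !comp_lfunE expr0 scale1r.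
by congr (_ + _); apply: h.
Qed.

Lemma divKO_rho lam (a : O) : divKO p t lam a = 2 *: rho Mo lam (psign (par Mo) a).
Proof.
rewrite /divKO sum_lfunE big_bool !scale_lfunE !(comp_lfunE _ (parity _ _ _ _)).
have h (b : O) : (Delta F p t + ((euler F p t - (n%:R * lam) *: \1) \o pdlast F p t))%VF b
  = rho Mo lam b.
  rewrite (rhoE (M := Mo)) add_lfunE comp_lfunE add_lfunE opp_lfunE scale_lfunE id_lfunE
    eulerE.
  congr (_ + _); rewrite (DelE (M := Mo)) /Delta sum_lfunE; apply: eq_bigr => i _.
  by rewrite comp_lfunE.
rewrite !h (psignBE (par Mo)) (endB (rho Mo lam)) /= expr0 expr1.
by rewrite mulN1r mul1r scaleNr scalerBr addrC.
Qed.

(** [divKO] and [rho] have the same kernel: they differ by the invertible factor 2 and by the parity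
    automorphism, which preserves the kernel of [rho]. *)
Lemma SKO2P lam f : f \in SKO2 p t lam <-> exists2 a, rho Mo lam a = 0 & f = Dk (M := Mo) a.
Proof.
have two0 := two_neq0 Mo.
split=> [/memv_imgP[a]|[a ra ->]].
  rewrite memv_ker divKO_rho scaler_eq0 (negPf two0) => /eqP ra ->; exists (a : Mo).
    by have := @sg_ker _ _ _ _ Mo lam _ ra; rewrite (sgK (M := Mo)).
  by rewrite lfunE /= DKO_Dk.
have <- : linfun (@DKO F p n t) a = Dk (M := Mo) a by rewrite lfunE /= DKO_Dk.
rewrite memv_img // memv_ker divKO_rho.
by rewrite (@sg_ker _ _ _ _ Mo lam _ ra) scaler0.
Qed.

Lemma simple_SKO_model lam : simple_lie_superalgebra (parity F p t) (SKO p t lam).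
Proof.
have [c [c0 cP cS]] := sum_zero_weights Mo.
exact: (@simple_SKO F p n t Mo lam c c0 cP cS (SKO2 p t lam) (SKO2P lam)).
Qed.
End Instance.

Theorem theorem3p1 (F : fieldType) (p n : nat) (t : 'I_n -> nat) (lambda : F)
    (charF : p \in [pchar F]) (p_gt3 : (3 < p)%N) (n_ge3 : (3 <= n)%N)
    (t_gt0 : forall i : 'I_n, (0 < t i)%N) :
  simple_lie_superalgebra (@parity F p n t) (@SKO F p n t lambda).
Proof. exact: simple_SKO_model charF (ltnW p_gt3) n_ge3 t_gt0 lambda. Qed.
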